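(* Consider the block model with integer parameter $l>0$. Assume that there exists $q_0\in[0,1/3)$ such that the minimization problem $$\min\left(\frac{p_{l-1,l}+p_{l-1,l+1}}{p_{l-1,l-1}+p_{l-1,l}+p_{l-1,l+1}}(1-9q)-\frac{p_{l+1,l+1}}{p_{l+1,l-1}+p_{l+1,l}+p_{l+1,l+1}}(1-3q)-3q\right)$$ over $q$ and $p=(p_{ij})_{i,j\in I}$, $I=\{l-1,l,l+1\}$, subject to the constraints $$q\in[0,q_0],\qquad \sum_{j\in I}p_{l-1,j}\ge \frac{(1/3)-q_0}{2},\qquad \sum_{j\in I}p_{l+1,j}\ge\frac{(1/3)-q_0}{2},$$ $$\sum_{i,j\in I}p_{ij}=1,\qquad p_{ij}\ge 0\ \text{ for all } i,j\in I,$$ $$2H(q)+(1-4q)\left(\ln(1/9)+H(p)\right)\ge 0,$$ has a strictly positive minimum, denoted $2\epsilon>0$. Then there is a constant $\beta>0$ not depending on $n$ such that, for all $n$ large enough, $$\mathrm{P}\left(\mathrm{E}[\tilde L_n-L_n\mid X,Y]\ge\epsilon\right)\ge 1-e^{-n^\beta}-\mathrm{P}(F^{nc}(q_0)),$$ where $F^{nc}(q_0)$ is the complement of the event $F^n(q_0)$.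
   Context: Block model with parameter $l$. Let $B_{X1},B_{X2},\ldots$ and $B_{Y1},B_{Y2},\ldots$ be two i.i.d. sequences, independent of each other, each variable uniformly distributed on $\{l-1,l,l+1\}$. A block is a maximal run of equal symbols. $X^\infty=X_1X_2\ldots$ is the infinite binary sequence, with symbols alternating from one block to the next, whose $i$-th block has length $B_{Xi}$ and whose first symbol is $0$ or $1$ with probability $1/2$ each; $Y^\infty=Y_1Y_2\ldots$ is defined in the same way from the $B_{Yi}$, independently of $X^\infty$. Put $X=X_1\ldots X_n$, $Y=Y_1\ldots Y_n$, and let $L_n=|\mathrm{LCS}(X,Y)|$ be the length of a longest common subsequence. Random modification: given $X$ and $Y$, choose uniformly at random one block of $X$ among those of length $l-1$ and uniformly at random one block of $X$ among those of length $l+1$, and change the length of both chosen blocks to $l$. The resulting string is $\tilde X$, and $\tilde L_n=|\mathrm{LCS}(\tilde X,Y)|$. (If $X$ has no block of length $l-1$ or no block of length $l+1$, put $\tilde X=X$.) Alignments: an alignment (with gaps) of two strings $x,y$ matches letters of $x$ with equal letters of $y$ in an order-preserving way, all other letters being aligned with gaps; it is optimal if it has the maximal number of matched letter pairs, i.e. if it defines a longest common subsequence. A block is left out by an alignment if all of its letters are aligned with gaps. $F^n(q)$ is the event that every optimal alignment of $X$ and $Y$ leaves out at most a proportion $q$ of the blocks of $X$ and at most a proportion $q$ of the blocks of $Y$. Entropies: $H(q)=q\ln(1/q)+(1-q)\ln(1/(1-q))$ for $q\in[0,1]$, and $H(p)=\sum_{i,j\in I}p_{ij}\ln(1/p_{ij})$,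 with the convention $0\ln(1/0)=0$. *)

(* Defs.v *)
From HB Require Import structures.
From mathcomp Require Import all_boot all_order all_algebra finmap.
From mathcomp Require Import all_classical all_reals all_analysis.

Set Implicit Arguments.
Unset Strict Implicit.
Unset Printing Implicit Defensive.

Import Order.TTheory GRing.Theory Num.Theory.

Local Open Scope nat_scope.

(* A binary string together with its block decomposition: the first symbol
   and the list of the block lengths, the symbols alternating from one block
   to the next. Lengths 0 are allowed because in the block model with l = 1
   a block may be empty; when all lengths are positive the blocks are exactly
   the maximal runs of equal symbols (Lemma runs_letters below). *)
Definition bstring := (bool * seq nat)%type.

Definition letters (u : bstring) : seq bool :=
  flatten (mkseq (fun i => nseq (nth 0 u.2 i) (u.1 (+) odd i)) (size u.2)).

Fixpoint runs (x : seq bool) : seq nat :=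
  if x is a :: x' then
    if x' is b :: _ then
      if a == b then (head 0 (runs x')).+1 :: behead (runs x')
      else 1 :: runs x'
    else [:: 1]
  else [::].

Lemma letters_cons s b bs :
  letters (s, b :: bs) = nseq b s ++ letters (~~ s, bs).
Proof.
rewrite /letters /mkseq /= addbF (iotaDl 1 0) -map_comp.
congr (_ ++ flatten _); apply: eq_map => i /=.
by rewrite addbN addNb.
Qed.

Lemma runs_letters u : all (leq 1) u.2 -> runs (letters u) = u.2.
Proof.
case: u => s bs /=; elim: bs s => [//|b bs IH] s /= /andP[b0 bs0].
rewrite letters_cons; case: b b0 => // b _.
elim: b => [|b IHb]; last by move: IHb; rewrite /= eqxx => ->.
rewrite -[in RHS](IH (~~ s) bs0).
case: bs bs0 {IH} => [|[|c] bs] // _.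
by rewrite letters_cons /=; case: s.
Qed.

(* The default value is used only if the total length of all blocks is less
   than n, a null event in the block model. *)
Definition nblocks (b : nat -> nat) (n : nat) : nat :=
  if pselect (exists k, n <= \sum_(i < k) b i) is left h then ex_minn h else 0.

(* The first n letters of the infinite string with first symbol s and block
   lengths b 0, b 1, ...; its last block may be cut off. *)
Definition prefix_bstring (s : bool) (b : nat -> nat) (n : nat) : bstring :=
  (s, mkseq (fun i => minn (b i) (n - \sum_(j < i) b j)) (nblocks b n)).

Definition lcs (x y : seq bool) : nat :=
  \max_(m : (size x).-tuple bool | subseq (mask m x) y) size (mask m x).

(* An alignment with gaps is given by the list of the pairs of positions of
   its matched letters; all other letters are aligned with gaps. *)
Definition alignment (x y : seq bool) (a : seq (nat * nat)) : bool :=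
  sorted (fun s t => (s.1 < t.1) && (s.2 < t.2)) a &&
  all (fun t => [&& t.1 < size x, t.2 < size y &
                    nth false x t.1 == nth false y t.2]) a.

Definition optimal_alignment (x y : seq bool) (a : seq (nat * nat)) : Prop :=
  alignment x y a /\ forall a', alignment x y a' -> size a' <= size a.

(* Number of blocks none of whose positions belongs to ps; block i occupies
   the positions from sumn (take i bs) to sumn (take i.+1 bs) - 1. *)
Definition left_out (bs : seq nat) (ps : seq nat) : nat :=
  count (fun i => all (fun t => ~~ (sumn (take i bs) <= t < sumn (take i.+1 bs)))
                      ps)
        (iota 0 (size bs)).

Definition blocks_of_length (k : nat) (u : bstring) : seq nat :=
  [seq i <- iota 0 (size u.2) | nth 0 u.2 i == k].

Definition modify (l : nat) (u : bstring) (i j : nat) : bstring :=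
  if (blocks_of_length l.-1 u != [::]) && (blocks_of_length l.+1 u != [::])
  then (u.1, set_nth 0 (set_nth 0 u.2 i l) j l) else u.

Local Open Scope ring_scope.
Local Open Scope classical_set_scope.

(* The event F^n(q), as a property of the strings X = u and Y = v. *)
Definition few_left_out (R : realType) (q : R) (u v : bstring) : Prop :=
  forall a, optimal_alignment (letters u) (letters v) a ->
    (left_out u.2 (unzip1 a))%:R <= q * (size u.2)%:R /\
    (left_out v.2 (unzip2 a))%:R <= q * (size v.2)%:R.

Section Probability.
Context {d : measure_display} {T : measurableType d} {R : realType}.
Variable P : probability T R.

Definition sigma_RV {d'} {T' : measurableType d'} (X : {RV P >-> T'}) :
  set (set T) := preimage_set_system setT X measurable.

Definition mutually_independent (K : choiceType) (S : K -> set (set T)) : Prop :=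
  forall (J : {fset K}) (A : K -> set T),
    (forall k, k \in J -> S k (A k)) ->
    P (\bigcap_(k in [set` J]) A k) = (\prod_(k <- J) fine (P (A k)))%:E.

(* E[Z | U] at the outcome w, for U with countably many values: the mean of Z
   on the event that U takes the value U w. *)
Definition cond_expectation {K : Type} (Z : T -> R) (U : T -> K) (w : T) : R :=
  let A := [set v | U v = U w] in
  fine (\int[P]_(v in A) (Z v)%:E) / fine (P A).

Definition uniform_block_lengths (l : nat) (B : nat -> {RV P >-> nat}) : Prop :=
  forall i k, k \in [:: l.-1; l; l.+1] ->
    P [set w | B i w = k] = (3^-1)%:E.

Definition fair_symbol (s : {RV P >-> bool}) : Prop :=
  forall c, P [set w | s w = c] = (2^-1)%:E.

(* In the family of sigma-algebras, (true, Some i) stands for the i-th block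
   length of X, (true, None) for its first symbol, and likewise with false
   for Y. *)
Definition block_model (l : nat) (BX BY : nat -> {RV P >-> nat})
    (sX sY : {RV P >-> bool}) : Prop :=
  [/\ uniform_block_lengths l BX, uniform_block_lengths l BY,
      fair_symbol sX, fair_symbol sY &
      mutually_independent (fun k : bool * option nat =>
        match k with
        | (true, Some i) => sigma_RV (BX i)
        | (false, Some i) => sigma_RV (BY i)
        | (true, None) => sigma_RV sX
        | (false, None) => sigma_RV sY
        end)].

(* Given X = u and Y = v, the pair (I, J) is uniformly distributed on the
   pairs of a block of u of length l - 1 and a block of u of length l + 1;
   nothing is required when there is no such pair. *)
Definition uniform_choice (l : nat) (X Y : T -> bstring)
    (I J : {RV P >-> nat}) : Prop :=
  forall u v i j, i \in blocks_of_length l.-1 u ->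
    j \in blocks_of_length l.+1 u ->
    P [set w | [/\ X w = u, Y w = v, I w = i & J w = j]] =
    (P [set w | X w = u /\ Y w = v] *
     (((size (blocks_of_length l.-1 u))%:R *
       (size (blocks_of_length l.+1 u))%:R)^-1)%:E)%E.

End Probability.

Section Optimization.
Context {R : realType}.

(* The convention 0 ln(1/0) = 0 holds since 0 is absorbing. *)
Definition entropy (q : R) : R :=
  q * ln (1 / q) + (1 - q) * ln (1 / (1 - q)).

Definition idx (l : nat) : seq nat := [:: l.-1; l; l.+1].

Definition entropy_p (l : nat) (p : nat -> nat -> R) : R :=
  \sum_(i <- idx l) \sum_(j <- idx l) p i j * ln (1 / p i j).

Definition objective (l : nat) (q : R) (p : nat -> nat -> R) : R :=
  (p l.-1 l + p l.-1 l.+1) / (p l.-1 l.-1 + p l.-1 l + p l.-1 l.+1)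
    * (1 - 9 * q)
  - p l.+1 l.+1 / (p l.+1 l.-1 + p l.+1 l + p l.+1 l.+1) * (1 - 3 * q)
  - 3 * q.

(* Only the values p i j with i and j in idx l matter. *)
Definition feasible (l : nat) (q0 q : R) (p : nat -> nat -> R) : Prop :=
  0 <= q <= q0 /\
  \sum_(j <- idx l) p l.-1 j >= (1 / 3 - q0) / 2 /\
  \sum_(j <- idx l) p l.+1 j >= (1 / 3 - q0) / 2 /\
  \sum_(i <- idx l) \sum_(j <- idx l) p i j = 1 /\
  (forall i j, i \in idx l -> j \in idx l -> 0 <= p i j) /\
  2 * entropy q + (1 - 4 * q) * (ln (1 / 9) + entropy_p l p) >= 0.

Definition is_minimum (l : nat) (q0 m : R) : Prop :=
  (exists q p, feasible l q0 q p /\ objective l q p = m) /\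
  (forall q p, feasible l q0 q p -> m <= objective l q p).

End Optimization.

(* Main.v *)
Require Import Defs.
From mathcomp Require Import all_boot all_order all_algebra finmap.
From mathcomp Require Import all_classical all_reals all_analysis.
From mathcomp Require Import measurable_realfun.
From mathcomp Require Import zify ring lra.

(** An optimal alignment cuts the blocks which it does not leave out into
    maximal groups of consecutive blocks of equal colour, and the LCS is the sum
    over the matched groups of the smaller of the two total lengths. Lengthening
    a block of length l - 1 gains 1 if its group is the shorter one; shortening a
    block of length l + 1 costs at most 1, and only if its group is not the longer
    one. Up to O(q0 n) blocks every group is a single block, so the mean gain is
    bounded below by the objective at q0 and at the empirical law p of the pairs
    of lengths of the matched single blocks. For a fixed choice of left-out blocks
    the pairs are independent and uniform on nine values, hence type counting and a
    union bound over these choices give p, up to a small error and an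
    exponentially small probability, the entropy constraint; the objective stays
    above 3 eps / 2 for such p by compactness of the feasible set. *)

Set Implicit Arguments.
Unset Strict Implicit.
Unset Printing Implicit Defensive.

Import Order.TTheory GRing.Theory Num.Theory.
Import numFieldNormedType.Exports.

(** * Matchings of blocks and longest common subsequences *)

Section Combinatorics.
Local Open Scope nat_scope.

(** The union bound cannot run over alignments, which are too numerous. It need not: the groups of
    kept blocks are formed separately in X and in Y, and an alignment matches the k-th group of X
    with the k-th group of Y. So the pairs of single blocks depend only on the two sets of left-out
    blocks; for a and b blocks there are at most e^((a + b) H(q0)) such choices, the source of the
    term 2 H(q). Two consecutive blocks of one group have a left-out block between them. With s and
    s' left-out blocks in X and Y, the groups therefore contain at most s and s' blocks beyond one
    per group. All but 3 s + s' + 2 blocks of X lie in pairs: s are left out, at most 2 s lie in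
    larger groups, s' face larger groups of Y, and 2 are lost to the cut ends. This is the factor 1
    - 4 q. The gain is off by 3 s + 2 only and the loss by s' + 2; compared with about a third of
    the blocks, these errors become 9 q and 3 q in the objective. The numbers of blocks are random,
    so the union also runs over a and b up to 4 n. *)

Fixpoint key_runs {A : Type} (k : A -> bool) (s : seq A) : seq (seq A) :=
  if s is x :: s' then
    if key_runs k s' is (y :: g) :: gs then
      if k x == k y then (x :: y :: g) :: gs else [:: x] :: (y :: g) :: gs
    else [:: [:: x]]
  else [::].

Lemma key_runs_cons A (k : A -> bool) x y s : exists g gs,
  key_runs k (y :: s) = (y :: g) :: gs /\
  key_runs k (x :: y :: s) =
    if k x == k y then (x :: y :: g) :: gs else [:: x] :: (y :: g) :: gs.
Proof.
suff [g [gs E]] : exists g gs, key_runs k (y :: s) = (y :: g) :: gs.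
  by exists g, gs; split=> //; rewrite [LHS]/= -/(key_runs k (y :: s)) E.
rewrite /=; case: (key_runs k s) => [|[|z g] gs]; first by exists [::], [::].
  by exists [::], [::].
by case: ifP => _; [exists (z :: g), gs | exists [::], ((z :: g) :: gs)].
Qed.

Lemma key_runs_nonnil A (k : A -> bool) s : all (fun g => 0 < size g) (key_runs k s).
Proof.
elim: s => [|x [|y s] IH] //.
have [g [gs [E ->]]] := key_runs_cons k x y s.
by move: IH; rewrite E; case: ifP.
Qed.

Lemma flatten_grp A (k : A -> bool) s : flatten (key_runs k s) = s.
Proof.
elim: s => [|x [|y s] IH] //.
have [g [gs [E ->]]] := key_runs_cons k x y s.
by move: IH; rewrite E; case: ifP => _ /= ->.
Qed.

Lemma key_runs_const (A : eqType) (k : A -> bool) s g : g \in key_runs k s ->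
  {in g &, forall x y, k x = k y}.
Proof.
suff : all (fun g => all (fun x => all (fun y => k x == k y) g) g) (key_runs k s).
  by move=> /allP H /H /allP H1 x y /H1 /allP H2 /H2 /eqP.
elim: s => [|x [|y s] IH] //=; first by rewrite eqxx.
have [h [hs [E]]] := key_runs_cons k x y s.
rewrite [key_runs k (x :: _)]/= => ->; move: IH; rewrite E /= eqxx /=.
case: eqP => [xy|_] /andP[/andP[H1 H2] H3] /=; rewrite ?eqxx /= ?H1 ?H2 ?H3 //.
rewrite !xy !eqxx H1 /=; apply/andP; split=> //; apply/allP => z zh.
by have /andP[/eqP -> ->] := allP H2 _ zh; rewrite eqxx.
Qed.

Lemma key_runs_map A B (f : A -> B) (k : B -> bool) s :
  key_runs k (map f s) = map (map f) (key_runs (k \o f) s).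
Proof.
elim: s => [|x s IH] //=.
by rewrite IH; case: (key_runs (k \o f) s) => [|[|y g] gs] //=; case: ifP.
Qed.

(** Matched letters are equal, so the parities of their block indices differ by a constant c. Hence
    both strings cut an alignment into groups at the same places. *)
Lemma key_runs_addb (A : eqType) (k k' : A -> bool) c s :
  {in s, forall x, k' x = c (+) k x} -> key_runs k' s = key_runs k s.
Proof.
elim: s => [|x [|y s] IH] // H.
have [g [gs [E ->]]] := key_runs_cons k x y s.
have [g' [gs' [E' ->]]] := key_runs_cons k' x y s.
have Hx := H x (mem_head _ _).
have Hy := H y; rewrite !inE eqxx orbT in Hy.
have Hs : {in y :: s, forall x, k' x = c (+) k x}.
  by move=> z Hz; apply: H; rewrite inE Hz orbT.
have := IH Hs; rewrite E E' => -[-> ->].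
rewrite Hx Hy //; congr (if _ then _ else _).
by case: (c); case: (k x); case: (k y).
Qed.

(* Equal indices are consecutive in a sorted list, so undup acts inside the runs. *)
Lemma key_runs_undup s : sorted leq s -> key_runs odd (undup s) = map undup (key_runs odd s).
Proof.
elim: s => [|x [|y s] IH] // Hs.
have xy : x <= y by case/andP: Hs.
have Hs' : sorted leq (y :: s) by case/andP: Hs.
have [g [gs [E ->]]] := key_runs_cons odd x y s.
have IH' := IH Hs'; rewrite E in IH'.
have HE : y :: g ++ flatten gs = y :: s by rewrite -(flatten_grp odd (y :: s)) E.
have [xey|nxy] := eqVneq x y.
  subst x; rewrite eqxx.
  have -> : undup [:: y, y & s] = undup (y :: s) by rewrite /= inE eqxx.
  by rewrite IH' /= inE eqxx.
have ltx : x < y by rewrite ltn_neqAle nxy xy.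
have xs : x \notin y :: s.
  rewrite inE negb_or nxy /=; apply/negP => xs.
  have := order_path_min leq_trans Hs' => /allP /(_ _ xs).
  by rewrite leqNgt ltx.
have -> : undup [:: x, y & s] = x :: undup (y :: s).
  by rewrite [LHS]/= (negbTE xs).
have : flatten (key_runs odd (undup (y :: s))) = undup (y :: s) by apply: flatten_grp.
rewrite {1}IH' [map _ _]/= -/(undup (y :: g)).
case Eg : (undup (y :: g)) => [|z g0].
  by have := mem_undup (y :: g) y; rewrite Eg mem_head.
move=> Eu.
have zg : z \in y :: g by rewrite -mem_undup Eg mem_head.
have oz : odd z = odd y.
  apply: (key_runs_const (k := odd) (s := y :: s) (g := y :: g)) => //.
    by rewrite E mem_head.
  by rewrite mem_head.
rewrite -Eu /= in IH' *.
move: IH'; rewrite -/(undup (y :: g)) Eg => ->.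
have xg : x \in y :: g = false.
  by apply: contraNF xs; rewrite -HE -cat_cons mem_cat => ->.
by rewrite oz; case: eqP => _; rewrite /= ?xg -/(undup (y :: g)) Eg.
Qed.

Lemma sum_size_key_runs A (k : A -> bool) s :
  \sum_(g <- key_runs k s) (size g).-1 + size (key_runs k s) = size s.
Proof.
rewrite -[in RHS](flatten_grp k s) size_flatten sumnE big_map -sum1_size -big_split /=.
elim: (key_runs k s) (key_runs_nonnil k s) => [|g gs IH] /=; first by rewrite !big_nil.
by move=> /andP[g0 /IH]; rewrite !big_cons => ->; rewrite addn1 prednK.
Qed.

(* Neighbours in a run have the same parity, hence differ by at least 2. *)
Lemma parity_runs_spread n x s : sorted ltn (x :: s) -> all (gtn n) (x :: s) ->
  (size s).+1 + (size s).+1 + x <= n + size (key_runs odd (x :: s)).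
Proof.
elim: s x => [|y s IH] x; first by move=> _ /= /andP[]; lia.
move=> /= /andP[xy Hs] /andP[xn Hn].
have [g [gs [E]]] := key_runs_cons odd x y s.
rewrite [key_runs odd (x :: _)]/= => ->; have := IH y Hs Hn; rewrite E /=.
case: eqP => [oxy|_] /=; last by lia.
suff : x.+2 <= y by lia.
move: xy; rewrite leq_eqVlt => /orP[/eqP Exy|//].
by move: oxy; rewrite -Exy /=; case: (odd x).
Qed.

Definition total (bs : seq nat) (g : seq nat) : nat := \sum_(i <- g) nth 0 bs i.

Definition score (bs bs' : seq nat) (gs : seq (seq nat * seq nat)) : nat :=
  \sum_(g <- gs) minn (total bs g.1) (total bs' g.2).

(* A list of pairs (g, h) of groups of block indices of u and of v; the order
   of the groups is preserved because the concatenated lists are sorted. *)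
Definition block_matching (u v : bstring) (gs : seq (seq nat * seq nat)) : bool :=
  [&& sorted ltn (flatten (unzip1 gs)), all (gtn (size u.2)) (flatten (unzip1 gs)),
      sorted ltn (flatten (unzip2 gs)), all (gtn (size v.2)) (flatten (unzip2 gs)) &
      all (fun g => all (fun i => all (fun j =>
        u.1 (+) odd i == v.1 (+) odd j) g.2) g.1) gs].

Lemma subseq_leq_lcs z x y : subseq z x -> subseq z y -> size z <= lcs x y.
Proof.
move=> /subseqP[m sm ->] zy; rewrite /lcs.
have sm' : size m == size x by apply/eqP.
exact: (leq_bigmax_cond (F := fun m : (size x).-tuple bool => size (mask m x)) (Tuple sm')).
Qed.

Lemma lcs_witness x y : exists z, [/\ subseq z x, subseq z y & size z = lcs x y].
Proof.
rewrite /lcs.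
have [m Hm ->] : {m : (size x).-tuple bool | subseq (mask m x) y &
   \max_(m : (size x).-tuple bool | subseq (mask m x) y) size (mask m x) = size (mask m x)}.
  apply: eq_bigmax_cond; apply/card_gt0P.
  have s0 : size (nseq (size x) false) == size x by rewrite size_nseq.
  by exists (Tuple s0); rewrite unfold_in /= mask_false sub0seq.
by exists (mask m x); split=> //; apply: mask_subseq.
Qed.

Lemma subseq_flatten (A : eqType) (s t : seq (seq A)) : subseq s t ->
  subseq (flatten s) (flatten t).
Proof.
elim: t s => [|y t IH] s /=; first by move/eqP ->.
case: s => [|x s]; first by rewrite sub0seq.
case: eqP => [-> H|_ H] /=; first by apply: cat_subseq => //; apply: IH.
by apply: (subseq_trans (IH _ H)); apply: suffix_subseq.
Qed.

Lemma sorted_ltn_filter_iota n r : sorted ltn r -> all (gtn n) r ->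
  r = [seq i <- iota 0 n | i \in r].
Proof.
move=> sr ar; apply: (irr_sorted_eq ltn_trans ltnn) => //.
  by apply: sorted_filter; [exact: ltn_trans | exact: iota_ltn_sorted].
move=> i; rewrite mem_filter mem_iota /=; case: (boolP (i \in r)) => //= ir.
by rewrite add0n; have /= -> := allP ar _ ir.
Qed.

Definition letters_at (u : bstring) (r : seq nat) : seq bool :=
  flatten [seq nseq (nth 0 u.2 i) (u.1 (+) odd i) | i <- r].

Lemma letters_at_subseq u r : sorted ltn r -> all (gtn (size u.2)) r ->
  subseq (letters_at u r) (letters u).
Proof.
move=> Hs Ha; apply: subseq_flatten; apply: map_subseq.
by rewrite (sorted_ltn_filter_iota Hs Ha); exact: filter_subseq.
Qed.

Lemma letters_at_const u c g : {in g, forall i, u.1 (+) odd i = c} ->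
  letters_at u g = nseq (total u.2 g) c.
Proof.
rewrite /letters_at /total; elim: g => [|i g IH] H; first by rewrite big_nil.
rewrite big_cons /= IH ?nseqD ?H ?mem_head // => j jg.
by apply: H; rewrite inE jg orbT.
Qed.

Lemma subseq_nseq m n (c : bool) : m <= n -> subseq (nseq m c) (nseq n c).
Proof. by move=> mn; rewrite -(subnKC mn) nseqD prefix_subseq. Qed.

Lemma score_leq_lcs u v gs : block_matching u v gs ->
  score u.2 v.2 gs <= lcs (letters u) (letters v).
Proof.
move=> /and5P[s1 a1 s2 a2 /allP Hc].
(* The colour is read off the first block of the group in [u]. If that group is empty, the minimum
   is 0 and the default of [head] is harmless. *)
pose z := flatten [seq nseq (minn (total u.2 g.1) (total v.2 g.2))
                           (u.1 (+) odd (head 0 g.1)) | g <- gs].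
have -> : score u.2 v.2 gs = size z.
  rewrite /z size_flatten sumnE /score /shape -map_comp big_map.
  by apply: eq_bigr => g _ /=; rewrite size_nseq.
have cat w r : letters_at w (flatten r) = flatten [seq letters_at w g | g <- r].
  by elim: r => //= g r <-; rewrite /letters_at map_cat flatten_cat.
have fl (A B : eqType) (f f' : A -> seq B) s : (forall x, x \in s -> subseq (f x) (f' x)) ->
    subseq (flatten (map f s)) (flatten (map f' s)).
  elim: s => //= x s IH H; apply: cat_subseq; first by apply: H; rewrite mem_head.
  by apply: IH => y ys; apply: H; rewrite inE ys orbT.
apply: subseq_leq_lcs.
  apply: subseq_trans (letters_at_subseq s1 a1).
  rewrite cat -map_comp; apply: fl => -[[|i g] h] gin /=.
    by rewrite /total big_nil min0n.
  case: h gin => [|j h] gin; first by rewrite /total big_nil minn0 sub0seq.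
  rewrite (letters_at_const (c := u.1 (+) odd i)); first exact/subseq_nseq/geq_minl.
  have /allP H := Hc _ gin; move=> k kg.
  have /= /andP[/eqP -> _] := H _ kg.
  by have /= /andP[/eqP -> _] := H i (mem_head _ _).
apply: subseq_trans (letters_at_subseq s2 a2).
rewrite cat -map_comp; apply: fl => -[[|i g] h] gin /=.
  by rewrite /total big_nil min0n sub0seq.
rewrite (letters_at_const (c := u.1 (+) odd i)); first exact/subseq_nseq/geq_minr.
move=> k kh; have /allP/(_ i (mem_head _ _))/allP/(_ _ kh)/eqP H := Hc _ gin.
by [].
Qed.

Definition aligned_blocks (bs ps : seq nat) : seq nat :=
  [seq i <- iota 0 (size bs) |
    ~~ all (fun t => ~~ (sumn (take i bs) <= t < sumn (take i.+1 bs))) ps].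

Lemma size_aligned_blocks bs ps : left_out bs ps + size (aligned_blocks bs ps) = size bs.
Proof. by rewrite /left_out /aligned_blocks size_filter count_predC size_iota. Qed.

Lemma sorted_aligned_blocks bs ps : sorted ltn (aligned_blocks bs ps).
Proof. by apply: sorted_filter; [exact: ltn_trans | exact: iota_ltn_sorted]. Qed.

Lemma aligned_blocks_bound bs ps : all (gtn (size bs)) (aligned_blocks bs ps).
Proof. by apply/allP => i; rewrite mem_filter mem_iota /= => /andP[]. Qed.

(** Identifies the interval test of [left_out] with [reshape_index], which is monotone and so
    compatible with forming groups. *)
Lemma in_block bs t i : t < sumn bs -> i < size bs ->
  (sumn (take i bs) <= t < sumn (take i.+1 bs)) = (reshape_index bs t == i).
Proof.
move=> ts ib; rewrite (take_nth 0 ib) sumn_rcons.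
apply/idP/eqP => [/andP[t1 t2]|<-].
  rewrite -(flatten_indexKl (sh := bs) (r := i) (c := t - sumn (take i bs))); last by lia.
  by rewrite /flatten_index subnKC.
have := reshape_offsetP ts; have := reshape_indexK bs t; rewrite /flatten_index.
by lia.
Qed.

Lemma size_letters u : size (letters u) = sumn u.2.
Proof.
rewrite /letters size_flatten /shape -map_comp; congr sumn.
rewrite -[RHS](mkseq_nth 0) /mkseq; apply: eq_map => i /=; exact: size_nseq.
Qed.

Lemma nth_letters u t : t < sumn u.2 ->
  nth false (letters u) t = u.1 (+) odd (reshape_index u.2 t).
Proof.
move=> tu.
have sh : shape (mkseq (fun i => nseq (nth 0 u.2 i) (u.1 (+) odd i)) (size u.2)) = u.2.
  rewrite /shape -map_comp -[RHS](mkseq_nth 0) /mkseq; apply: eq_map => i /=.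
  exact: size_nseq.
rewrite /letters nth_flatten sh nth_mkseq ?reshape_indexP // nth_nseq.
by rewrite reshape_offsetP.
Qed.

Lemma homo_reshape_index bs : {homo reshape_index bs : x y / x <= y}.
Proof. by move=> x y; rewrite (reshape_leq bs) => /orP[/ltnW|/andP[/eqP ->]]. Qed.

Lemma aligned_blocks_undup bs ps : sorted leq ps -> all (gtn (sumn bs)) ps ->
  aligned_blocks bs ps = undup (map (reshape_index bs) ps).
Proof.
move=> sps aps.
have sm : sorted leq (map (reshape_index bs) ps).
  exact: (homo_sorted (@homo_reshape_index bs)).
apply: (irr_sorted_eq ltn_trans ltnn).
- exact: sorted_aligned_blocks.
- rewrite ltn_sorted_uniq_leq undup_uniq /=.
  exact: (subseq_sorted leq_trans (undup_subseq _)).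
move=> i; rewrite mem_undup mem_filter mem_iota /= add0n -has_predC.
apply/andP/mapP => [[/hasP[t tp] /= + ib]|[t tp ->]].
  by rewrite negbK in_block //; [move=> /eqP <-; exists t | exact: (allP aps)].
have tb := allP aps _ tp; split; last exact: reshape_indexP.
by apply/hasP; exists t => //=; rewrite negbK in_block ?reshape_indexP.
Qed.

Lemma size_sum_count (A B : eqType) (f : A -> B) (s : seq A) :
  size s = \sum_(i <- undup (map f s)) count (fun t => f t == i) s.
Proof.
under eq_bigr do rewrite -sum1_count big_mkcond /=.
rewrite exchange_big -sum1_size /= big_seq [RHS]big_seq.
apply: eq_bigr => t ts; rewrite -big_mkcond sum1_count.
rewrite (eq_count (a2 := pred1 (f t))); last by move=> i /=; rewrite eq_sym.
by rewrite count_uniq_mem ?undup_uniq // mem_undup map_f.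
Qed.

(** The positions of [ps] inside one block are distinct and lie in an interval as long as that
    block. *)
Lemma size_leq_total bs ps : uniq ps -> all (gtn (sumn bs)) ps ->
  size ps <= total bs (undup (map (reshape_index bs) ps)).
Proof.
move=> ups aps; rewrite (size_sum_count (reshape_index bs)) /total.
rewrite big_seq [X in _ <= X]big_seq; apply: leq_sum => i.
rewrite mem_undup => /mapP[t0 tp it]; rewrite -size_filter.
have ib : i < size bs by rewrite it reshape_indexP //; exact: (allP aps).
rewrite -[X in _ <= X](size_iota (sumn (take i bs))).
apply: uniq_leq_size; first exact: filter_uniq.
move=> t; rewrite mem_filter => /andP[+ /(allP aps) tb].
by rewrite -in_block // (take_nth 0 ib) sumn_rcons mem_iota.
Qed.

Lemma mem_subseq_flatten (A : eqType) (g : seq A) gs : g \in gs ->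
  subseq g (flatten gs).
Proof.
elim: gs => //= h gs IH; rewrite inE => /orP[/eqP ->|/IH H].
  exact: prefix_subseq.
exact/(subseq_trans H)/suffix_subseq.
Qed.

(** The list of matched pairs is cut where the colour changes. The block indices met by one piece
    form a group on either side, and the piece is no longer than either total because its positions
    are distinct. *)
Lemma alignment_matching u v a : alignment (letters u) (letters v) a ->
  exists gs, [/\ block_matching u v gs,
    unzip1 gs = key_runs odd (aligned_blocks u.2 (unzip1 a)),
    unzip2 gs = key_runs odd (aligned_blocks v.2 (unzip2 a)) & size a <= score u.2 v.2 gs].
Proof.
case/andP=> sa aa.
have s1 : sorted ltn (unzip1 a).
  by apply: homo_sorted sa => -[i j] [i' j'] /andP[].
have s2 : sorted ltn (unzip2 a).
  by apply: homo_sorted sa => -[i j] [i' j'] /andP[].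
have s1' : sorted leq (unzip1 a) by move: s1; rewrite ltn_sorted_uniq_leq => /andP[].
have s2' : sorted leq (unzip2 a) by move: s2; rewrite ltn_sorted_uniq_leq => /andP[].
have a1 : all (gtn (sumn u.2)) (unzip1 a).
  by apply/allP => _ /mapP[t ta ->]; have /and3P[] := allP aa _ ta; rewrite size_letters.
have a2 : all (gtn (sumn v.2)) (unzip2 a).
  by apply/allP => _ /mapP[t ta ->]; have /and3P[] := allP aa _ ta; rewrite !size_letters.
pose f (t : nat * nat) := reshape_index u.2 t.1.
pose f' (t : nat * nat) := reshape_index v.2 t.2.
have col t : t \in a -> odd (f' t) = (u.1 (+) v.1) (+) odd (f t).
  move=> ta; have /and3P[t1 t2] := allP aa _ ta.
  rewrite !size_letters in t1 t2; rewrite !nth_letters // => /eqP.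
  rewrite /f /f'; case: (odd _); case: (odd _); by case: (u.1); case: (v.1).
pose G := key_runs (odd \o f) a.
have G' : key_runs (odd \o f') a = G.
  by apply: (key_runs_addb (c := u.1 (+) v.1)) => t /col.
have gr1 : key_runs odd (aligned_blocks u.2 (unzip1 a)) = [seq undup (map f g) | g <- G].
  rewrite aligned_blocks_undup // key_runs_undup; last exact: (homo_sorted (@homo_reshape_index u.2)).
  by rewrite -map_comp key_runs_map -map_comp.
have gr2 : key_runs odd (aligned_blocks v.2 (unzip2 a)) = [seq undup (map f' g) | g <- G].
  rewrite aligned_blocks_undup // key_runs_undup; last exact: (homo_sorted (@homo_reshape_index v.2)).
  by rewrite -map_comp key_runs_map -map_comp G'.
exists [seq (undup (map f g), undup (map f' g)) | g <- G].
have e1 : unzip1 [seq (undup (map f g), undup (map f' g)) | g <- G]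
    = key_runs odd (aligned_blocks u.2 (unzip1 a)) by rewrite gr1 /unzip1 -map_comp.
have e2 : unzip2 [seq (undup (map f g), undup (map f' g)) | g <- G]
    = key_runs odd (aligned_blocks v.2 (unzip2 a)) by rewrite gr2 /unzip2 -map_comp.
split=> //.
  rewrite /block_matching e1 e2 !flatten_grp !sorted_aligned_blocks !aligned_blocks_bound /=.
  apply/allP => _ /mapP[g gG ->] /=.
  apply/allP => i; rewrite mem_undup => /mapP[t tg ->].
  apply/allP => j; rewrite mem_undup => /mapP[t' tg' ->].
  have ga : {subset g <= a}.
    move=> z; apply: mem_subseq; rewrite -(flatten_grp (odd \o f) a).
    exact: mem_subseq_flatten.
  have /= ott := key_runs_const gG tg' tg.
  by rewrite col ?ga // ott; case: (odd _); case: (u.1); case: (v.1).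
rewrite -{1}(flatten_grp (odd \o f) a) size_flatten sumnE big_map /score big_map.
rewrite big_seq [X in _ <= X]big_seq; apply: leq_sum => g gG /=.
have ga : subseq g a.
  by rewrite -(flatten_grp (odd \o f) a); exact: mem_subseq_flatten.
rewrite leq_min; apply/andP; split.
  rewrite -(size_map fst) /f map_comp; apply: size_leq_total.
    exact: (subseq_uniq (map_subseq _ ga) (sorted_uniq ltn_trans ltnn s1)).
  by apply/allP => t /(mem_subseq (map_subseq _ ga)) /(allP a1).
rewrite -(size_map snd) /f' map_comp; apply: size_leq_total.
  exact: (subseq_uniq (map_subseq _ ga) (sorted_uniq ltn_trans ltnn s2)).
by apply/allP => t /(mem_subseq (map_subseq _ ga)) /(allP a2).
Qed.

Lemma subseq_positions (z x : seq bool) : subseq z x ->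
  exists ps, [/\ sorted ltn ps, all (gtn (size x)) ps & map (nth false x) ps = z].
Proof.
case/subseqP => m sm ->; exists (mask m (iota 0 (size x))); split.
- exact: (subseq_sorted ltn_trans (mask_subseq _ _) (iota_ltn_sorted _ _)).
- by apply/allP => t /mem_mask; rewrite mem_iota.
by rewrite map_mask map_nth_iota0 ?take_size.
Qed.

Lemma common_subseq_alignment z x y : subseq z x -> subseq z y ->
  exists2 a, alignment x y a & size a = size z.
Proof.
move=> /subseq_positions[ps [s1 a1 e1]] /subseq_positions[qs [s2 a2 e2]].
have sp : size ps = size z by rewrite -e1 size_map.
have sq : size qs = size z by rewrite -e2 size_map.
exists (zip ps qs); last by rewrite size_zip sp sq minnn.
have su1 : unzip1 (zip ps qs) = ps by rewrite unzip1_zip // sp sq.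
have su2 : unzip2 (zip ps qs) = qs by rewrite unzip2_zip // sp sq.
apply/andP; split.
  apply/(sortedP (0, 0)) => i; rewrite size1_zip ?sp ?sq // => ilt.
  rewrite !nth_zip ?sp ?sq //=; apply/andP; split.
    by move/(sortedP 0): s1; apply; rewrite sp.
  by move/(sortedP 0): s2; apply; rewrite sq.
apply/(all_nthP (0, 0)) => i; rewrite size1_zip ?sp ?sq // => ilt.
rewrite !nth_zip ?sp ?sq //=; apply/and3P; split.
- by apply: (allP a1); rewrite mem_nth ?sp.
- by apply: (allP a2); rewrite mem_nth ?sq.
by rewrite -(nth_map 0 false) ?sp // e1 -(nth_map 0 false) ?sq // e2.
Qed.

(** Alignments have at most [size x] pairs, so a longest one exists; comparison with the alignment
    given by a longest common subsequence bounds its size from below. *)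
Lemma optimal_alignment_exists x y :
  exists2 a, optimal_alignment x y a & lcs x y <= size a.
Proof.
have [z [zx zy <-]] := lcs_witness x y.
have [a0 al0 <-] := common_subseq_alignment zx zy.
have bound a : alignment x y a -> size a <= size x.
  case/andP=> sa aa; rewrite -(size_map fst) -(size_iota 0 (size x)).
  apply: uniq_leq_size.
    apply: (sorted_uniq ltn_trans ltnn); apply: homo_sorted sa.
    by move=> [? ?] [? ?] /andP[].
  by move=> _ /mapP[t ta ->]; rewrite mem_iota; have /and3P[] := allP aa _ ta.
pose Q k := `[< exists2 a, alignment x y a & size a = k >].
have exQ : exists k, Q k by exists (size a0); apply/asboolP; exists a0.
have bQ k : Q k -> k <= size x by move=> /asboolP[a /bound ? <-].
case: (ex_maxnP exQ bQ) => k /asboolP[a al sa] mx.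
exists a; last by rewrite sa; apply: mx; apply/asboolP; exists a0.
by split=> // a' al'; rewrite sa; apply: mx; apply/asboolP; exists a'.
Qed.

Definition singletons (g : seq nat * seq nat) : bool :=
  (size g.1 == 1) && (size g.2 == 1).

(* The last block of each string is excluded since it may be cut off. *)
Definition pairs (a b : nat) (gs : seq (seq nat * seq nat)) : seq (nat * nat) :=
  [seq t <- [seq (head 0 g.1, head 0 g.2) | g <- gs & singletons g] |
    (t.1.+1 < a) && (t.2.+1 < b)].

Lemma count_pairs (Q : pred (nat * nat)) a b gs :
  count Q (pairs a b gs) =
  \sum_(g <- gs) (singletons g && [&& (head 0 g.1).+1 < a, (head 0 g.2).+1 < b &
     Q (head 0 g.1, head 0 g.2)]).
Proof.
rewrite /pairs -sum1_count big_filter_cond big_map big_filter_cond.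
rewrite big_mkcond /=; apply: eq_bigr => g _.
by case: (singletons g) => //=; rewrite andbA; case: (_ && _); case: (Q _).
Qed.

Definition ngain (l : nat) (bs bs' : seq nat) gs : nat :=
  \sum_(g <- gs) (total bs g.1 < total bs' g.2) *
     count (fun i => nth 0 bs i == l.-1) g.1.

Definition nloss (l : nat) (bs bs' : seq nat) gs : nat :=
  \sum_(g <- gs) (total bs g.1 <= total bs' g.2) *
     count (fun i => nth 0 bs i == l.+1) g.1.

Definition npairs (bs bs' : seq nat) gs (x y : nat) : nat :=
  count (fun t => (nth 0 bs t.1 == x) && (nth 0 bs' t.2 == y))
    (pairs (size bs) (size bs') gs).

Lemma count_flatten_sum (A : Type) (Q : pred A) (gs : seq (seq A)) :
  count Q (flatten gs) = \sum_(g <- gs) count Q g.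
Proof. by rewrite count_flatten sumnE big_map. Qed.

Lemma count_complement (Q : pred nat) n r : sorted ltn r -> all (gtn n) r ->
  count Q (iota 0 n) <= count Q r + (n - size r).
Proof.
move=> sr ar.
have Er := sorted_ltn_filter_iota sr ar.
have := count_predC (mem r) (iota 0 n); rewrite size_iota => En.
have Esz : size r = count (mem r) (iota 0 n) by rewrite {1}Er size_filter.
have -> : count Q (iota 0 n) = count (predI Q (mem r)) (iota 0 n) +
    count (predI Q (predC (mem r))) (iota 0 n).
  by elim: (iota 0 n) => //= i s ->; case: (Q i); case: (i \in r) => /=; lia.
have -> : count Q r = count (predI Q (mem r)) (iota 0 n).
  by rewrite {1}Er count_filter.
suff : count (predI Q (predC (mem r))) (iota 0 n) <= count (predC (mem r)) (iota 0 n).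
  by lia.
by apply: sub_count => i /= /andP[].
Qed.

Lemma sum_mem_leq1 x (gs : seq (seq nat)) : sorted ltn (flatten gs) ->
  \sum_(g <- gs) (x \in g) <= 1.
Proof.
move=> /(sorted_uniq ltn_trans ltnn) ug.
apply: (@leq_trans (count_mem x (flatten gs))).
  rewrite count_flatten_sum; apply: leq_sum => g _.
  by case: (boolP (x \in g)) => //; rewrite -has_pred1 has_count.
by rewrite count_uniq_mem // leq_b1.
Qed.

Lemma sumnD (A : Type) (F G : A -> nat) (s : seq A) :
  \sum_(g <- s) (F g + G g) = \sum_(g <- s) F g + \sum_(g <- s) G g.
Proof. exact: big_split. Qed.

(** Bookkeeping: x counts in the pairs, a in the aligned blocks, b and c are the excesses of the
    groups over single blocks in [u] and [v], d and e stand for the two last blocks, and s for the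
    left-out ones. *)
Fact pair_sum_bound (x a b c d e N s s' : nat) : e <= 1 -> d <= 1 -> c <= s' -> b <= s ->
  a <= x + (b + b) + c + d + e -> N <= a + s -> N <= x + 3 * s + s' + 2.
Proof. by lia. Qed.

Fact pair_sum_bound2 (x y a b d e N s : nat) : e <= 1 -> d <= 1 -> b <= s ->
  a <= x + y + (b + b) + d + e -> N <= a + s -> N <= x + y + 3 * s + 2.
Proof. by lia. Qed.

Fact last_or i n : i < n -> (i.+1 < n) || (n.-1 == i).
Proof. by lia. Qed.

(** * Gains, losses and single pairs in an optimal matching *)

Section BlockGroups.
Variables (l : nat) (u v : bstring) (gs : seq (seq nat * seq nat)).
Hypothesis bm : block_matching u v gs.
Hypothesis ne1 : all (fun g => 0 < size g) (unzip1 gs).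
Hypothesis ne2 : all (fun g => 0 < size g) (unzip2 gs).
Hypothesis l1 : 1 < l.
Hypothesis u1 : forall i, i < size u.2 -> 0 < nth 0 u.2 i <= l.+1.
Hypothesis v1 : forall i, i < size v.2 -> 0 < nth 0 v.2 i <= l.+1.
Hypothesis u2 : forall i, i.+1 < size u.2 -> l.-1 <= nth 0 u.2 i.
Hypothesis v2 : forall i, i.+1 < size v.2 -> l.-1 <= nth 0 v.2 i.
Variables (s s' : nat).
Hypothesis es : size u.2 - size (flatten (unzip1 gs)) = s.
Hypothesis m1 : \sum_(g <- gs) (size g.1).-1 <= s.
Hypothesis m2 : \sum_(g <- gs) (size g.2).-1 <= s'.

Lemma group_bounds (g : seq nat * seq nat) : g \in gs -> [/\ 0 < size g.1, 0 < size g.2,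
  {in g.1, forall i, i < size u.2}, {in g.2, forall i, i < size v.2} & uniq g.2].
Proof.
move=> gg; have g1 : g.1 \in unzip1 gs by apply: map_f.
have g2 : g.2 \in unzip2 gs by apply: map_f.
have [s1 a1 s2 a2 _] := and5P bm.
have h1 := mem_subseq_flatten g1; have h2 := mem_subseq_flatten g2.
split; [exact: (allP ne1) | exact: (allP ne2) | | |].
- by move=> i /(mem_subseq h1) /(allP a1).
- by move=> i /(mem_subseq h2) /(allP a2).
exact: (subseq_uniq h2 (sorted_uniq ltn_trans ltnn s2)).
Qed.

Lemma sum_group (F G : (seq nat * seq nat) -> nat) :
  (forall g, g \in gs -> F g <= G g) -> \sum_(g <- gs) F g <= \sum_(g <- gs) G g.
Proof. by move=> H; rewrite big_seq [X in _ <= X]big_seq; exact: leq_sum. Qed.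


Lemma sum_mem1 x : \sum_(g <- gs) (x \in g.1) <= 1.
Proof.
have [s1 _ _ _ _] := and5P bm.
by have := sum_mem_leq1 x s1; rewrite big_map.
Qed.

Lemma sum_mem2 x : \sum_(g <- gs) (x \in g.2) <= 1.
Proof.
have [_ _ s2 _ _] := and5P bm.
by have := sum_mem_leq1 x s2; rewrite big_map.
Qed.

(** A block of [u] outside the pairs is left out (at most s), or lies in a group of k >= 2 blocks,
    where k <= 2 (k - 1) sums to 2 s, or is single and faces k >= 2 blocks of [v], where 1 <= k - 1
    sums to s', or is in a pair with a last block, at most twice. *)
Lemma count_in_pairs (Q : pred nat) :
  count Q (iota 0 (size u.2)) <=
  count (fun t => Q t.1) (pairs (size u.2) (size v.2) gs) + 3 * s + s' + 2.
Proof.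
have [s1 a1 s2 a2 _] := and5P bm.
have := count_complement Q s1 a1; rewrite es count_flatten_sum big_map.
rewrite count_pairs.
suff : \sum_(g <- gs) count Q g.1 <=
  \sum_(g <- gs) ((singletons g && [&& (head 0 g.1).+1 < size u.2, (head 0 g.2).+1 < size v.2 &
     Q (head 0 g.1)]) + ((size g.1).-1 + (size g.1).-1) + (size g.2).-1 + ((size u.2).-1 \in g.1)
     + ((size v.2).-1 \in g.2)).
  rewrite !sumnD /=.
  exact: (pair_sum_bound (sum_mem2 _) (sum_mem1 _) m2 m1).
apply: sum_group => -[g h] /group_bounds /= [g0 h0 gi hi _].
have := count_size Q g; rewrite /singletons /=.
case: g g0 gi => [//|i [|i' g]] _ gi /=; last first.
  by move: (Q i + _) (size g) (size h).-1 (_ \in _) (_ \in _); clear; lia.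
case: h h0 hi => [//|j [|j' h]] _ hi /=.
  have := last_or (gi i (mem_head _ _)); have := last_or (hi j (mem_head _ _)).
  rewrite !inE addn0; case: (i.+1 < size u.2); case: (j.+1 < size v.2);
  by case: (_ == i); case: (_ == j); case: (Q i).
by move: (Q i) (_ \in _) (_ \in _); clear; lia.
Qed.

Lemma gain_lower : npairs u.2 v.2 gs l.-1 l + npairs u.2 v.2 gs l.-1 l.+1 <= ngain l u.2 v.2 gs.
Proof.
rewrite /npairs !count_pairs /ngain -big_split /=.
apply: sum_group => -[g h] _ /=; rewrite /singletons /=.
case: g => [|i [|i' g]] //=; case: h => [|j [|j' h]] //=; rewrite ?andbF //=.
rewrite /total !big_seq1 /= addn0.
case: eqP => [->|_]; last by rewrite !andbF.
case: (_ < size u.2) => //; case: (_ < size v.2) => //=.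
by move: l1 (nth _ _ _); clear; lia.
Qed.

(** Of two distinct blocks at most one is the last; the other has length at least l - 1, and the
    possibly cut one still has a letter. *)
Lemma total_lower2 j j' h : {in j :: j' :: h, forall i, i < size v.2} ->
  uniq [:: j, j' & h] -> l <= total v.2 [:: j, j' & h].
Proof.
move=> H; rewrite /= inE negb_or => /andP[/andP[jj _] _].
rewrite /total !big_cons.
have hj : j < size v.2 by apply: H; rewrite mem_head.
have hj' : j' < size v.2 by apply: H; rewrite !inE eqxx orbT.
have := v1 hj; have := v1 hj'.
have [jl|jl] := leqP (size v.2) j.+1.
  have /v2 : j'.+1 < size v.2 by move/eqP: jj; lia.
  by lia.
by have := v2 jl; lia.
Qed.

(** As in [count_in_pairs], but without s': a single block of length l - 1 facing two or more blocks
    gains, their total being at least l. *)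
Lemma gain_upper :
  count (fun i => nth 0 u.2 i == l.-1) (iota 0 (size u.2)) <=
  ngain l u.2 v.2 gs + npairs u.2 v.2 gs l.-1 l.-1 + 3 * s + 2.
Proof.
have [s1 a1 s2 a2 _] := and5P bm.
have := count_complement (fun i => nth 0 u.2 i == l.-1) s1 a1.
rewrite es count_flatten_sum big_map /npairs count_pairs /ngain.
suff : \sum_(g <- gs) count (fun i => nth 0 u.2 i == l.-1) g.1 <=
  \sum_(g <- gs) ((total u.2 g.1 < total v.2 g.2) * count (fun i => nth 0 u.2 i == l.-1) g.1
   + (singletons g && [&& (head 0 g.1).+1 < size u.2, (head 0 g.2).+1 < size v.2 &
     (nth 0 u.2 (head 0 g.1) == l.-1) && (nth 0 v.2 (head 0 g.2) == l.-1)])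
   + ((size g.1).-1 + (size g.1).-1) + ((size u.2).-1 \in g.1)
     + ((size v.2).-1 \in g.2)).
  rewrite !sumnD /=.
  exact: (pair_sum_bound2 (sum_mem2 _) (sum_mem1 _) m1).
apply: sum_group => -[g h] /group_bounds /= [g0 h0 gi hi uh].
have := count_size (fun i => nth 0 u.2 i == l.-1) g; rewrite /singletons /=.
case: g g0 gi => [//|i [|i' g]] _ gi /=; last first.
  by move=> H; apply: (leq_trans H); move: (_ * _) (_ \in h) (_ \in _) (size g); clear; lia.
rewrite addn0; case: eqP => //= ei _.
case: h h0 hi uh => [//|j [|j' h]] _ hi uh /=.
  have := last_or (gi i (mem_head _ _)); have := last_or (hi j (mem_head _ _)).
  rewrite !inE /total !big_seq1 ei.
  case: (boolP (j.+1 < size v.2)) => [/v2|_] /=; case: (_ < size u.2) => /=;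
  by move: (nth 0 v.2 j) (_.-1 == i) (_.-1 == j); clear; lia.
have -> // : total u.2 [:: i] < total v.2 [:: j, j' & h].
apply: leq_trans (total_lower2 hi uh).
by rewrite /total big_seq1 ei; move: l1; clear; lia.
Qed.

Hypothesis opt : forall gs', block_matching u v gs' -> score u.2 v.2 gs' <= score u.2 v.2 gs.
Hypothesis par1 : forall g : seq nat, g \in unzip1 gs -> {in g &, forall x y, odd x = odd y}.
Hypothesis par2 : forall g : seq nat, g \in unzip2 gs -> {in g &, forall x y, odd x = odd y}.

Lemma total_leq (w : bstring) (h : seq nat) :
  (forall i, i < size w.2 -> 0 < nth 0 w.2 i <= l.+1) ->
  {in h, forall i, i < size w.2} -> total w.2 h <= size h * l.+1.
Proof.
move=> H; rewrite /total; elim: h => [|i h IH] hi; first by rewrite big_nil.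
rewrite big_cons /= mulSn; have := H _ (hi _ (mem_head _ _)).
have : \sum_(j <- h) nth 0 w.2 j <= size h * l.+1.
  by apply: IH => j jh; apply: hi; rewrite inE jh orbT.
by lia.
Qed.

Lemma total_geq (g : seq nat) : {in g, forall i, i < size u.2} ->
  count (fun i => nth 0 u.2 i == l.+1) g * l.+1 +
  (size g - count (fun i => nth 0 u.2 i == l.+1) g) <= total u.2 g.
Proof.
rewrite /total; elim: g => [|i g IH] gi; first by rewrite big_nil.
have := u1 (gi _ (mem_head _ _)); rewrite big_cons /=.
have := count_size (fun i => nth 0 u.2 i == l.+1) g.
have : count (fun i0 : nat => nth 0 u.2 i0 == l.+1) g * l.+1 +
     (size g - count (fun i0 : nat => nth 0 u.2 i0 == l.+1) g) <=
     \sum_(i0 <- g) nth 0 u.2 i0.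
  by apply: IH => j jg; apply: gi; rewrite inE jg orbT.
by case: eqP; lia.
Qed.

(** Let k blocks of [g.1] have length l + 1. If k < |g.2|, the excess of [g.2] pays for them.
    Otherwise k (l + 1) <= total of [g.1] <= total of [g.2] <= |g.2| (l + 1) forces k = |g.1| =
    |g.2| and length l + 1 everywhere; this is a single pair, or else the matching can be
    improved. *)
Lemma loss_group (g : seq nat * seq nat) : g \in gs ->
  (total u.2 g.1 <= total v.2 g.2) * count (fun i => nth 0 u.2 i == l.+1) g.1 <=
  (singletons g && [&& (head 0 g.1).+1 < size u.2, (head 0 g.2).+1 < size v.2 &
     (nth 0 u.2 (head 0 g.1) == l.+1) && (nth 0 v.2 (head 0 g.2) == l.+1)])
  + (size g.2).-1 + ((size u.2).-1 \in g.1) + ((size v.2).-1 \in g.2).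
Proof.
move=> gg; have [g0 h0 gi hi _] := group_bounds gg.
case: (boolP (total u.2 g.1 <= total v.2 g.2)) => tl; last by rewrite mul0n.
rewrite mul1n.
have t1 := total_geq gi; have t2 := total_leq v1 hi.
have cs := count_size (fun i => nth 0 u.2 i == l.+1) g.1.
have [sm|big] := leqP (count (fun i => nth 0 u.2 i == l.+1) g.1) (size g.2).-1.
  by lia.
have Ec : count (fun i => nth 0 u.2 i == l.+1) g.1 = size g.2.
  apply/eqP; rewrite eqn_leq; apply/andP; split; last by move: big; clear; lia.
  rewrite -(leq_pmul2r (ltn0Sn l)); apply: leq_trans t2; apply: leq_trans tl.
  by apply: leq_trans t1; exact: leq_addr.
rewrite Ec in t1 cs.
have Eg : size g.1 = size g.2 by move: t1 t2 tl cs; clear; lia.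
have tE : total u.2 g.1 = size g.1 * l.+1 /\ total v.2 g.2 = size g.1 * l.+1.
  by have := total_leq u1 gi; rewrite Eg; move: t1 t2 tl; clear; lia.
have [sg|sg] := leqP (size g.1) 1.
  have sg1 : size g.1 = 1 by lia.
  have sg2 : size g.2 = 1 by lia.
  case: g gg g0 h0 gi hi tl t1 t2 cs big Ec Eg tE sg sg1 sg2 => [[|i [|? ?]] [|j [|? ?]]] //=.
  rewrite /singletons /total !big_seq1 /= !mul1n => _ _ _ gi hi _ _ _ _ _ _ _ [-> ->] _ _ _.
  have iu := gi i (mem_head _ _); have jv := hi j (mem_head _ _).
  by rewrite !inE !eqxx /=; lia.
case: g gg g0 h0 gi hi tl t1 t2 cs big Ec Eg tE sg => [[|i [|i' g]] [|j [|j' h]]] //=.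
move=> gg _ _ gi hi _ _ _ _ _ Ec Eg [tE1 tE2] _.
exfalso.
(* If two or more blocks of length l + 1 on each side are matched as a whole, the
   blocks lying between the first two of them can be matched as well. *)
have [gs1 [gs2 Egs]] : exists gs1 gs2, gs = gs1 ++ ([:: i, i' & g], [:: j, j' & h]) :: gs2.
  by case/splitPr: gg => gs1 gs2; exists gs1, gs2.
have [s1 a1 s2 a2 co] := and5P bm.
have g1 : [:: i, i' & g] \in unzip1 gs by apply: (map_f fst gg).
have g2 : [:: j, j' & h] \in unzip2 gs by apply: (map_f snd gg).
have pi : odd i = odd i' by apply: (par1 g1); rewrite !inE eqxx ?orbT.
have pj : odd j = odd j' by apply: (par2 g2); rewrite !inE eqxx ?orbT.
have si : sorted ltn [:: i, i' & g].
  exact: (subseq_sorted ltn_trans (mem_subseq_flatten g1)).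
have sj : sorted ltn [:: j, j' & h].
  exact: (subseq_sorted ltn_trans (mem_subseq_flatten g2)).
have ii' : i.+2 <= i'.
  move: si => /= /andP[]; rewrite leq_eqVlt => /orP[/eqP e|//].
  by move: pi; rewrite -e /=; case: (odd i).
have jj' : j.+2 <= j'.
  move: sj => /= /andP[]; rewrite leq_eqVlt => /orP[/eqP e|//].
  by move: pj; rewrite -e /=; case: (odd j).
pose gs' := gs1 ++ ([:: i], [:: j]) :: ([:: i.+1], [:: j.+1]) :: (i' :: g, j' :: h) :: gs2.
have bm' : block_matching u v gs'.
  have ib := gi i' ; have jb := hi j'.
  rewrite !inE eqxx orbT in ib; rewrite !inE eqxx orbT in jb.
  have iu := ib isT; have ju := jb isT.
  have ins (x y : nat) s0 t0 : x.+2 <= y -> sorted ltn (s0 ++ x :: y :: t0) ->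
      sorted ltn (s0 ++ x :: x.+1 :: y :: t0).
    move=> xy; case: s0 => [|z s0] /=; first by move=> /andP[_ ->]; rewrite xy !andbT.
    by rewrite !cat_path /= => /and3P[-> -> /andP[_ ->]]; rewrite xy ltnSn.
  move: s1 a1 s2 a2 co; rewrite /block_matching /gs' Egs /unzip1 /unzip2 !map_cat !flatten_cat /=.
  move=> s1 a1 s2 a2 co; apply/and5P; split; [exact: ins | | exact: ins | |].
  - move: a1; rewrite !all_cat /= => /and4P[-> /= i1 i2 ->].
    by rewrite i1 i2 !andbT; apply: ltn_trans i2.
  - move: a2; rewrite !all_cat /= => /and4P[-> /= i1 i2 ->].
    by rewrite i1 i2 !andbT; apply: ltn_trans i2.
  move: co; rewrite !all_cat /=.
  case/and3P=> -> /andP[/andP[/eqP cij ci] H] ->; rewrite /= andbT cij eqxx /=.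
  have -> : u.1 (+) ~~ odd i = v.1 (+) ~~ odd j by rewrite !addbN cij.
  rewrite eqxx /=; case/andP: H => /and3P[_ -> ->] /=.
  by rewrite andbT; apply: sub_all => k /and3P[_ -> ->].
(* Splitting off the two first blocks leaves equal totals on both sides, so it costs nothing; the
   inserted blocks have positive length and add at least one letter. *)
have := opt bm'.
rewrite /score Egs /gs' !big_cat /= !big_cons /= tE1 tE2 minnn leqNgt => /negP; apply.
have iu1 : i.+1 < size u.2 by apply: (leq_trans ii'); apply: ltnW; apply: gi; rewrite !inE eqxx orbT.
have jv1 : j.+1 < size v.2 by apply: (leq_trans jj'); apply: ltnW; apply: hi; rewrite !inE eqxx orbT.
have := u1 iu1; have := v1 jv1; have := u1 (ltnW iu1); have := v1 (ltnW jv1).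
have := total_leq (h := i' :: g) u1 (fun k kg => gi k (mem_behead (s := [:: i, i' & g]) kg)).
have := total_leq (h := j' :: h) v1 (fun k kg => hi k (mem_behead (s := [:: j, j' & h]) kg)).
move: tE1 tE2; rewrite /total !big_seq1 !(big_cons _ _ i) !(big_cons _ _ j) /= -!/(total _ _).
case: Eg => <-.
rewrite ltn_add2l.
move: (total _ (i' :: g)) (total _ (j' :: h)) (\sum_(k <- gs2) _).
move: (nth _ _ _) (nth _ _ _) (nth _ _ _) (nth _ _ _).
move=> B1 B2 B3 B4 S1 S2 S; rewrite !mulSn; move: (size g * l.+1) => z.
clear; lia.
Qed.

Lemma loss_upper :
  nloss l u.2 v.2 gs <= npairs u.2 v.2 gs l.+1 l.+1 + s' + 2.
Proof.
rewrite /npairs count_pairs /nloss.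
have := sum_group loss_group; rewrite !sumnD /=.
have := sum_mem1 (size u.2).-1; have := sum_mem2 (size v.2).-1; move: m2.
move: (\sum_(g <- gs) (size g.2).-1) (\sum_(g <- gs) (_ \in g.2)) (\sum_(g <- gs) (_ \in g.1)).
move=> a b c a1 b1 c1 H; apply: leq_trans H _.
by rewrite -!addnA leq_add2l; move: a1 b1 c1; clear; lia.
Qed.

(** In a pair of lengths l + 1 against l - 1 or l the group of [u] is the longer one, so [nloss]
    does not count it: the three terms count disjoint sets of blocks. *)
Lemma loss_lower :
  nloss l u.2 v.2 gs + npairs u.2 v.2 gs l.+1 l.-1 + npairs u.2 v.2 gs l.+1 l <=
  count (fun i => nth 0 u.2 i == l.+1) (iota 0 (size u.2)).
Proof.
have [s1 a1 _ _ _] := and5P bm.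
apply: (@leq_trans (count (fun i => nth 0 u.2 i == l.+1) (flatten (unzip1 gs)))); last first.
  by apply: leq_count_subseq; rewrite (sorted_ltn_filter_iota s1 a1); exact: filter_subseq.
rewrite count_flatten_sum big_map /npairs !count_pairs /nloss -!sumnD /=.
apply: sum_group => -[g h] _ /=; rewrite /singletons /=.
case: g => [|i [|i' g]] //=; first by case: h => [|? [|? ?]]; rewrite /= ?muln0.
  2: by rewrite !addn0; case: (total _ _ <= total _ _); rewrite ?mul1n ?mul0n.
case: h => [|j [|j' h]] //=; rewrite ?andbF /= ?addn0; try by case: (total _ _ <= total _ _); rewrite ?mul1n ?mul0n.
rewrite /total !big_seq1.
case: eqP => [->|_]; last by rewrite !andbF muln0.
case: (_ < size u.2) => /=; last by rewrite muln1 !addn0; case: (l.+1 <= _).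
case: (_ < size v.2) => /=; last by rewrite muln1 !addn0; case: (l.+1 <= _).
by move: l1 (nth _ _ _); clear; lia.
Qed.

End BlockGroups.

Lemma total_modify l bs i j g : uniq g -> nth 0 bs i = l.-1 -> nth 0 bs j = l.+1 -> 0 < l ->
  total (set_nth 0 (set_nth 0 bs i l) j l) g + (j \in g) = total bs g + (i \in g).
Proof.
move=> ug bi bj l0.
have ij : (i == j) = false by apply/eqP => e; move: bi; rewrite e bj; lia.
rewrite /total -!(count_uniq_mem _ ug) -!sum1_count !(big_mkcond (pred1 _)) /= -!sumnD.
apply: eq_bigr => k _; rewrite !nth_set_nth /= nth_set_nth /=.
have [->|kj] := eqVneq k j; first by rewrite eq_sym ij bj addn1 addn0.
by have [->|ki] := eqVneq k i; rewrite ?bi ?addn0 // addn1 prednK.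
Qed.

(** * Effect of the modification on the score *)

Section Modification.
Variables (l : nat) (u v : bstring) (gs : seq (seq nat * seq nat)).
Hypothesis bm : block_matching u v gs.
Hypothesis l0 : 0 < l.

Let uniq1 (g : seq nat * seq nat) : g \in gs -> uniq g.1 /\ {in g.1, forall i, i < size u.2}.
Proof.
move=> gg; have [s1 a1 _ _ _] := and5P bm.
have h1 := mem_subseq_flatten (map_f fst gg : g.1 \in unzip1 gs).
split; first exact: (subseq_uniq h1 (sorted_uniq ltn_trans ltnn s1)).
by move=> i /(mem_subseq h1) /(allP a1).
Qed.

(** If i and j lie in the same group, its total is unchanged, and the gain counted for i is covered
    by the loss counted for j, since < implies <=. *)
Lemma score_modify i j : i < size u.2 -> j < size u.2 ->
  nth 0 u.2 i = l.-1 -> nth 0 u.2 j = l.+1 ->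
  score u.2 v.2 gs + \sum_(g <- gs) (total u.2 g.1 < total v.2 g.2) * (i \in g.1) <=
  lcs (letters (u.1, set_nth 0 (set_nth 0 u.2 i l) j l)) (letters v) +
  \sum_(g <- gs) (total u.2 g.1 <= total v.2 g.2) * (j \in g.1).
Proof.
move=> iu ju bi bj.
set u' := (u.1, _).
have su : size u'.2 = size u.2.
  by rewrite /= !size_set_nth; rewrite !(maxn_idPr _) // maxnC maxnE; lia.
have bm' : block_matching u' v gs by rewrite /block_matching su.
apply: (@leq_trans (score u'.2 v.2 gs +
  \sum_(g <- gs) (total u.2 g.1 <= total v.2 g.2) * (j \in g.1))); last first.
  by rewrite leq_add2r; exact: score_leq_lcs.
rewrite /score -!sumnD big_seq [X in _ <= X]big_seq; apply: leq_sum => -[g h] gg /=.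
have [ug _] := uniq1 gg.
have /= := total_modify ug bi bj l0.
move: (total _ h) (total u.2 g) (total _ g) (i \in g) (j \in g); clear.
move=> a b c [] []; lia.
Qed.

Lemma sum_blocks k (X : (seq nat * seq nat) -> bool) :
  \sum_(i <- blocks_of_length k u) \sum_(g <- gs) X g * (i \in g.1) =
  \sum_(g <- gs) X g * count (fun i => nth 0 u.2 i == k) g.1.
Proof.
rewrite exchange_big /= big_seq [RHS]big_seq; apply: eq_bigr => g gg.
have [ug gu] := uniq1 gg.
rewrite -big_distrr /=; congr (_ * _).
rewrite -size_filter -big_mkcond /= sum1_count -size_filter.
apply/eqP; rewrite -uniq_size_uniq ?filter_uniq ?iota_uniq //.
move=> i; rewrite !mem_filter mem_iota /= add0n.
by case: (boolP (i \in g.1)) => [/gu ->|]; rewrite ?andbF ?andbT.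
Qed.

(** Divided by the product of the two numbers of blocks N and N', this bounds the mean LCS after
    modification below by the score plus [ngain] / N minus [nloss] / N'. The products keep
    everything in the natural numbers. *)
Lemma sum_lcs_modify :
  score u.2 v.2 gs * (size (blocks_of_length l.-1 u) * size (blocks_of_length l.+1 u)) +
  size (blocks_of_length l.+1 u) * ngain l u.2 v.2 gs <=
  \sum_(i <- blocks_of_length l.-1 u) \sum_(j <- blocks_of_length l.+1 u)
     lcs (letters (modify l u i j)) (letters v) +
  size (blocks_of_length l.-1 u) * nloss l u.2 v.2 gs.
Proof.
have [n1|n1] := eqVneq (blocks_of_length l.-1 u) [::].
  by rewrite /ngain -sum_blocks n1 !big_nil /= !muln0.
have [n2|n2] := eqVneq (blocks_of_length l.+1 u) [::].
  by rewrite n2 /= !muln0 mul0n.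
set A := blocks_of_length l.-1 u; set B := blocks_of_length l.+1 u.
have -> : score u.2 v.2 gs * (size A * size B) + size B * ngain l u.2 v.2 gs =
  \sum_(i <- A) \sum_(j <- B) (score u.2 v.2 gs +
   \sum_(g <- gs) (total u.2 g.1 < total v.2 g.2) * (i \in g.1)).
  rewrite (eq_bigr (fun i => score u.2 v.2 gs * size B + size B *
   (\sum_(g <- gs) (total u.2 g.1 < total v.2 g.2) * (i \in g.1)))); last first.
    move=> i _; rewrite big_const_seq count_predT iter_addn_0.
    by rewrite mulnDl [X in _ + X]mulnC.
  rewrite sumnD -[X in _ = _ + X]big_distrr /= sum_blocks big_const_seq count_predT iter_addn_0.
  by rewrite mulnAC mulnA.
have -> : size A * nloss l u.2 v.2 gs =
  \sum_(i <- A) \sum_(j <- B) \sum_(g <- gs) (total u.2 g.1 <= total v.2 g.2) * (j \in g.1).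
  by rewrite big_const_seq count_predT iter_addn_0 sum_blocks mulnC.
rewrite -sumnD big_seq [X in _ <= X]big_seq; apply: leq_sum => i.
rewrite mem_filter mem_iota /= add0n => /andP[/eqP bi iu].
rewrite -sumnD big_seq [X in _ <= X]big_seq; apply: leq_sum => j.
rewrite mem_filter mem_iota /= add0n => /andP[/eqP bj ju].
by rewrite /modify -/A -/B n1 n2 /=; exact: score_modify.
Qed.

End Modification.

Definition aligned_pairs (a b : nat) (r r' : seq nat) : seq (nat * nat) :=
  pairs a b (zip (key_runs odd r) (key_runs odd r')).

Lemma sum_parity_runs_leq n r : sorted ltn r -> all (gtn n) r ->
  \sum_(g <- key_runs odd r) (size g).-1 <= n - size r.
Proof.
case: r => [|x r] sr ar; first by rewrite big_nil.
by have := parity_runs_spread sr ar; have := sum_size_key_runs odd (x :: r); rewrite /=; lia.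
Qed.

(** Collects what later parts use about strings, with counts over [aligned_pairs] in place of a
    matching. The matching behind it comes from [alignment_matching] and is optimal because its
    score equals the LCS. *)
Lemma modification_bound (l : nat) (u v : bstring) (a : seq (nat * nat)) :
  1 < l ->
  (forall i, i < size u.2 -> 0 < nth 0 u.2 i <= l.+1) ->
  (forall i, i < size v.2 -> 0 < nth 0 v.2 i <= l.+1) ->
  (forall i, i.+1 < size u.2 -> l.-1 <= nth 0 u.2 i) ->
  (forall i, i.+1 < size v.2 -> l.-1 <= nth 0 v.2 i) ->
  alignment (letters u) (letters v) a -> lcs (letters u) (letters v) <= size a ->
  let s := left_out u.2 (unzip1 a) in let s' := left_out v.2 (unzip2 a) in
  let prs := aligned_pairs (size u.2) (size v.2) (aligned_blocks u.2 (unzip1 a)) (aligned_blocks v.2 (unzip2 a)) in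
  let c x y := count (fun t => (nth 0 u.2 t.1 == x) && (nth 0 v.2 t.2 == y)) prs in
  let N := size (blocks_of_length l.-1 u) in let N' := size (blocks_of_length l.+1 u) in
  exists gain loss : nat,
  [/\ lcs (letters u) (letters v) * (N * N') + N' * gain <=
      \sum_(i <- blocks_of_length l.-1 u) \sum_(j <- blocks_of_length l.+1 u)
        lcs (letters (modify l u i j)) (letters v) + N * loss,
      c l.-1 l + c l.-1 l.+1 <= gain,
      N <= gain + c l.-1 l.-1 + 3 * s + 2 &
      loss <= c l.+1 l.+1 + s' + 2] /\
  (loss + c l.+1 l.-1 + c l.+1 l <= N' /\
   forall Q : pred nat, count Q (iota 0 (size u.2)) <=
     count (fun t => Q t.1) prs + 3 * s + s' + 2).
Proof.
move=> l1 u1 v1 u2 v2 al opt s s' prs c N N'.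
have [gs [bm g1 g2 sc]] := alignment_matching al.
have Eprs : prs = pairs (size u.2) (size v.2) gs.
  by rewrite /prs /aligned_pairs -g1 -g2 zip_unzip.
have ne1 : all (fun g => 0 < size g) (unzip1 gs) by rewrite g1 key_runs_nonnil.
have ne2 : all (fun g => 0 < size g) (unzip2 gs) by rewrite g2 key_runs_nonnil.
have sr := size_aligned_blocks u.2 (unzip1 a); have sr' := size_aligned_blocks v.2 (unzip2 a).
have es : size u.2 - size (flatten (unzip1 gs)) = s.
  by rewrite g1 flatten_grp -sr addnK.
have m1 : \sum_(g <- gs) (size g.1).-1 <= s.
  rewrite -(big_map fst predT (fun g => (size g).-1)) -/(unzip1 gs) g1.
  by apply: leq_trans (sum_parity_runs_leq (sorted_aligned_blocks _ _) (aligned_blocks_bound _ _)) _; rewrite -sr addnK.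
have m2 : \sum_(g <- gs) (size g.2).-1 <= s'.
  rewrite -(big_map snd predT (fun g => (size g).-1)) -/(unzip2 gs) g2.
  by apply: leq_trans (sum_parity_runs_leq (sorted_aligned_blocks _ _) (aligned_blocks_bound _ _)) _; rewrite -sr' addnK.
have scE : score u.2 v.2 gs = lcs (letters u) (letters v).
  by apply/eqP; rewrite eqn_leq score_leq_lcs // (leq_trans opt).
have optg gs' : block_matching u v gs' -> score u.2 v.2 gs' <= score u.2 v.2 gs.
  by rewrite scE; exact: score_leq_lcs.
have par1 (g : seq nat) : g \in unzip1 gs -> {in g &, forall x y, odd x = odd y}.
  by rewrite g1; exact: key_runs_const.
have par2 (g : seq nat) : g \in unzip2 gs -> {in g &, forall x y, odd x = odd y}.
  by rewrite g2; exact: key_runs_const.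
have EN k : size (blocks_of_length k u) = count (fun i => nth 0 u.2 i == k) (iota 0 (size u.2)).
  by rewrite size_filter.
have Ec x y : c x y = npairs u.2 v.2 gs x y by rewrite /c Eprs.
exists (ngain l u.2 v.2 gs), (nloss l u.2 v.2 gs).
rewrite !Ec Eprs -scE /N /N'; split; [split|split].
- exact: (sum_lcs_modify bm (ltnW l1)).
- by apply: gain_lower; eassumption.
- by rewrite EN; exact: (gain_upper bm ne1 ne2 l1 v1 v2 es m1).
- by apply: loss_upper; eassumption.
- by rewrite EN; apply: loss_lower; eassumption.
- by move=> Q; apply: count_in_pairs; eassumption.
Qed.

End Combinatorics.

Local Open Scope ring_scope.
Local Open Scope classical_set_scope.

(** * Robustness of the optimization problem *)

Lemma mem_idx l i : (0 < l)%N -> (i \in idx l) = (l.-1 <= i <= l.+1)%N.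
Proof. by rewrite !inE; lia. Qed.

Lemma mem_idx_add l k : (0 < l)%N -> (k < 3)%N -> (l.-1 + k)%N \in idx l.
Proof. by move=> l0 k3; rewrite mem_idx //; lia. Qed.

Lemma idx_offset l i : (0 < l)%N -> i \in idx l ->
  exists2 k, i = (l.-1 + k)%N & (k < 3)%N.
Proof. by move=> l0; rewrite mem_idx // => il; exists (i - l.-1)%N; lia. Qed.

Lemma base3_digits i j : (i < 3)%N -> (j < 3)%N ->
  [/\ (3 * i + j < 9)%N, ((3 * i + j) %/ 3)%N = i & ((3 * i + j) %% 3)%N = j].
Proof. by move=> i3 j3; split; lia. Qed.

Section Compactness.
Context {R : realType}.

Lemma ler_sum_mem (I : eqType) (s : seq I) (F : I -> R) i : i \in s ->
  (forall j, j \in s -> 0 <= F j) -> F i <= \sum_(j <- s) F j.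
Proof.
move=> si F0; rewrite (big_rem i) //= lerDl big_seq.
by apply: sumr_ge0 => j /mem_rem /F0.
Qed.

(** This is ln y < y at y = 1 / sqrt t; it gives continuity of the entropy term at 0. *)
Lemma entropy_term_le (t : R) : t <= 1 -> `|t * ln (1 / t)| <= 2 * Num.sqrt t.
Proof.
have [t0 _|t0 t1] := leP t 0.
  by rewrite ln0 ?mulr0 ?normr0 ?div1r ?invr_le0 // mulr_ge0 // sqrtr_ge0.
have s0 : 0 < Num.sqrt t by rewrite sqrtr_gt0.
have ts : t = Num.sqrt t * Num.sqrt t by rewrite -expr2 sqr_sqrtr // ltW.
have l0 : 0 <= ln (1 / t) by rewrite ln_ge0 // div1r invf_ge1.
rewrite ger0_norm ?mulr_ge0 //; last exact: ltW.
have -> : ln (1 / t) = 2 * ln ((Num.sqrt t)^-1).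
  rewrite div1r {1}ts invfM lnM ?posrE ?invr_gt0 //; lra.
have : ln ((Num.sqrt t)^-1) < (Num.sqrt t)^-1 by rewrite ln_sublinear // invr_gt0.
move=> /ltW H; rewrite {1}ts.
have -> : 2 * Num.sqrt t = (Num.sqrt t * Num.sqrt t) * (2 * (Num.sqrt t)^-1).
  by rewrite mulrCA -mulrA divff ?mulr1 ?gt_eqF.
rewrite ler_pM2l; last by rewrite mulr_gt0.
by rewrite ler_pM2l.
Qed.

Lemma entropy_term_continuous : continuous (fun t : R => t * ln (1 / t)).
Proof.
move=> t; have [t0|t0|->] := ltgtP t 0.
(* [ln] is 0 at nonpositive arguments, so the function vanishes near a negative t. *)
- apply: (@near_cst_continuous _ _ 0).
  near=> s; rewrite ln0 ?mulr0 // div1r invr_le0 ltW //.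
  by near: s; exact: lt_nbhsl.
- apply: cvgM; first exact: cvg_id.
  apply: (@continuous_comp _ _ _ (fun s : R => 1 / s) (@ln R)).
    by apply: cvgM; [exact: cvg_cst | apply: cvgV; rewrite ?gt_eqF].
  by apply: continuous_ln; rewrite divr_gt0.
rewrite /continuous_at mul0r; apply: norm_cvg0.
apply: (@squeeze_cvgr _ _ _ _ (fun=> 0) (fun t => 2 * Num.sqrt t)).
- near=> s; rewrite normr_ge0 /= entropy_term_le //.
  by apply: ltW; near: s; exact: lt_nbhsl.
- exact: cvg_cst.
have : (fun t : R => 2 * Num.sqrt t) @ (0 : R) --> 2 * Num.sqrt (0 : R).
  by apply: cvgM; [exact: cvg_cst | exact: sqrt_continuous].
by rewrite sqrtr0 mulr0.
Unshelve. all: by end_near.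
Qed.

Lemma cvg_sum_seq (V : topologicalType) (I : Type) (s : seq I) (f : I -> V -> R) (x : V) :
  (forall i, {for x, continuous (f i)}) ->
  (fun y => \sum_(i <- s) f i y) @ x --> \sum_(i <- s) f i x.
Proof.
move=> fc; apply: cvg_big => [|i _]; first by move=> z; exact: (cvgD cvg_fst cvg_snd).
exact: fc.
Qed.

(* A point of R^9 as a matrix indexed by idx l, with base 3 digits as indices. *)
Definition cell (l : nat) (x : 'rV[R]_9) (i j : nat) : R :=
  x ord0 (inord (3 * (i - l.-1) + (j - l.-1))).

Lemma cell_continuous l i j : continuous (fun x => cell l x i j).
Proof. exact: coord_continuous. Qed.

Lemma entropy_p_continuous l : continuous (fun x => entropy_p l (cell l x)).
Proof.
move=> x; rewrite /entropy_p /continuous_at.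
apply: cvg_sum_seq => i; apply: cvg_sum_seq => j.
exact: (continuous_comp (@cell_continuous l i j x) (@entropy_term_continuous _)).
Qed.

Lemma sum_idx l (F : nat -> R) : \sum_(i <- idx l) F i = F l.-1 + F l + F l.+1.
Proof. by rewrite /idx !big_cons big_nil addr0 addrA. Qed.

(** Multiplication by the two row sums turns the condition into the sign of a polynomial in p, which
    is continuous also where a row sum vanishes. *)
Lemma objective_gt l q (p : nat -> nat -> R) m :
  0 < \sum_(j <- idx l) p l.-1 j -> 0 < \sum_(j <- idx l) p l.+1 j ->
  (m < objective l q p) = (0 < (p l.-1 l + p l.-1 l.+1) * (1 - 9 * q) * (\sum_(j <- idx l) p l.+1 j)
   - p l.+1 l.+1 * (1 - 3 * q) * (\sum_(j <- idx l) p l.-1 j)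
   - (3 * q + m) * (\sum_(j <- idx l) p l.-1 j) * (\sum_(j <- idx l) p l.+1 j)).
Proof.
rewrite !sum_idx => S0 T0; rewrite -subr_gt0 /objective.
set S := (X in 0 < X) in S0; set T := (X in 0 < X) in T0.
rewrite -(pmulr_lgt0 _ (mulr_gt0 S0 T0)).
congr (0 < _); rewrite -/S -/T.
by field; rewrite !gt_eqF.
Qed.

Lemma minimum_robust (l : nat) (q0 eps : R) : (0 < l)%N -> 0 <= q0 < 1 / 3 ->
  0 < 2 * eps -> is_minimum l q0 (2 * eps) ->
  exists2 delta, 0 < delta & forall p : nat -> nat -> R,
    (1 / 3 - q0) / 2 <= \sum_(j <- idx l) p l.-1 j ->
    (1 / 3 - q0) / 2 <= \sum_(j <- idx l) p l.+1 j ->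
    \sum_(i <- idx l) \sum_(j <- idx l) p i j = 1 ->
    (forall i j, i \in idx l -> j \in idx l -> 0 <= p i j) ->
    - delta <= 2 * entropy q0 + (1 - 4 * q0) * (ln (1 / 9) + entropy_p l p) ->
    3 / 2 * eps < objective l q0 p.
Proof.
move=> l0 /andP[q00 q03] e0 [_ hmin].
pose c : R := (1 / 3 - q0) / 2.
have c0 : 0 < c by rewrite /c; lra.
pose S (x : 'rV[R]_9) := \sum_(j <- idx l) cell l x l.-1 j.
pose T (x : 'rV[R]_9) := \sum_(j <- idx l) cell l x l.+1 j.
pose U (x : 'rV[R]_9) := \sum_(i <- idx l) \sum_(j <- idx l) cell l x i j.
pose f (x : 'rV[R]_9) := (cell l x l.-1 l + cell l x l.-1 l.+1) * (1 - 9 * q0) * T x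
  - cell l x l.+1 l.+1 * (1 - 3 * q0) * S x
  - (3 * q0 + 3 / 2 * eps) * S x * T x.
pose g (x : 'rV[R]_9) := 2 * entropy q0 + (1 - 4 * q0) * (ln (1 / 9) + entropy_p l (cell l x)).
have cS : continuous S.
  by move=> x; apply: cvg_sum_seq => j; exact: cell_continuous.
have cT : continuous T.
  by move=> x; apply: cvg_sum_seq => j; exact: cell_continuous.
have cU : continuous U.
  by move=> x; apply: cvg_sum_seq => i; apply: cvg_sum_seq => j; exact: cell_continuous.
have cf : continuous f.
  move=> x; rewrite /f /continuous_at.
  have cc i j := @cell_continuous l i j x.
  exact: (cvgB (cvgB (cvgM (cvgM (cvgD (cc _ _) (cc _ _)) (cvg_cst _)) (cT x))
    (cvgM (cvgM (cc _ _) (cvg_cst _)) (cS x))) (cvgM (cvgM (cvg_cst _) (cS x)) (cT x))).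
have cg : continuous g.
  move=> x; rewrite /g /continuous_at.
  exact: (cvgD (cvg_cst (2 * entropy q0)) (cvgM (cvg_cst (1 - 4 * q0))
    (cvgD (cvg_cst (ln (1 / 9) : R)) (@entropy_p_continuous l x)))).
(* K consists of the laws with objective at most 3 eps / 2, not of the feasible ones. On K the
   entropy expression g is negative, as a point with g >= 0 would be feasible and have objective at
   least 2 eps. Compactness makes this uniform and yields delta. *)
pose K := [set x : 'rV[R]_9 | [/\ c <= S x, c <= T x, U x = 1 & f x <= 0] /\
   (forall k, 0 <= x ord0 k <= 1)].
have Kc : compact K.
  apply: (@subclosed_compact _ K [set x : 'rV[R]_9 | forall k, `[0, 1] (x ord0 k)]).
  - have -> : K = (S @^-1` [set r | c <= r]) `&` (T @^-1` [set r | c <= r]) `&`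
       (U @^-1` [set r | r = 1]) `&` (f @^-1` [set r | r <= 0]) `&`
       \bigcap_(k in setT) ((fun x : 'rV[R]_9 => x ord0 k) @^-1` `[0, 1]).
      apply/seteqP; split=> x /=.
        move=> [[h1 h2 h3 h4] h5]; split; first by [].
        by move=> k _ /=; rewrite in_itv /=; exact: h5.
      move=> [[[[h1 h2] h3] h4] h5]; split; first by split.
      by move=> k; have := h5 k Logic.I; rewrite /= in_itv.
    apply: closedI; [apply: closedI; [apply: closedI; [apply: closedI|]|]|].
    + by move/continuous_closedP: cS; apply; exact: closed_ge.
    + by move/continuous_closedP: cT; apply; exact: closed_ge.
    + by move/continuous_closedP: cU; apply; exact: closed_eq.
    + by move/continuous_closedP: cf; apply; exact: closed_le.
    + apply: closed_bigI => k _.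
      have /continuous_closedP : continuous (fun x : 'rV[R]_9 => x ord0 k).
        exact: coord_continuous.
      by apply; exact: itv_closed.
  - exact: (@rV_compact R 9 (fun=> `[0, 1]) (fun=> @segment_compact R 0 1)).
  by move=> x [_ h] k /=; rewrite in_itv /=.
have gneg x : K x -> g x < 0.
  move=> [[h1 h2 h3 h4] h5]; rewrite ltNge; apply/negP => gx.
  have : 2 * eps <= objective l q0 (cell l x).
    apply: hmin; split; first by rewrite q00 lexx.
    by do 4! [split=> //]; move=> i j _ _; have /andP[] := h5 (inord (3 * (i - l.-1) + (j - l.-1))).
  rewrite leNgt => /negP; apply; apply: (@le_lt_trans _ _ (3 / 2 * eps)); last by lra.
  rewrite leNgt objective_gt -?leNgt //; exact: lt_le_trans c0 _.
have [delta d0 Hd] : exists2 delta, 0 < delta & forall x, K x -> g x < - delta.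
  have [K0|/set0P K0] := eqVneq K set0; first by exists 1 => // x; rewrite K0.
  have [z zK zmax] := compact_EVT_max K0 Kc (continuous_subspaceT cg).
  exists (- g z / 2); first by have := gneg z (set_mem zK); lra.
  move=> x /mem_set /zmax; have := gneg z (set_mem zK); lra.
exists delta => // p p1 p2 p3 p4 pd.
pose x : 'rV[R]_9 := \row_k p (l.-1 + k %/ 3)%N (l.-1 + k %% 3)%N.
have xE i j : i \in idx l -> j \in idx l -> cell l x i j = p i j.
  move=> /(idx_offset l0)[i' -> i3] /(idx_offset l0)[j' -> j3]; rewrite /cell mxE !addKn.
  by have [h1 h2 h3] := base3_digits i3 j3; rewrite inordK // h2 h3.
have [i1 [i2 i3]] : l.-1 \in idx l /\ l \in idx l /\ l.+1 \in idx l.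
  by rewrite !inE !eqxx !orbT.
have SE : S x = \sum_(j <- idx l) p l.-1 j by rewrite /S !sum_idx !xE.
have TE : T x = \sum_(j <- idx l) p l.+1 j by rewrite /T !sum_idx !xE.
have UE : U x = 1 by rewrite /U -p3 !sum_idx !xE.
rewrite objective_gt; [|exact: lt_le_trans c0 _..].
rewrite ltNge; apply/negP => fx.
have : K x.
  split; first by rewrite SE TE UE /f SE TE !xE.
  move=> k; rewrite mxE.
  have k1 : (l.-1 + k %/ 3)%N \in idx l.
    by rewrite mem_idx_add // ltn_divLR.
  have k2 : (l.-1 + k %% 3)%N \in idx l by rewrite mem_idx_add // ltn_mod.
  rewrite p4 //= -p3.
  have P0 i : i \in idx l -> 0 <= \sum_(j <- idx l) p i j.
    by move=> il; rewrite sum_idx !addr_ge0 ?p4.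
  apply: le_trans (ler_sum_mem k1 P0).
  by apply: (ler_sum_mem (F := p _) k2) => j; exact: p4.
move=> /Hd; rewrite ltNge => /negP; apply.
by move: pd; rewrite /g /entropy_p !sum_idx !xE.
Qed.

Lemma entropy_term_ge0 (x : R) : 0 <= x -> x <= 1 -> 0 <= x * ln (1 / x).
Proof.
rewrite le_eqVlt => /orP[/eqP <- _|x0 x1]; first by rewrite mul0r.
by apply: mulr_ge0; [exact: ltW | rewrite ln_ge0 // div1r invf_ge1].
Qed.

Lemma entropy_ge0 (q : R) : 0 <= q <= 1 -> 0 <= entropy q.
Proof.
by move=> /andP[q0 q1]; rewrite addr_ge0 ?entropy_term_ge0 //; lra.
Qed.

Lemma entropy_p_ge0 (l : nat) (p : nat -> nat -> R) :
  \sum_(i <- idx l) \sum_(j <- idx l) p i j = 1 ->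
  (forall i j, i \in idx l -> j \in idx l -> 0 <= p i j) -> 0 <= entropy_p l p.
Proof.
move=> p1 p0; rewrite /entropy_p big_seq; apply: sumr_ge0 => i il.
rewrite big_seq; apply: sumr_ge0 => j jl; apply: entropy_term_ge0; first exact: p0.
have r0 k : k \in idx l -> 0 <= \sum_(j <- idx l) p k j.
  by move=> kl; rewrite big_seq; apply: sumr_ge0 => h hl; exact: p0.
rewrite -p1; apply: le_trans (ler_sum_mem il r0).
by apply: (ler_sum_mem (F := p i) jl) => h; exact: p0.
Qed.

(** Gibbs' inequality against the uniform law: ln y <= y - 1 at y = 1 / (9 x) bounds each term, and
    the differences 1/9 - x sum to 0. *)
Lemma entropy_p_le (l : nat) (p : nat -> nat -> R) :
  \sum_(i <- idx l) \sum_(j <- idx l) p i j = 1 ->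
  (forall i j, i \in idx l -> j \in idx l -> 0 <= p i j) ->
  ln (1 / 9) + entropy_p l p <= 0.
Proof.
move=> p1 p0.
have l9 : ln (1 / 9 : R) = - ln 9 by rewrite div1r lnV ?posrE.
have H (x : R) : 0 <= x -> x * ln (1 / x) <= 1 / 9 - x + x * ln 9.
  rewrite le_eqVlt => /orP[/eqP <-|x0]; first by rewrite !mul0r addr0 subr0; lra.
  have : ln (1 + (1 / (9 * x) - 1)) <= 1 / (9 * x) - 1.
    by apply: le_ln1Dx; rewrite ltrBrDr addNr divr_gt0 ?mulr_gt0.
  rewrite addrCA subrr addr0 div1r lnV ?posrE ?mulr_gt0 // lnM ?posrE // => h.
  rewrite div1r lnV ?posrE //.
  have -> : 1 / 9 - x + x * ln 9 = x * ((9 * x)^-1 - 1 + ln 9).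
    by field; rewrite gt_eqF.
  by rewrite ler_pM2l //; lra.
have [i1 [i2 i3]] : l.-1 \in idx l /\ l \in idx l /\ l.+1 \in idx l.
  by rewrite !inE !eqxx !orbT.
move: p1; rewrite /entropy_p !sum_idx l9 => p1.
have := H _ (p0 _ _ i1 i1); have := H _ (p0 _ _ i1 i2); have := H _ (p0 _ _ i1 i3).
have := H _ (p0 _ _ i2 i1); have := H _ (p0 _ _ i2 i2); have := H _ (p0 _ _ i2 i3).
have := H _ (p0 _ _ i3 i1); have := H _ (p0 _ _ i3 i2); have := H _ (p0 _ _ i3 i3).
have p19 : (\sum_(i <- idx l) \sum_(j <- idx l) p i j) * ln 9 = ln 9.
  by rewrite !sum_idx p1 mul1r.
move: p19; rewrite !sum_idx !mulrDl; lra.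
Qed.

(** The uniform law is feasible at q0, its entropy cancelling ln (1 / 9), and has objective 1/3 - 8
    q0. A positive minimum thus forces q0 < 1/24, which keeps 1 - 4 q0 and 1 - 9 q0 positive. *)
Lemma minimum_q0_lt (l : nat) (q0 eps : R) : 0 <= q0 < 1 / 3 ->
  0 < 2 * eps -> is_minimum l q0 (2 * eps) -> q0 < 1 / 24.
Proof.
move=> /andP[q00 q03] e0 [_ hmin].
have : 2 * eps <= objective l q0 (fun _ _ => 1 / 9).
  apply: hmin; split; first by rewrite q00 lexx.
  rewrite /entropy_p !sum_idx; do 3 (split; first by lra).
  split; first by move=> *; lra.
  have -> : ln (1 / 9 : R) = - ln 9 by rewrite div1r lnV ?posrE.
  have -> : 1 / (1 / 9) = 9 :> R by field.
  have := entropy_ge0 (q := q0) _; rewrite q00 /= => /(_ _) H.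
  have : 0 <= entropy q0 by apply: H; lra.
  by move: (entropy q0) (ln 9) => A B; lra.
rewrite /objective (_ : (1 / 9 + 1 / 9) / (1 / 9 + 1 / 9 + 1 / 9) = 2 / 3); last by field.
rewrite (_ : (1 / 9) / (1 / 9 + 1 / 9 + 1 / 9) = 1 / 3); last by field.
lra.
Qed.

End Compactness.

(** * Counting by types *)

Section Counting.
Context {R : realType}.

(* The product weights of all functions f sum to 1. *)
Lemma weight_count (I J : finType) (w : J -> R) (F : {pred {ffun I -> J}}) (m : R) :
  (forall j, 0 <= w j) -> \sum_j w j = 1 ->
  (forall f, f \in F -> m <= \prod_i w (f i)) -> #|F|%:R * m <= 1.
Proof.
move=> w0 w1 H.
have E : \sum_(f : {ffun I -> J}) \prod_i w (f i) = 1.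
  by rewrite -(bigA_distr_bigA (fun (i : I) j => w j)) big1.
rewrite -[leRHS]E mulr_natl -sumr_const.
apply: (@le_trans _ _ (\sum_(f in F) \prod_i w (f i))); first exact: ler_sum.
rewrite [leRHS](bigID (mem F)) /= lerDl.
by apply: sumr_ge0 => f _; apply: prodr_ge0.
Qed.

Lemma prod_fiber (I J : finType) (w : J -> R) (f : {ffun I -> J}) :
  \prod_i w (f i) = \prod_j w j ^+ #|[pred i | f i == j]|.
Proof.
rewrite (partition_big f predT) //=; apply: eq_bigr => j _.
by rewrite -prodr_const; apply: eq_big => [i|i /eqP -> //].
Qed.

(** Draw the entries independently, false with probability q. Since q <= 1 - q, a mask with at most
    q a false entries has probability at least e^(- a H(q)). *)
Lemma count_masks (a : nat) (q : R) : 0 <= q <= 1 / 2 ->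
  #|[pred f : {ffun 'I_a -> bool} | (#|[pred i | ~~ f i]|%:R <= q * a%:R)]|%:R
    <= expR (a%:R * entropy q).
Proof.
move=> /andP[q0 q1].
rewrite -[leRHS]mul1r -ler_pdivrMr ?expR_gt0 // -expRN.
apply: (weight_count (w := fun b => if b then 1 - q else q)).
- by move=> []; lra.
- by rewrite big_bool /=; lra.
move=> f; rewrite inE => fq.
rewrite (prod_fiber (fun b : bool => if b then 1 - q else q)) big_bool /=.
have -> : #|[pred i | f i == false]| = #|[pred i | ~~ f i]|.
  by apply: eq_card => i; rewrite !inE; case: (f i).
have sz : (#|[pred i | f i == true]| + #|[pred i | ~~ f i]| = a)%N.
  rewrite -[RHS]card_ord -(cardC [pred i | f i == true]); congr (_ + _)%N.
  by apply: eq_card => i; rewrite !inE; case: (f i).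
have {sz} : #|[pred i | f i == true]|%:R + #|[pred i | ~~ f i]|%:R = a%:R :> R.
  by rewrite -natrD sz.
move: fq; move: #|[pred i | ~~ f i]| #|[pred i | f i == true]| => s t sq st.
have p1 : 0 < 1 - q by lra.
move: q0; rewrite le_eqVlt => /orP[/eqP q0|q0].
  move: sq; rewrite -q0 mul0r lern0 => /eqP ->.
  rewrite /entropy !subr0 !mul0r add0r mul1r divr1 ln1 mulr0 oppr0 expR0.
  by rewrite expr0 expr1n mulr1.
rewrite -[X in X ^+ t]lnK ?posrE // -[X in _ * X ^+ s]lnK ?posrE //.
rewrite -!expRM_natl -expRD ler_expR /entropy !div1r !lnV ?posrE //.
have : ln q <= ln (1 - q) by rewrite ler_ln ?posrE //; lra.
have -> : t%:R = a%:R - s%:R :> R by lra.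
move: (ln q) (ln (1 - q)) => x y xy.
rewrite -subr_ge0.
have -> : (a%:R - s%:R) * y + s%:R * x - - (a%:R * (q * - x + (1 - q) * - y)) =
  (q * a%:R - s%:R) * (y - x) by ring.
by apply: mulr_ge0; lra.
Qed.

Definition empirical (l : nat) (c : 'I_3 -> 'I_3 -> nat) (i j : nat) : R :=
  (c (inord (i - l.-1)) (inord (j - l.-1)))%:R / (\sum_x \sum_y c x y)%:R.

Lemma empiricalE l c (x y : 'I_3) :
  empirical l c (l.-1 + x) (l.-1 + y) = (c x y)%:R / (\sum_x \sum_y c x y)%:R.
Proof. by rewrite /empirical !addKn !inord_val. Qed.

Lemma sum_idx_ord l (F : nat -> R) : (0 < l)%N ->
  \sum_(i <- idx l) F i = \sum_(x < 3) F (l.-1 + x)%N.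
Proof.
move=> l0; rewrite sum_idx !big_ord_recr big_ord0 /= add0r addn0 addn1 addn2 prednK //.
Qed.

Lemma entropy_p_ord l (p : nat -> nat -> R) : (0 < l)%N ->
  entropy_p l p = \sum_(x < 3) \sum_(y < 3)
    p (l.-1 + x)%N (l.-1 + y)%N * ln (1 / p (l.-1 + x)%N (l.-1 + y)%N).
Proof.
by move=> l0; rewrite /entropy_p sum_idx_ord //; apply: eq_bigr => x _; rewrite sum_idx_ord.
Qed.

(** When the pairs are drawn independently from the empirical law, every h of this type has
    probability e^(- m H), where H is the entropy of that law. *)
Lemma count_type (l : nat) (c : 'I_3 -> 'I_3 -> nat) (m : nat) : (0 < l)%N -> (0 < m)%N ->
  (\sum_x \sum_y c x y = m)%N ->
  #|[pred h : {ffun 'I_m -> 'I_3 * 'I_3} |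
     [forall x, forall y, #|[pred k | h k == (x, y)]| == c x y]]|%:R
    <= expR (m%:R * entropy_p l (empirical l c)).
Proof.
move=> l0 m0 cm.
have m0' : 0 < m%:R :> R by rewrite ltr0n.
rewrite -[leRHS]mul1r -ler_pdivrMr ?expR_gt0 // -expRN.
apply: (weight_count (w := fun z => (c z.1 z.2)%:R / m%:R)).
- by move=> z; rewrite divr_ge0.
- rewrite -mulr_suml -natr_sum -(pair_big predT predT (fun x y => c x y)) /= cm.
  by rewrite divff ?gt_eqF.
move=> h; rewrite inE => /forallP H.
rewrite (prod_fiber (fun z => (c z.1 z.2)%:R / m%:R)).
rewrite (eq_bigr (fun z => ((c z.1 z.2)%:R / m%:R) ^+ #|[pred i | h i == (z.1, z.2)]|)); last by case.
rewrite -(pair_big predT predT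
  (fun x y => ((c x y)%:R / m%:R) ^+ #|[pred i | h i == (x, y)]|)) /=.
rewrite entropy_p_ord // mulr_sumr -sumrN expR_sum.
apply: ler_prod => x _; rewrite mulr_sumr -sumrN expR_sum prodr_ge0; last first.
  by move=> *; exact: expR_ge0.
apply: ler_prod => y _; rewrite expR_ge0 /= empiricalE cm.
have /forallP /(_ y) /eqP -> := H x.
have [->|c0] := posnP (c x y); first by rewrite mul0r mul0r mulr0 oppr0 expR0 expr0.
have cp : 0 < (c x y)%:R / m%:R :> R by rewrite divr_gt0 ?ltr0n.
rewrite -[X in _ <= X ^+ _](lnK (_ : _ \is Num.pos)) ?posrE // -expRM_natl ler_expR.
by rewrite div1r lnV ?posrE // mulrN mulrN opprK mulrA mulrCA divff ?gt_eqF // mulr1.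
Qed.

End Counting.

(** * From the counts of pairs to the mean gain *)

Section Gain.
Context {R : realType}.

(** Add w times the upper bound on N to 1 - w times w S <= g: S cancels and w N <= g + w k remains.
    So the ratio w seen in the pairs passes to g / N, although N is bounded only in terms of g. *)
Lemma gain_ratio (g N S w k t : R) : 0 < N -> 0 <= w <= 1 -> w * S <= g ->
  N <= g + (1 - w) * S + k -> k <= t * N -> w * (1 - t) <= g / N.
Proof.
move=> N0 /andP[w0 w1] h1 h2 h3; rewrite ler_pdivlMr //.
have := ler_wpM2l w0 h2; have := ler_wpM2l w0 h3.
have w1' : 0 <= 1 - w by lra.
by have := ler_wpM2l w1' h1; lra.
Qed.

(** Weighting L <= w T + k by 1 - w and L + (1 - w) T <= N by w cancels T and leaves L <= w N + (1 -
    w) k. *)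
Lemma loss_ratio (L N T w k t : R) : 0 < N -> 0 <= w <= 1 -> L <= w * T + k ->
  L + (1 - w) * T <= N -> k <= t * N -> L / N <= w + (1 - w) * t.
Proof.
move=> N0 /andP[w0 w1] h1 h2 h3; rewrite ler_pdivrMr //.
have w1' : 0 <= 1 - w by lra.
have := ler_wpM2l w1' h1; have := ler_wpM2l w0 h2; have := ler_wpM2l w1' h3.
lra.
Qed.

(** Here x stands for n / l, a and b for the numbers of blocks of X and Y, N and N' for the blocks
    of X of length l - 1 and l + 1, s and s' for the left-out blocks, g and L for gain and loss, M
    for the number of pairs and C for their counts by lengths. *)
Lemma modification_gain (l : nat) (q eps delta : R) : (0 < l)%N ->
  0 <= q < 1 / 24 -> 0 < eps -> 0 < delta ->
  (forall p : nat -> nat -> R,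
    (1 / 3 - q) / 2 <= \sum_(j <- idx l) p l.-1 j ->
    (1 / 3 - q) / 2 <= \sum_(j <- idx l) p l.+1 j ->
    \sum_(i <- idx l) \sum_(j <- idx l) p i j = 1 ->
    (forall i j, i \in idx l -> j \in idx l -> 0 <= p i j) ->
    - delta <= 2 * entropy q + (1 - 4 * q) * (ln (1 / 9) + entropy_p l p) ->
    3 / 2 * eps < objective l q p) ->
  exists2 kappa : R, 0 < kappa < 1 / 100 & exists x0 : R,
  forall (x a b N N' s s' g L M : R) (C : nat -> nat -> R),
  x0 <= x ->
  (1 - kappa) * x <= a <= (1 + kappa) * x -> (1 - kappa) * x <= b <= (1 + kappa) * x ->
  (1 / 3 - kappa) * a - 1 <= N -> (1 / 3 - kappa) * a - 1 <= N' ->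
  s <= q * a -> s' <= q * b ->
  (forall i j, 0 <= C i j) ->
  C l.-1 l + C l.-1 l.+1 <= g -> N <= g + C l.-1 l.-1 + 3 * s + 2 ->
  L <= C l.+1 l.+1 + s' + 2 -> L + C l.+1 l.-1 + C l.+1 l <= N' ->
  \sum_(i <- idx l) \sum_(j <- idx l) C i j = M ->
  M <= a -> a <= M + 3 * s + s' + 2 ->
  N <= \sum_(j <- idx l) C l.-1 j + 3 * s + s' + 2 ->
  N' <= \sum_(j <- idx l) C l.+1 j + 3 * s + s' + 2 ->
  - (kappa * x) <= a * entropy q + b * entropy q +
     M * (ln (1 / 9) + entropy_p l (fun i j => C i j / M)) ->
  [/\ 0 < N, 0 < N' & eps <= g / N - L / N'].
Proof.
move=> l0 /andP[q0 q1] e0 d0 rob.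
(* The two ratios below lose at most w eta and (1 - w') eta, together at most eps / 2, the gap
   between 3 eps / 2 and eps. *)
pose eta := Num.min (eps / 4) 1.
have [eta0 [eta1 eta2]] : 0 < eta /\ eta <= eps / 4 /\ eta <= 1.
  by rewrite lt_min ge_min lexx ge_min lexx orbT; split=> //; lra.
have H0 : 0 <= entropy q by apply: entropy_ge0; lra.
have l9 : 0 <= ln 9 :> R by apply: ln_ge0; lra.
(* With D = ln (1 / 9) + H(p) >= - ln 9, the bound kappa <= K0 keeps the error 2 kappa H(q) - 2
   kappa D + kappa of the entropy constraint below delta. *)
pose K0 := delta / (8 * (entropy q + ln 9 + 1)).
have K0E : K0 * (8 * (entropy q + ln 9 + 1)) = delta.
  by rewrite /K0 divfK // gt_eqF //; lra.
have K00 : 0 < K0 by rewrite divr_gt0 //; lra.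
have [kappa [k0 [k1 [k2 k3]]]] : exists kappa : R,
    0 < kappa /\ kappa <= eta / 24 /\ kappa <= 1 / 200 /\ kappa <= K0.
  exists (Num.min (Num.min (eta / 24) (1 / 200)) K0).
  by rewrite !lt_min K00 !ge_min !lexx !orbT; do ?split=> //; lra.
exists kappa; first by lra.
exists (Num.max (1000 / eta) (Num.max 1000 (2 / kappa))).
move=> x a b N N' s s' g L M C; rewrite !ge_max => /and3P[x1 x2 x3].
move=> /andP[a1 a2] /andP[b1 b2] hN hN' hs hs' C0 G1 G2 L1 L2 CM Ma aM hS hT hE.
have {}x1 : 1000 <= eta * x by rewrite mulrC -ler_pdivrMr.
have {}x3 : 2 <= kappa * x by rewrite mulrC -ler_pdivrMr.
have x0 : 0 <= x by apply: le_trans x2; exact: ler0n.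
have kx : kappa * x <= 1 / 200 * x by exact: ler_wpM2r.
have ekx : eta * (kappa * x) <= eta * (1 / 200 * x) by apply: ler_wpM2l => //; exact: ltW.
have ba : b <= (1 + 3 * kappa) * a.
  have h1 : 0 <= 1 + 3 * kappa by move: k0; clear; lra.
  have h2 : 0 <= kappa * (1 - 3 * kappa) * x.
    by apply: mulr_ge0 => //; apply: mulr_ge0; move: k0 k2; clear; lra.
  by have := ler_wpM2l h1 a1; move: h2 b2; clear; lra.
have a0 : 900 <= a by move: a1 kx x2; clear; lra.
have a0' : 0 <= a by apply: le_trans a0; exact: ler0n.
have ea : 900 <= eta * a by have := ler_wpM2l (ltW eta0) a1; move: ekx x1; clear; lra.
have ka : kappa * a <= 1 / 200 * a by exact: ler_wpM2r.
have ka' : kappa * a <= eta / 24 * a by exact: ler_wpM2r.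
have ka0 : 0 <= kappa * a by apply: mulr_ge0 => //; exact: ltW.
have qa : q * a <= 1 / 24 * a by apply: ler_wpM2r => //; exact: ltW.
have qka : q * (kappa * a) <= 1 / 24 * (kappa * a) by apply: ler_wpM2r => //; exact: ltW.
have eka : eta * (kappa * a) <= 1 * (kappa * a) by exact: ler_wpM2r.
have qb : q * b <= q * a + kappa * a / 8.
  by have := ler_wpM2l q0 ba; move: qka; clear; lra.
have N0 : 0 < N by move: hN ka a0; clear; lra.
have N0' : 0 < N' by move: hN' ka a0; clear; lra.
have [S ES] : exists S, S = \sum_(j <- idx l) C l.-1 j by exists (\sum_(j <- idx l) C l.-1 j).
have [T ET] : exists T, T = \sum_(j <- idx l) C l.+1 j by exists (\sum_(j <- idx l) C l.+1 j).
rewrite -ES in hS; rewrite -ET in hT.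
have S1 : (1 / 3 - q) / 2 * a <= S.
  by move: hS hN hs hs' qb qa ka a0; clear; lra.
have T1 : (1 / 3 - q) / 2 * a <= T.
  by move: hT hN' hs hs' qb qa ka a0; clear; lra.
have S0 : 0 < S by move: S1 qa a0; clear; lra.
have T0 : 0 < T by move: T1 qa a0; clear; lra.
have SM : S <= M.
  have [i1 i2] : l.-1 \in idx l /\ l \in idx l by rewrite !inE !eqxx !orbT.
  rewrite -CM ES; apply: (ler_sum_mem (F := fun i => \sum_(j <- idx l) C i j) i1) => j _.
  by rewrite sumr_ge0.
have M0 : 0 < M by exact: lt_le_trans SM.
pose p i j := C i j / M.
have pr i : \sum_(j <- idx l) p i j = (\sum_(j <- idx l) C i j) / M by rewrite -mulr_suml.
have p1 : \sum_(i <- idx l) \sum_(j <- idx l) p i j = 1.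
  by rewrite (eq_bigr _ (fun i _ => pr i)) -mulr_suml CM divff // gt_eqF.
have p0 i j : i \in idx l -> j \in idx l -> 0 <= p i j by move=> _ _; rewrite divr_ge0 // ltW.
have obj : 3 / 2 * eps < objective l q p.
  have c0 : 0 <= (1 / 3 - q) / 2 by move: q1; clear; lra.
  have cM := ler_wpM2l c0 Ma.
  apply: rob => //.
  - by rewrite pr ler_pdivlMr // -ES; exact: le_trans S1.
  - by rewrite pr ler_pdivlMr // -ET; exact: le_trans T1.
  have D0 := entropy_p_le p1 p0.
  have D1 : - ln 9 <= ln (1 / 9) + entropy_p l p.
    by rewrite div1r lnV ?posrE // lerDl entropy_p_ge0.
  move: hE D0 D1; rewrite -/p; move: (ln (1 / 9) + _) (entropy q) (ln 9) H0 l9 K0E => D Hq l9.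
  move=> Hq0 l90 K0E hE D0 D1.
  (* All blocks of X but 3 q a + q b + 2 are in pairs, and a, b are close to x. Since D <= 0, a
     lower bound on M is the one required. *)
  have m1 : (1 - 4 * q - 2 * kappa) * x <= M.
    have h3 : 0 <= 1 - 3 * q by move: q1; clear; lra.
    have : 0 <= q * (kappa * x) by apply: mulr_ge0 => //; apply: mulr_ge0 => //; exact: ltW.
    have := ler_wpM2l h3 a1; have := ler_wpM2l q0 b2.
    by move: aM hs hs' x3; clear; lra.
  have m2 : M * D <= (1 - 4 * q - 2 * kappa) * x * D by exact: ler_wnM2r.
  have m3 : (a + b) * Hq <= (2 * (1 + kappa) * x) * Hq.
    by apply: ler_wpM2r => //; move: a2 b2; clear; lra.
  have m4 : 0 <= x * (2 * Hq + (1 - 4 * q) * D + (2 * kappa * Hq - 2 * kappa * D + kappa)).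
    by move: hE m2 m3; clear; lra.
  have m5 : 0 <= 2 * Hq + (1 - 4 * q) * D + (2 * kappa * Hq - 2 * kappa * D + kappa).
    by rewrite pmulr_rge0 // in m4; apply: lt_le_trans x2; exact: ltr0n.
  have m6 : 2 * kappa * Hq - 2 * kappa * D + kappa <= delta.
    have := ler_wpM2l (ltW k0) D1; have := ler_wpM2r Hq0 k3; have := ler_wpM2r l90 k3.
    have := mulr_ge0 (ltW K00) Hq0; have := mulr_ge0 (ltW K00) l90.
    by move: K0E k3 K00; clear; lra.
  by move: m5 m6; clear; lra.
pose w := (C l.-1 l + C l.-1 l.+1) / S.
pose w' := C l.+1 l.+1 / T.
have wE : w * S = C l.-1 l + C l.-1 l.+1 by rewrite /w divfK // gt_eqF.
have wE' : w' * T = C l.+1 l.+1 by rewrite /w' divfK // gt_eqF.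
have SE : S = C l.-1 l.-1 + C l.-1 l + C l.-1 l.+1 by rewrite ES sum_idx.
have TE : T = C l.+1 l.-1 + C l.+1 l + C l.+1 l.+1 by rewrite ET sum_idx.
have w01 : 0 <= w <= 1.
  rewrite divr_ge0 ?addr_ge0 ?C0 ?(ltW S0) //= ler_pdivrMr // mul1r SE -addrA.
  by rewrite lerDr.
have w01' : 0 <= w' <= 1.
  rewrite divr_ge0 ?C0 ?(ltW T0) //= ler_pdivrMr // mul1r TE.
  by rewrite lerDr addr_ge0.
have objE : objective l q p = w * (1 - 9 * q) - w' * (1 - 3 * q) - 3 * q.
  have Snz : S != 0 by rewrite gt_eqF.
  have Tnz : T != 0 by rewrite gt_eqF.
  have Mnz : M != 0 by rewrite gt_eqF.
  move: Snz Tnz Mnz; rewrite /objective /w /w' SE TE /p; clear => Snz Tnz Mnz.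
  by field; rewrite Snz Tnz Mnz.
have t1 : 0 <= 9 * q + eta by move: q0 eta0; clear; lra.
have t2 : 0 <= 3 * q + eta by move: q0 eta0; clear; lra.
(* The error 3 s + 2, about 3 q a at most, is compared with N, about a / 3 at least: this is 9 q.
   For the loss, s' + 2 against a / 3 gives 3 q. *)
have GN : w * (1 - (9 * q + eta)) <= g / N.
  apply: (@gain_ratio g N S w (3 * s + 2)) => //; first by rewrite wE.
    by rewrite mulrBl mul1r wE SE; move: G2; clear; lra.
  have := ler_wpM2l t1 hN; move: hs qa ea eka qka ka' q1 eta2; clear; lra.
have LN : L / N' <= w' + (1 - w') * (3 * q + eta).
  apply: (@loss_ratio L N' T w' (s' + 2)) => //; first by rewrite wE'; move: L1; clear; lra.
    by rewrite mulrBl mul1r wE' TE; move: L2; clear; lra.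
  have := ler_wpM2l t2 hN'; move: hs' qa qb ea eka qka ka' q1 eta2; clear; lra.
split=> //; rewrite objE in obj.
move: w01 w01' obj GN LN eta0 eta1; move: (w) (w') (g / N) (L / N'); clear.
move=> w w' G K /andP[w0 w1] /andP[w0' w1'] obj GN LN eta0 eta1.
have := ler_wpM2r (ltW eta0) w1; have := mulr_ge0 w0' (ltW eta0); lra.
Qed.

End Gain.

(** * Large deviations in the block model *)

Section Discrete.
Context {d : measure_display} {T : measurableType d} {R : realType}.
Variable P : probability T R.

Lemma measurable_discrete (C : countType) (Z : T -> C) (Q : C -> Prop) :
  (forall c, measurable [set w | Z w = c]) -> measurable [set w | Q (Z w)].
Proof.
move=> mZ.
have -> : [set w | Q (Z w)] = \bigcup_c [set w | Z w = c /\ Q c].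
  by apply/seteqP; split=> [w Qw|w [c _ [<- //]]]; exists (Z w).
apply: countable_bigcupT_measurable; first exact: countableP.
move=> c; have [Qc|nQ] := pselect (Q c).
  by rewrite (_ : [set w | _] = [set w | Z w = c]) //; apply/seteqP; split=> w //= [].
by rewrite (_ : [set w | _] = set0) //; apply/seteqP; split=> w //= [].
Qed.

Lemma measurable_RV_fiber d' (T' : measurableType d') (X : {RV P >-> T'}) (c : T') :
  measurable [set c] -> measurable [set w | X w = c].
Proof. exact: measurable_funPTI. Qed.

Lemma probability_le_sum (I : Type) (s : seq I) (E : I -> set T) (A : set T) :
  measurable A -> (forall i, measurable (E i)) ->
  (forall w, A w -> exists2 i, List.In i s & E i w) ->
  (P A <= \sum_(i <- s) P (E i))%E.
Proof.
move=> mA mE AE.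
have mU (t : seq I) : measurable (\big[setU/set0]_(i <- t) E i).
  by apply: bigsetU_measurable.
apply: (@le_trans _ _ (P (\big[setU/set0]_(i <- s) E i))).
  apply: le_measure; rewrite ?inE //.
  move=> w /AE[i]; elim: s {AE} => //= j s IH [->|] Ei.
    by rewrite big_cons; left.
  by move=> Eiw; rewrite big_cons; right; exact: IH.
elim: s {AE} => [|j s IH]; first by rewrite !big_nil measure0.
rewrite !big_cons; apply: (@le_trans _ _ (P (E j) + P (\big[setU/set0]_(i <- s) E i))%E).
  by apply: measureU2 => //; exact: mU.
exact: leeD2l.
Qed.

Lemma probability_le_sum_fin (I : finType) (F : {pred I}) (E : I -> set T) (A : set T) :
  measurable A -> (forall i, measurable (E i)) ->
  (forall w, A w -> exists2 i, i \in F & E i w) ->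
  (P A <= \sum_(i in F) P (E i))%E.
Proof.
move=> mA mE AE; rewrite -big_enum /=; apply: probability_le_sum => // w /AE[i iF Ei].
exists i => //.
have : i \in enum F by rewrite mem_enum.
by elim: (enum F) => //= j t IH; rewrite inE => /orP[/eqP ->|/IH]; [left|right].
Qed.

Lemma measurable_map_fiber (I : Type) (C : countType) (F : I -> T -> C) (s : seq I) (r : seq C) :
  (forall i c, measurable [set w | F i w = c]) ->
  measurable [set w | map (F^~ w) s = r].
Proof.
move=> mF; elim: s r => [|i s IH] [|c r] /=.
- by rewrite (_ : [set w | _] = setT) //; apply/seteqP; split.
- by rewrite (_ : [set w | _] = set0) //; apply/seteqP; split.
- by rewrite (_ : [set w | _] = set0) //; apply/seteqP; split.
rewrite (_ : [set w | _] = [set w | F i w = c] `&` [set w | map (F^~ w) s = r]).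
  exact: measurableI.
by apply/seteqP; split=> w /= [-> ->].
Qed.

Lemma measurable_map (I : Type) (C : countType) (F : I -> T -> C) (s : seq I)
    (Q : seq C -> Prop) :
  (forall i c, measurable [set w | F i w = c]) -> measurable [set w | Q (map (F^~ w) s)].
Proof. by move=> mF; apply: measurable_discrete => r; exact: measurable_map_fiber. Qed.

Lemma measurable_exists (I : countType) (E : I -> T -> Prop) :
  (forall i, measurable [set w | E i w]) -> measurable [set w | exists i, E i w].
Proof.
move=> mE; rewrite (_ : [set w | _] = \bigcup_i [set w | E i w]).
  by apply: countable_bigcupT_measurable => //; exact: countableP.
by apply/seteqP; split=> w [i]; [exists i | exists i].
Qed.

End Discrete.

Section Model.
Context {d : measure_display} {T : measurableType d} {R : realType}.
Variable P : probability T R.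
Variables (l : nat) (BX BY : nat -> {RV P >-> nat}) (sX sY : {RV P >-> bool}).
Hypothesis hl : (0 < l)%N.
Hypothesis hmodel : block_model l BX BY sX sY.

(* (true, i) stands for the i-th block of X, (false, i) for that of Y. *)
Definition block (z : bool * nat) : {RV P >-> nat} := if z.1 then BX z.2 else BY z.2.

Lemma block_uniform z k : k \in idx l -> P [set w | block z w = k] = (3^-1)%:E.
Proof. by case: z => -[] i kl; case: hmodel => hX hY _ _ _; [exact: hX | exact: hY]. Qed.

Lemma measurable_block z (Q : nat -> Prop) : measurable [set w | Q (block z w)].
Proof. by apply: measurable_discrete => c; exact: measurable_RV_fiber. Qed.

Lemma block_independent (D : finType) (site : D -> bool * nat) (h : D -> 'I_3) :
  injective site ->
  P [set w | forall x, block (site x) w = (l.-1 + h x)%N] = ((3^-1) ^+ #|D|)%:E.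
Proof.
move=> sinj; case: hmodel => _ _ _ _ ind.
pose f x := ((site x).1, Some (site x).2).
have finj : injective f.
  move=> x y [e1 e2]; apply: sinj; move: e1 e2.
  by case: (site x) => ? ?; case: (site y) => ? ? /= -> ->.
pose J := [fset f x | x in D]%fset.
(* Quantifying over all x with [f x = k] avoids inverting [f]; by injectivity it is a single
   constraint for k in J. *)
pose A (k : bool * option nat) := [set w | forall x, f x = k -> block (site x) w = (l.-1 + h x)%N].
have := ind J A.
have -> : \bigcap_(k in [set` J]) A k = [set w | forall x, block (site x) w = (l.-1 + h x)%N].
  apply/seteqP; split=> [w H x|w H k _ x _]; last exact: H.
  by apply: (H (f x)) => //=; rewrite in_imfset.
move=> ->; last first.
  move=> k; case/imfsetP => x _ ->; rewrite /A /f /sigma_RV.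
  have -> : [set w | forall x0 : D, ((site x0).1, Some (site x0).2) = ((site x).1, Some (site x).2) ->
     block (site x0) w = (l.-1 + h x0)%N] = [set w | block (site x) w = (l.-1 + h x)%N].
    by apply/seteqP; split=> [w H|w H y /finj ->]; [exact: H|].
  rewrite /block; case: (site x).1;
  by exists [set (l.-1 + h x)%N] => //; rewrite setTI.
congr EFin; rewrite (eq_big_seq (fun=> 3^-1)); last first.
  move=> k; case/imfsetP => x _ ->.
  rewrite /A (_ : [set w | _] = [set w | block (site x) w = (l.-1 + h x)%N]).
    by rewrite block_uniform // mem_idx_add.
  by apply/seteqP; split=> [w H|w H y /finj ->]; [exact: H|].
rewrite big_const_seq count_predT iter_mulr_1; congr (_ ^+ _).
by rewrite card_imfset // -cardE.
Qed.

(** Each pattern of lengths on distinct blocks has probability 3^-|D|, so bounding a probability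
    becomes counting patterns. *)
Lemma block_law (D : finType) (site : D -> bool * nat) (F : {pred {ffun D -> 'I_3}}) A :
  injective site -> measurable A ->
  (forall w, A w -> exists2 f, f \in F & forall x, block (site x) w = (l.-1 + f x)%N) ->
  (P A <= (#|F|%:R / 3 ^+ #|D|)%:E)%E.
Proof.
move=> sinj mA AF.
pose E (f : {ffun D -> 'I_3}) := [set w | forall x, block (site x) w = (l.-1 + f x)%N].
apply: (@le_trans _ _ (\sum_(f in F) P (E f))).
  apply: probability_le_sum_fin => // f.
  rewrite (_ : E f = \bigcap_(x in [set: D]) [set w | block (site x) w = (l.-1 + f x)%N]).
    by apply: fin_bigcap_measurable => // x _; exact: measurable_RV_fiber.
  by apply/seteqP; split=> [w H x _|w H x]; [exact: H | exact: (H x)].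
rewrite (eq_bigr (fun=> (3^-1 ^+ #|D|)%:E)); last by move=> f _; exact: block_independent.
by rewrite sumEFin lee_fin sumr_const mulr_natl exprVn.
Qed.

Definition regular (w : T) : Prop := forall z, block z w \in idx l.

Lemma regular_ae : P.-negligible (~` [set w | regular w]).
Proof.
have -> : ~` [set w | regular w] = \bigcup_i [set w | ~ block (true, i) w \in idx l] `|`
    \bigcup_i [set w | ~ block (false, i) w \in idx l].
  apply/seteqP; split=> w /=.
    move/existsNP => [[[] i] H]; [left|right]; by exists i.
  by move=> [[i _ H]|[i _ H]] /(_ (_, i)) /H.
have N z : P.-negligible [set w | ~ block z w \in idx l].
  exists [set w | ~ block z w \in idx l]; split=> //; first exact: (measurable_block z (fun k => ~ k \in idx l)).
  have -> : [set w | ~ block z w \in idx l] = ~` [set w | block z w \in idx l] by [].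
  have mI : measurable [set w | block z w \in idx l] by exact: (measurable_block z (fun k => k \in idx l)).
  rewrite probability_setC //.
  suff -> : P [set w | block z w \in idx l] = 1%E by rewrite subee.
  have -> : [set w | block z w \in idx l] = [set w | block z w = l.-1] `|`
      ([set w | block z w = l] `|` [set w | block z w = l.+1]).
    apply/seteqP; split=> w /=; rewrite !inE.
      by move=> /or3P[] /eqP ->; [left|right; left|right; right].
    by move=> [->|[->|->]]; rewrite eqxx ?orbT.
  have mb k : measurable [set w | block z w = k] by exact: measurable_RV_fiber.
  rewrite measureU //; [|exact: measurableU|]; last first.
    by apply/seteqP; split=> w //= [-> [] /eqP]; lia.
  rewrite measureU //; last by apply/seteqP; split=> w //= [-> /eqP]; lia.
  transitivity ((3^-1)%:E + ((3^-1)%:E + (3^-1)%:E) : \bar R)%E.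
    by congr (_ + (_ + _))%E; apply: block_uniform; rewrite !inE eqxx ?orbT.
  by rewrite -!EFinD; congr EFin; lra.
by apply: negligibleU; apply: negligible_bigcup => i; exact: N.
Qed.

Lemma count_card (A : Type) (x0 : A) (p : pred A) (s : seq A) :
  count p s = #|[pred k : 'I_(size s) | p (nth x0 s k)]|.
Proof. by rewrite -sum1_count (big_nth x0) big_mkord sum1_card. Qed.

(** The rate of [low_count]. From ln (1 - t/3) <= - t/3 and ln (1 - t) >= - t / (1 - t) it is at
    least 2 t^2 / (3 (1 - t)). *)
Lemma chernoff_exponent (t : R) : 0 < t < 1 / 3 ->
  0 < (1 / 3 - t) * ln (1 - t) - ln ((3 - t) / 3).
Proof.
move=> /andP[t0 t1].
have h1 : ln ((3 - t) / 3) <= - (t / 3).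
  rewrite (_ : (3 - t) / 3 = 1 + - (t / 3)); last by field.
  by apply: le_ln1Dx; lra.
have h2 : - (t / (1 - t)) <= ln (1 - t).
  rewrite [X in _ <= ln X](_ : 1 - t = (1 + t / (1 - t))^-1); last by field; lra.
  rewrite lnV ?posrE; last by rewrite addr_gt0 // divr_gt0 //; lra.
  rewrite lerN2.
  by apply: le_ln1Dx; apply: (@lt_le_trans _ _ 0); [lra|rewrite divr_ge0 //; lra].
have h3 : (1 / 3 - t) * - (t / (1 - t)) <= (1 / 3 - t) * ln (1 - t).
  by apply: ler_wpM2l => //; lra.
have h4 : - (t / 3) < (1 / 3 - t) * - (t / (1 - t)).
  rewrite -subr_gt0 (_ : _ - _ = (2 / 3 * t ^+ 2) / (1 - t)); last by field; lra.
  by rewrite divr_gt0 ?mulr_gt0 ?exprn_gt0 //; lra.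
lra.
Qed.

(** A Chernoff bound obtained by counting. Membership in [idx l] is part of A so that every outcome
    of A is one of the 3^k patterns. *)
Lemma low_count (t : R) : 0 < t < 1 / 3 -> exists2 eta : R, 0 < eta &
  forall (z : bool) v k, v \in idx l ->
   let A := [set w | (forall i, (i < k)%N -> block (z, i) w \in idx l) /\
     (count (fun i => block (z, i) w == v) (iota 0 k))%:R < (1 / 3 - t) * k%:R] in
   measurable A /\ (P A <= (expR (- (eta * k%:R)))%:E)%E.
Proof.
move=> t01; have := chernoff_exponent t01; set eta := _ - _ => eta0; exists eta => //.
move: t01 => /andP[t0 t1] z v k /(idx_offset hl)[y -> y3].
pose F := [pred f : {ffun 'I_k -> 'I_3} |
  #|[pred i | f i == Ordinal y3]|%:R < (1 / 3 - t) * k%:R].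
move=> A.
have mA : measurable A.
  pose Q r := (forall i, (i < k)%N -> nth 0%N r i \in idx l) /\
     (count (pred1 (l.-1 + y)%N) r)%:R < (1 / 3 - t) * k%:R.
  rewrite (_ : A = [set w | Q (map (fun i => block (z, i) w) (iota 0 k))]).
    by apply: measurable_map => i c; exact: measurable_RV_fiber.
  apply/seteqP; split=> w; rewrite /A /Q /= count_map => -[h1 h2]; split=> // i ik.
    by rewrite (nth_map 0%N) ?size_iota // nth_iota // add0n; exact: h1.
  by have := h1 i ik; rewrite (nth_map 0%N) ?size_iota // nth_iota // add0n.
split=> //.
apply: (@le_trans _ _ (#|F|%:R / 3 ^+ #|'I_k|)%:E).
  apply: (block_law (site := fun i : 'I_k => (z, val i))) => //.
    by move=> i j [] /val_inj.
  move=> w [h1 h2].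
  have off (i : 'I_k) : (block (z, val i) w - l.-1 < 3)%N /\
      block (z, val i) w = (l.-1 + (block (z, val i) w - l.-1))%N.
    by have [j -> j3] := idx_offset hl (h1 i (ltn_ord i)); rewrite addKn.
  exists [ffun i => Ordinal (off i).1]; last by move=> i; rewrite ffunE; exact: (off i).2.
  rewrite inE (le_lt_trans _ h2) // ler_nat (count_card 0%N).
  rewrite -(card_imset _ (@cast_ord_inj _ _ (esym (size_iota 0 k)))).
  apply: subset_leq_card; apply/fintype.subsetP => _ /imsetP[i + ->].
  rewrite !inE ffunE => /eqP [e].
  have -> : nth 0%N (iota 0 k) (cast_ord (esym (size_iota 0 k)) i) = val i.
    exact: (nth_iota 0%N 0 (ltn_ord i)).
  by rewrite (off i).2 e.
rewrite lee_fin card_ord.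
have t10 : 0 < 1 - t by lra.
have : #|F|%:R * (((3 - t)^-1) ^+ k * expR ((1 / 3 - t) * k%:R * ln (1 - t))) <= 1.
  (* The tilted law: v has relative weight 1 - t instead of 1, and 3 - t normalises. A pattern with
     too few v weighs at least (3 - t)^(-k) (1 - t)^((1/3 - t) k), as ln (1 - t) <= 0. *)
  apply: (weight_count (w := fun j => if j == Ordinal y3 then (1 - t) / (3 - t) else (3 - t)^-1)).
  - by move=> j; case: ifP => _; rewrite ?divr_ge0 ?invr_ge0 //; lra.
  - rewrite (bigD1 (Ordinal y3)) //= eqxx (eq_bigr (fun=> (3 - t)^-1)); last first.
      by move=> j /negbTE ->.
    rewrite sumr_const (_ : #|_| = 2%N); last first.
      transitivity #|predC1 (Ordinal y3)|; last by rewrite cardC1 card_ord.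
      by apply: eq_card => j; rewrite !inE.
    by field; lra.
  move=> f; rewrite inE => fF.
  rewrite (eq_bigr (fun i => (3 - t)^-1 * (if f i == Ordinal y3 then 1 - t else 1))); last first.
    by move=> i _; case: ifP => _; rewrite ?mulr1 // mulrC.
  rewrite big_split /= prodr_const card_ord ler_wpM2l ?exprn_ge0 ?invr_ge0 //; first by lra.
  rewrite -big_mkcond /= prodr_const -[X in X ^+ _]lnK ?posrE // -expRM_natl ler_expR.
  by apply: ler_wnM2r; [apply: ln_le0; lra | exact: ltW].
have e3 : 0 < (3 - t)^-1 ^+ k by rewrite exprn_gt0 // invr_gt0; lra.
rewrite -ler_pdivlMr ?mulr_gt0 ?expR_gt0 // mul1r => H.
rewrite ler_pdivrMr ?exprn_gt0 //; apply: le_trans H _.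
rewrite invfM -expRN exprVn invrK.
have -> : (3 - t) ^+ k = expR (k%:R * ln ((3 - t) / 3)) * 3 ^+ k.
  rewrite expRM_natl lnK ?posrE; last by rewrite divr_gt0 //; lra.
  by rewrite -exprMn divfK.
rewrite ?mul1r mulrAC ler_wpM2r ?exprn_ge0 // -expRD ler_expR /eta.
by rewrite le_eqVlt; apply/orP; left; apply/eqP; field.
Qed.

Definition pair_count (w : T) (prs : seq (nat * nat)) (x y : nat) : nat :=
  count (fun t => (block (true, t.1) w == x) && (block (false, t.2) w == y)) prs.

(** No index repeats on either side, so 2 m distinct blocks are involved: the 9^m patterns are
    equally likely, and [count_type] bounds how many have type c. *)
Lemma type_prob (prs : seq (nat * nat)) (c : 'I_3 -> 'I_3 -> nat) :
  (0 < size prs)%N -> uniq (unzip1 prs) -> uniq (unzip2 prs) ->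
  (\sum_x \sum_y c x y = size prs)%N ->
  let E := [set w | (forall t, t \in prs -> block (true, t.1) w \in idx l /\ block (false, t.2) w \in idx l) /\
      forall x y : 'I_3, pair_count w prs (l.-1 + x) (l.-1 + y) = c x y] in
  measurable E /\
  (P E <= (expR ((size prs)%:R * (ln (1 / 9) + entropy_p l (empirical l c))))%:E)%E.
Proof.
move=> m0 u1 u2 cm; set m := size prs in m0 cm *.
move=> E.
have mE : measurable E.
  pose Q (r : seq (nat * nat)) := (forall t, t \in r -> t.1 \in idx l /\ t.2 \in idx l) /\
     forall x y : 'I_3, count (fun t => (t.1 == l.-1 + x)%N && (t.2 == l.-1 + y)%N) r = c x y.
  rewrite (_ : E = [set w | Q (map (fun t => (block (true, t.1) w, block (false, t.2) w) : nat * nat) prs)]).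
    apply: measurable_map => t [i j].
    rewrite (_ : [set w | _] = [set w | block (true, t.1) w = i] `&` [set w | block (false, t.2) w = j]).
      by apply: measurableI; exact: measurable_RV_fiber.
    by apply/seteqP; split=> w /= [-> ->].
  apply/seteqP; split=> w [h1 h2]; split.
  - by move=> _ /mapP[t tp ->]; exact: h1.
  - by move=> x y; rewrite count_map; exact: h2.
  - move=> t tp; exact: (h1 (block (true, t.1) w, block (false, t.2) w) (map_f _ tp)).
  - by move=> x y; have := h2 x y; rewrite count_map.
split=> //.
pose site (z : bool * 'I_m) := (z.1, if z.1 then (nth (0, 0)%N prs z.2).1 else (nth (0, 0)%N prs z.2).2).
have sinj : injective site.
  have n1 (k : 'I_m) : nth 0%N (unzip1 prs) k = (nth (0, 0)%N prs k).1 by apply: nth_map.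
  have n2 (k : 'I_m) : nth 0%N (unzip2 prs) k = (nth (0, 0)%N prs k).2 by apply: nth_map.
  have sm (k : 'I_m) : (k < size prs)%N by exact: ltn_ord.
  move=> [b i] [b' j] [<-]; case: b => e; congr pair; apply: val_inj.
    apply/eqP; rewrite -(nth_uniq 0%N _ _ u1) ?size_map; [|exact: sm..].
    exact/eqP/(etrans (n1 i) (etrans e (esym (n1 j)))).
  apply/eqP; rewrite -(nth_uniq 0%N _ _ u2) ?size_map; [|exact: sm..].
  exact/eqP/(etrans (n2 i) (etrans e (esym (n2 j)))).
pose F' := [pred h : {ffun 'I_m -> 'I_3 * 'I_3} |
     [forall x, forall y, #|[pred k | h k == (x, y)]| == c x y]].
pose phi (f : {ffun bool * 'I_m -> 'I_3}) : {ffun 'I_m -> 'I_3 * 'I_3} :=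
  [ffun k => (f (true, k), f (false, k))].
have phi_inj : injective phi.
  move=> f g /ffunP fg; apply/ffunP => -[b k].
  by have := fg k; rewrite !ffunE => -[e1 e2]; case: b.
pose F := [pred f | phi f \in F'].
apply: (@le_trans _ _ (#|F|%:R / 3 ^+ #|{: bool * 'I_m}|)%:E).
  apply: (block_law (site := site)) => // w [h1 h2].
  have off (z : bool * 'I_m) : (block (site z) w - l.-1 < 3)%N /\
      block (site z) w = (l.-1 + (block (site z) w - l.-1))%N.
    have zi : block (site z) w \in idx l.
      by have [] := h1 _ (mem_nth (0, 0)%N (ltn_ord z.2)); rewrite /site; case: (z.1).
    by have [j -> j3] := idx_offset hl zi; rewrite addKn.
  exists [ffun z => Ordinal (off z).1]; last by move=> z; rewrite ffunE; exact: (off z).2.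
  rewrite !inE; apply/forallP => x; apply/forallP => y; rewrite -h2 /pair_count (count_card (0, 0)%N).
  apply/eqP; apply: eq_card => k; rewrite !inE !ffunE xpair_eqE -!val_eqE /=.
  have := (off (true, k)).2; have := (off (false, k)).2; rewrite /site /= => -> ->.
  by rewrite !eqn_add2l !addKn.
rewrite lee_fin mulrDr expRD ler_pdivrMr ?exprn_gt0 //.
apply: (@le_trans _ _ (expR (m%:R * entropy_p l (empirical l c)))).
  apply: le_trans (count_type hl m0 cm); rewrite ler_nat -(fintype.card_image phi_inj).
  by apply: subset_leq_card; apply/fintype.subsetP => h /fintype.imageP[f + ->].
rewrite [X in _ <= X * _]mulrC -mulrA card_prod card_bool card_ord exprM -[leLHS]mulr1.
rewrite ler_wpM2l ?expR_ge0 // expRM_natl lnK ?posrE // -exprMn.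
by rewrite (_ : 1 / 9 * 3 ^+ 2 = 1) ?expr1n //; field.
Qed.

Definition kept (a : nat) (f : {ffun 'I_a -> bool}) : seq nat :=
  [seq val i | i <- enum 'I_a & f i].

Definition kept_pairs (a b : nat) (f : {ffun 'I_a -> bool}) (f' : {ffun 'I_b -> bool}) :=
  aligned_pairs a b (kept f) (kept f').

(* f and f' select the blocks that are kept; the last inequality makes a
   union bound over all such f and f' of the event has_type cost at most e^(-r). *)
Definition atypical (q r : R) (a b : nat) (f : {ffun 'I_a -> bool}) (f' : {ffun 'I_b -> bool})
    (c : 'I_3 -> 'I_3 -> nat) : Prop :=
  [/\ (#|[pred i | ~~ f i]|%:R <= q * a%:R) && (#|[pred i | ~~ f' i]|%:R <= q * b%:R),
    (0 < size (kept_pairs f f'))%N, uniq (unzip1 (kept_pairs f f')) && uniq (unzip2 (kept_pairs f f')),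
    (\sum_x \sum_y c x y = size (kept_pairs f f'))%N &
    a%:R * entropy q + b%:R * entropy q +
    (size (kept_pairs f f'))%:R * (ln (1 / 9) + entropy_p l (empirical l c)) < - r].

Definition has_type (w : T) (prs : seq (nat * nat)) (c : 'I_3 -> 'I_3 -> nat) : Prop :=
  (forall t, t \in prs -> block (true, t.1) w \in idx l /\ block (false, t.2) w \in idx l) /\
  forall x y : 'I_3, pair_count w prs (l.-1 + x) (l.-1 + y) = c x y.

(** The numbers of blocks of the prefixes are random. The union over all deterministic sizes, masks
    and types reduces the estimate to fixed sets of blocks. *)
Definition atypical_event (q r : R) (K : nat) : set T :=
  [set w | exists i : 'I_K.+1 * 'I_K.+1 * {ffun 'I_3 * 'I_3 -> 'I_K.+1},
    exists z : {ffun 'I_i.1.1 -> bool} * {ffun 'I_i.1.2 -> bool},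
      atypical q r z.1 z.2 (fun x y => i.2 (x, y)) /\
      has_type w (kept_pairs z.1 z.2) (fun x y => i.2 (x, y))].

(** For fixed sizes a, b and a fixed type, at most e^(a H(q) + b H(q)) pairs of masks count, each
    with probability at most e^(- r - a H(q) - b H(q)). Two sizes and nine counts make the exponent
    11. *)
Lemma atypical_prob (q r : R) (K : nat) : 0 <= q <= 1 / 2 ->
  measurable (atypical_event q r K) /\
  (P (atypical_event q r K) <= (K.+1%:R ^+ 11 * expR (- r))%:E)%E.
Proof.
move=> q01.
pose E (i : 'I_K.+1 * 'I_K.+1 * {ffun 'I_3 * 'I_3 -> 'I_K.+1})
    (z : {ffun 'I_i.1.1 -> bool} * {ffun 'I_i.1.2 -> bool}) :=
  [set w | atypical q r z.1 z.2 (fun x y => i.2 (x, y)) /\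
      has_type w (kept_pairs z.1 z.2) (fun x y => i.2 (x, y))].
have HE i z : measurable (E i z) /\ (P (E i z) <= (expR (- r - i.1.1%:R * entropy q - i.1.2%:R * entropy q))%:E)%E.
  have [at_|nat_] := pselect (atypical q r z.1 z.2 (fun x y => i.2 (x, y) : nat)); last first.
    rewrite (_ : E i z = set0); last by apply/seteqP; split=> w // [].
    by split=> //; rewrite measure0 lee_fin expR_ge0.
  have [_ m0 /andP[u1 u2] cm lt] := at_.
  have [mE PE] := type_prob m0 u1 u2 cm.
  rewrite (_ : E i z = [set w | has_type w (kept_pairs z.1 z.2) (fun x y => i.2 (x, y))]).
    split=> //; apply: le_trans PE _; rewrite lee_fin ler_expR.
    by move: lt; lra.
  by apply/seteqP; split=> w // [].
have mE i : measurable [set w | exists z, E i z w].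
  by apply: measurable_exists => z; have [] := HE i z.
have PE i : (P [set w | exists z, E i z w] <= (expR (- r))%:E)%E.
  pose F := [pred z : {ffun 'I_i.1.1 -> bool} * {ffun 'I_i.1.2 -> bool} |
    (#|[pred k | ~~ z.1 k]|%:R <= q * i.1.1%:R) && (#|[pred k | ~~ z.2 k]|%:R <= q * i.1.2%:R)].
  apply: (@le_trans _ _ (\sum_(z in F) P (E i z))).
    apply: probability_le_sum_fin => // [z|w [z [[H1 H2 H3 H4 H5] Ht]]]; first by have [] := HE i z.
    by exists z.
  apply: (@le_trans _ _ (\sum_(z in F) (expR (- r - i.1.1%:R * entropy q - i.1.2%:R * entropy q))%:E)%E).
    by apply: lee_sum => z _; have [] := HE i z.
  rewrite sumEFin lee_fin sumr_const.
  have -> : #|F| = (#|[pred f : {ffun 'I_i.1.1 -> bool} | (#|[pred k | ~~ f k]|%:R <= q * i.1.1%:R)%R]| *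
     #|[pred f : {ffun 'I_i.1.2 -> bool} | (#|[pred k | ~~ f k]|%:R <= q * i.1.2%:R)%R]|)%N.
    by rewrite -cardX; apply: eq_card => z; rewrite !inE.
  rewrite -[leLHS]mulr_natl natrM.
  apply: (@le_trans _ _ (expR (i.1.1%:R * entropy q) * expR (i.1.2%:R * entropy q) *
     expR (- r - i.1.1%:R * entropy q - i.1.2%:R * entropy q))).
    rewrite ler_wpM2r ?expR_ge0 //.
    by apply: ler_pM => //; exact: count_masks.
  by rewrite -!expRD ler_expR; lra.
split; first exact: measurable_exists.
apply: (@le_trans _ _ (\sum_(i in predT) P [set w | exists z, E i z w])%E).
  apply: probability_le_sum_fin => //; first exact: measurable_exists.
  by move=> w [i H]; exists i.
pose I : finType := ('I_K.+1 * 'I_K.+1 * {ffun 'I_3 * 'I_3 -> 'I_K.+1})%type.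
apply: (@le_trans _ _ (\sum_(i in @predT I) (expR (- r))%:E)%E).
  by apply: lee_sum.
rewrite sumEFin lee_fin sumr_const -[leLHS]mulr_natl ler_wpM2r ?expR_ge0 //.
have -> : #|@predT I| = #|{: I}| by apply: eq_card.
rewrite /I !card_prod card_ffun !card_prod !card_ord natrM natrX natrM.
by rewrite -expr2 -exprD.
Qed.

End Model.

(** * Finite prefixes of the block sequences *)

Section Prefix.
Local Open Scope nat_scope.

Lemma nblocksP (b : nat -> nat) n K : n <= \sum_(i < K) b i ->
  [/\ nblocks b n <= K, n <= \sum_(i < nblocks b n) b i &
      forall k, k < nblocks b n -> \sum_(i < k) b i < n].
Proof.
move=> nK; rewrite /nblocks; case: pselect => [h|[]]; last by exists K.
case: ex_minnP => m nm mmin; split=> //; first exact: mmin.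
by move=> k km; rewrite ltnNge; apply/negP => /mmin; rewrite leqNgt km.
Qed.

Lemma nblocks_ext (b b' : nat -> nat) n K : n <= \sum_(i < K) b i ->
  (forall i, i < K -> b i = b' i) -> nblocks b n = nblocks b' n.
Proof.
move=> nK bb'.
have E k : k <= K -> \sum_(i < k) b i = \sum_(i < k) b' i.
  by move=> kK; apply: eq_bigr => i _; apply: bb'; apply: leq_trans kK.
have nK' : n <= \sum_(i < K) b' i by rewrite -E.
have [h1 h2 h3] := nblocksP nK; have [h1' h2' h3'] := nblocksP nK'.
have [lt|lt|//] := ltngtP (nblocks b n) (nblocks b' n).
  by have := h3' _ lt; rewrite -E // ltnNge h2.
by have := h3 _ lt; rewrite E // ltnNge h2'.
Qed.

Lemma prefix_bstring_ext s (b b' : nat -> nat) n K : n <= \sum_(i < K) b i ->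
  (forall i, i < K -> b i = b' i) -> prefix_bstring s b n = prefix_bstring s b' n.
Proof.
move=> nK bb'; rewrite /prefix_bstring -(nblocks_ext nK bb').
have [h1 _ _] := nblocksP nK.
congr pair; apply/eq_in_map => i; rewrite mem_iota /= add0n => ik.
have iK : i < K by apply: leq_trans h1.
rewrite bb' //; congr (minn _ (_ - _)); apply: eq_bigr => j _; apply: bb'.
by apply: ltn_trans iK.
Qed.

Lemma size_prefix s b n : size (prefix_bstring s b n).2 = nblocks b n.
Proof. by rewrite size_mkseq. Qed.

Lemma nth_prefix s b n i : i < nblocks b n ->
  nth 0 (prefix_bstring s b n).2 i = minn (b i) (n - \sum_(j < i) b j).
Proof. by move=> ib; rewrite nth_mkseq. Qed.

Lemma nth_prefix_inner s (b : nat -> nat) n K i : n <= \sum_(i < K) b i -> i.+1 < nblocks b n ->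
  nth 0 (prefix_bstring s b n).2 i = b i.
Proof.
move=> nK ib; have [_ _ h] := nblocksP nK.
rewrite nth_prefix; last exact: ltnW.
by have := h _ ib; rewrite big_ord_recr /=; lia.
Qed.

Lemma nth_prefix_bound s (b : nat -> nat) n K i : n <= \sum_(i < K) b i -> i < nblocks b n ->
  nth 0 (prefix_bstring s b n).2 i <= b i /\
  (0 < b i -> 0 < nth 0 (prefix_bstring s b n).2 i).
Proof.
move=> nK ib; have [_ _ h] := nblocksP nK.
by rewrite nth_prefix //; have := h _ ib; split; lia.
Qed.

End Prefix.

Section PrefixMeasurable.
Context {d : measure_display} {T : measurableType d} {R : realType}.
Variable P : probability T R.

(** The number of blocks read is random, but any K lengths with total at least n determine the
    prefix. B is the case where no K suffices and [nblocks] takes its default value 0. *)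
Lemma measurable_prefix (s : {RV P >-> bool}) (b : nat -> {RV P >-> nat}) n u :
  measurable [set w | prefix_bstring (s w) (fun i => b i w) n = u].
Proof.
pose Z K w := (s w, map (fun i => b i w) (iota 0 K)).
have mZ K (Q : bool * seq nat -> Prop) : measurable [set w | Q (Z K w)].
  apply: measurable_discrete => -[c r].
  rewrite (_ : [set w | _] = [set w | s w = c] `&` [set w | map (fun i => b i w) (iota 0 K) = r]).
    apply: measurableI; first exact: measurable_RV_fiber.
    by apply: measurable_map_fiber => i k; exact: measurable_RV_fiber.
  by apply/seteqP; split=> w; rewrite /Z /= => -[-> ->].
pose sumK (r : seq nat) K := (\sum_(i < K) nth 0 r i)%N.
have sumE K w : sumK (Z K w).2 K = (\sum_(i < K) b i w)%N.
  by apply: eq_bigr => i _; rewrite (nth_map 0%N) ?size_iota // nth_iota.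
pose A K := [set w | (n <= sumK (Z K w).2 K)%N /\
   prefix_bstring (Z K w).1 (nth 0%N (Z K w).2) n = u].
pose B := [set w | forall K, (sumK (Z K w).2 K < n)%N] `&` [set w | (s w, [::]) = u].
rewrite (_ : [set w | _] = (\bigcup_K A K) `|` B).
  apply: measurableU.
    apply: bigcupT_measurable => K.
    exact: (mZ K (fun z => (n <= sumK z.2 K)%N /\ prefix_bstring z.1 (nth 0%N z.2) n = u)).
  apply: measurableI; last exact: (mZ 0%N (fun z => (z.1, [::]) = u)).
  rewrite (_ : [set w | _] = \bigcap_K [set w | (sumK (Z K w).2 K < n)%N]).
    by apply: bigcapT_measurable => K; exact: (mZ K (fun z => (sumK z.2 K < n)%N)).
  by apply/seteqP; split=> w H K; [move=> _|]; exact: H.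
have ext K w : (n <= sumK (Z K w).2 K)%N ->
    prefix_bstring (Z K w).1 (nth 0%N (Z K w).2) n = prefix_bstring (s w) (fun i => b i w) n.
  rewrite sumE => h; apply/esym; apply: (prefix_bstring_ext _ h) => i iK.
  by rewrite (nth_map 0%N) ?size_iota // nth_iota.
apply/seteqP; split=> w /=.
  move=> E; have [[K hK]|no] := pselect (exists K, (n <= sumK (Z K w).2 K)%N).
    by left; exists K => //; split=> //; rewrite ext.
  right; split.
    by move=> K /=; rewrite ltnNge; apply/negP => h; apply: no; exists K.
  rewrite -E /prefix_bstring /nblocks; case: pselect => // -[K hK].
  by exfalso; apply: no; exists K; rewrite sumE.
move=> [[K _ [hK <-]]|[no /= <-]]; first by rewrite ext.
rewrite /prefix_bstring /nblocks; case: pselect => // -[K hK].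
by have := no K; rewrite sumE ltnNge hK.
Qed.

End PrefixMeasurable.

Section GoodEvent.
Context {R : realType}.
Variables (l n : nat) (t : R) (b : nat -> nat).
Hypothesis hl : (0 < l)%N.
Hypothesis bi : forall i, b i \in idx l.
Let cnt v k := count (fun i => b i == v) (iota 0 k).
Hypothesis good : forall k, (k <= 4 * n)%N -> (n <= 2 * l.+1 * k)%N ->
  forall v, v \in idx l -> (1 / 3 - t) * k%:R <= (cnt v k)%:R.

Lemma cnt_sum k : (cnt l.-1 k + cnt l k + cnt l.+1 k = k)%N.
Proof.
rewrite -[RHS](size_iota 0) -(count_predT (iota 0 k)) /cnt.
elim: (iota 0 k) => //= i r IH; rewrite -IH.
by have := bi i; rewrite !inE; do 3 case: eqP; lia.
Qed.

Lemma sum_blocks_cnt k : (\sum_(i < k) b i + cnt l.-1 k = l * k + cnt l.+1 k)%N.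
Proof.
rewrite -(big_mkord xpredT b) /index_iota subn0 /cnt.
have -> : (l * k = l * size (iota 0 k))%N by rewrite size_iota.
elim: (iota 0 k) => [|i r IH] /=; first by rewrite big_nil muln0.
rewrite big_cons; have := bi i; rewrite !inE mulnS.
by do 3 case: eqP; lia.
Qed.

Hypothesis t01 : 0 <= t <= 1 / 10.

(** Blocks of length l and l + 1 contribute at least 1 and 2 letters, hence the total is at least 3
    (1/3 - t) 4 n >= n. This covers l = 1, where blocks may be empty. *)
Lemma good_total : (n <= \sum_(i < 4 * n) b i)%N.
Proof.
have [->//|n0] := posnP n.
have nn : (n <= 2 * l.+1 * (4 * n))%N by nia.
have g1 := good (leqnn _) nn (_ : l.+1 \in idx l).
have g2 := good (leqnn _) nn (_ : l \in idx l).
have := g1; rewrite !inE eqxx !orbT => /(_ isT) {}g1.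
have := g2; rewrite !inE eqxx !orbT => /(_ isT) {}g2.
have := sum_blocks_cnt (4 * n)%N; have := cnt_sum (4 * n)%N.
move: g1 g2; move: (cnt l.-1 _) (cnt l _) (cnt l.+1 _) (\sum_(i < _) _)%N => x y z S g1 g2 c1 c2.
have n0R : 0 < n%:R :> R by rewrite ltr0n.
have h : (4 * n)%:R = 4 * n%:R :> R by rewrite natrM.
rewrite h in g1 g2.
have : n%:R <= (y + 2 * z)%:R :> R.
  rewrite natrD natrM.
  have : t * n%:R <= 1 / 10 * n%:R by apply: ler_wpM2r; [exact: ltW|]; case/andP: t01.
  by move: g1 g2 n0R; lra.
rewrite ler_nat => h2; apply: leq_trans h2 _.
by move: c1 c2 hl; clear; nia.
Qed.

Lemma good_nblocks_le : (nblocks b n <= 4 * n)%N.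
Proof. by have [] := nblocksP good_total. Qed.

(** Puts the number of blocks into the range of [good]; the factor 2 there also admits this number
    minus one, used in [n_lower]. *)
Lemma nblocks_lower : (n <= l.+1 * nblocks b n)%N.
Proof.
have [_ h _] := nblocksP good_total; apply: leq_trans h _.
have := sum_blocks_cnt (nblocks b n); have := cnt_sum (nblocks b n).
by rewrite mulSn; lia.
Qed.

Lemma good_count v : v \in idx l ->
  (1 / 3 - t) * (nblocks b n)%:R <= (cnt v (nblocks b n))%:R.
Proof.
by apply: good; [exact: good_nblocks_le | have := nblocks_lower; lia].
Qed.

(** The total of k blocks is l k plus the number of long ones minus the number of short ones. As
    each length occurs at least (1/3 - t) k times, none occurs more than (1/3 + 2 t) k times, and
    the difference is at most 3 t k. *)
Lemma n_upper : n%:R <= (l%:R + 3 * t) * (nblocks b n)%:R.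
Proof.
have [_ h _] := nblocksP good_total.
have hn : n%:R <= (\sum_(i < nblocks b n) b i)%:R :> R by rewrite ler_nat.
have g1 := good_count (_ : l.-1 \in idx l).
have g2 := good_count (_ : l \in idx l).
have := g1; rewrite !inE eqxx => /(_ isT) {}g1.
have := g2; rewrite !inE eqxx orbT => /(_ isT) {}g2.
have := sum_blocks_cnt (nblocks b n); have := cnt_sum (nblocks b n).
move: hn g1 g2; move: (cnt l.-1 _) (cnt l _) (cnt l.+1 _) (\sum_(i < _) _)%N => x y z S hn g1 g2.
move=> /(congr1 (fun m => m%:R : R)); rewrite !natrD => c1.
move=> /(congr1 (fun m => m%:R : R)); rewrite !natrD natrM => c2.
by move: hn g1 g2 c1 c2; lra.
Qed.

(** The same estimate for all blocks but the last, whose total is below n. *)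
Lemma n_lower : (l.+1 < n)%N -> (l%:R - 3 * t) * ((nblocks b n)%:R - 1) <= n%:R.
Proof.
move=> ln; have [_ h1 h2] := nblocksP good_total.
have a2 : (1 < nblocks b n)%N by have := nblocks_lower; move: ln; clear; nia.
have ak : ((nblocks b n).-1 <= 4 * n)%N by have := good_nblocks_le; lia.
have an : (n <= 2 * l.+1 * (nblocks b n).-1)%N.
  by have := nblocks_lower; move: a2; clear; nia.
have hk : ((nblocks b n).-1 < nblocks b n)%N by rewrite prednK // ltnW.
have hn : (\sum_(i < (nblocks b n).-1) b i)%:R <= n%:R :> R.
  by rewrite ler_nat; exact: ltnW (h2 _ hk).
have g1 := good ak an (_ : l.+1 \in idx l).
have g2 := good ak an (_ : l \in idx l).
have := g1; rewrite !inE eqxx !orbT => /(_ isT) {}g1.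
have := g2; rewrite !inE eqxx !orbT => /(_ isT) {}g2.
have -> : (nblocks b n)%:R - 1 = (nblocks b n).-1%:R :> R.
  by rewrite -{1}(prednK (ltnW a2)) -natr1 addrK.
have := sum_blocks_cnt (nblocks b n).-1; have := cnt_sum (nblocks b n).-1.
move: hn g1 g2; move: (cnt l.-1 _) (cnt l _) (cnt l.+1 _) (\sum_(i < _) _)%N => x y z S hn g1 g2.
move=> /(congr1 (fun m => m%:R : R)); rewrite !natrD => c1.
move=> /(congr1 (fun m => m%:R : R)); rewrite !natrD natrM => c2.
by move: hn g1 g2 c1 c2; lra.
Qed.

(** One block is subtracted because the last one may be cut off. *)
Lemma blocks_lower s v : v \in idx l ->
  (1 / 3 - t) * (nblocks b n)%:R - 1 <= (size (blocks_of_length v (prefix_bstring s b n)))%:R.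
Proof.
move=> vi; rewrite lerBlDr natr1; apply: le_trans (good_count vi) _.
rewrite ler_nat /blocks_of_length size_filter size_prefix /cnt.
case Ea : (nblocks b n) => [//|a].
rewrite -addn1 iotaD !count_cat /= add0n !addn0.
rewrite (_ : count (fun i => b i == v) (iota 0 a) =
  count (fun i => nth 0 (prefix_bstring s b n).2 i == v) (iota 0 a))%N.
  by rewrite -addnS leq_add2l; case: (b a == v).
apply: eq_in_count => i; rewrite mem_iota add0n /= => ia.
by rewrite (nth_prefix_inner s good_total) // Ea ltnS.
Qed.

End GoodEvent.

Lemma subseq_head_singletons (gs : seq (seq nat * seq nat)) :
  subseq [seq head 0%N g.1 | g <- gs & singletons g] (flatten (unzip1 gs)) /\
  subseq [seq head 0%N g.2 | g <- gs & singletons g] (flatten (unzip2 gs)).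
Proof.
elim: gs => //= -[g h] gs [IH1 IH2]; rewrite /singletons /=.
case: andP => [[]|_] /=; last first.
  by split; apply: (subseq_trans _ (suffix_subseq _ _)).
case: g => [|x [|? ?]] // _; case: h => [|y [|? ?]] // _ /=.
by rewrite !eqxx.
Qed.

(** Distinct indices on each side are what makes the lengths in the pairs independent. *)
Lemma uniq_aligned_pairs a b r r' : sorted ltn r -> sorted ltn r' ->
  uniq (unzip1 (aligned_pairs a b r r')) /\ uniq (unzip2 (aligned_pairs a b r r')).
Proof.
move=> sr sr'; rewrite /aligned_pairs /pairs.
set gs := zip _ _; have [s1 s2] := subseq_head_singletons gs.
have zt (A B : eqType) (s : seq A) (s' : seq B) :
    subseq (unzip1 (zip s s')) s /\ subseq (unzip2 (zip s s')) s'.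
  elim: s s' => [|x s IH] [|y s'] //=; rewrite ?sub0seq //.
  by rewrite !eqxx; exact: IH.
have [z1 z2] := zt _ _ (key_runs odd r) (key_runs odd r').
have f1 : subseq (flatten (unzip1 gs)) r.
  by rewrite -[X in subseq _ X](flatten_grp odd r); apply: subseq_flatten.
have f2 : subseq (flatten (unzip2 gs)) r'.
  by rewrite -[X in subseq _ X](flatten_grp odd r'); apply: subseq_flatten.
split.
  apply: (@subseq_uniq _ _ r); last exact: sorted_uniq ltn_trans ltnn _ sr.
  apply: subseq_trans f1; apply: subseq_trans s1.
  rewrite [X in subseq _ X](_ : _ = map fst [seq (head 0%N g.1, head 0%N g.2) | g <- gs & singletons g]).
    by apply: map_subseq; exact: filter_subseq.
  by rewrite -map_comp.
apply: (@subseq_uniq _ _ r'); last exact: sorted_uniq ltn_trans ltnn _ sr'.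
apply: subseq_trans f2; apply: subseq_trans s2.
rewrite [X in subseq _ X](_ : _ = map snd [seq (head 0%N g.1, head 0%N g.2) | g <- gs & singletons g]).
  by apply: map_subseq; exact: filter_subseq.
by rewrite -map_comp.
Qed.

Lemma aligned_pairs_lt a b r r' t : t \in aligned_pairs a b r r' ->
  (t.1.+1 < a)%N && (t.2.+1 < b)%N.
Proof. by rewrite mem_filter => /andP[]. Qed.

(** Places the kept blocks of an actual alignment among the masks of the union bound. *)
Lemma kept_mask (a : nat) (r : seq nat) : sorted ltn r -> all (gtn a) r ->
  exists f : {ffun 'I_a -> bool}, kept f = r /\ #|[pred i | ~~ f i]| = (a - size r)%N.
Proof.
move=> sr ar; exists [ffun i : 'I_a => val i \in r].
have E := sorted_ltn_filter_iota sr ar.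
have K : kept [ffun i : 'I_a => val i \in r] = r.
  transitivity [seq i <- iota 0 a | i \in r]; last by rewrite -E.
  rewrite -val_enum_ord filter_map /kept.
  by rewrite (eq_filter (a2 := preim val (mem r))) // => i; rewrite ffunE.
split=> //.
have := cardC [pred i | [ffun i : 'I_a => val i \in r] i]; rewrite card_ord.
have -> : size r = #|[pred i | [ffun i : 'I_a => val i \in r] i]|.
  rewrite -[in LHS]K /kept size_map -sum1_size big_filter big_enum_cond /= sum1_card.
  by apply: eq_card.
move=> /(congr1 (subn^~ #|[pred i | [ffun i : 'I_a => val i \in r] i]|)).
by rewrite addKn => <-; apply: eq_card => i; rewrite !inE.
Qed.

(** An empty block contains no position, so every alignment leaves it out; this will exclude l =
    1. *)
Lemma left_out_empty u ps : (size (blocks_of_length 0 u) <= left_out u.2 ps)%N.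
Proof.
rewrite /left_out -size_filter; apply: uniq_leq_size; first exact: filter_uniq (iota_uniq _ _).
move=> i; rewrite !mem_filter => /andP[/eqP i0 ii]; rewrite ii andbT.
move: ii; rewrite mem_iota add0n /= => iu; apply/allP => t _; rewrite (take_nth 0%N iu) sumn_rcons i0 addn0.
by rewrite ltnNge andbN.
Qed.

Lemma count_idx (l : nat) (f : nat * nat -> nat * nat) (s : seq (nat * nat)) : (0 < l)%N ->
  (forall t, t \in s -> (f t).1 \in idx l /\ (f t).2 \in idx l) ->
  (\sum_(i <- idx l) \sum_(j <- idx l)
    count (fun t => ((f t).1 == i) && ((f t).2 == j)) s = size s)%N /\
  forall i, (count (fun t => (f t).1 == i) s = \sum_(j <- idx l)
    count (fun t => ((f t).1 == i) && ((f t).2 == j)) s)%N.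
Proof.
move=> l0 H.
have D i k : i \in idx l -> (\sum_(j <- idx l) ((i == j) && k) = k)%N.
  rewrite !inE !big_cons big_nil addn0.
  by case/or3P=> /eqP ->; case: k => /=; do 2 case: eqP; lia.
elim: s H => [|t s IH] H /=.
  by split=> [|i]; rewrite big1 // => i _; rewrite big1.
have [ti tj] := H t (mem_head _ _).
have [IH1 IH2] := IH (fun z zs => H z (mem_behead (s := t :: s) zs)).
split=> [|i].
  under eq_bigr do rewrite big_split /=.
  rewrite big_split /= IH1 -add1n; congr (_ + _)%N.
  rewrite -[RHS](D _ true ti); apply: eq_bigr => i _.
  rewrite andbT -[RHS](D _ _ tj); apply: eq_bigr => j _.
  by rewrite andbC.
rewrite big_split /= IH2; congr (_ + _)%N.
by rewrite -[LHS](D _ _ tj); apply: eq_bigr => j _; rewrite andbC.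
Qed.

Section Scale.
Context {R : realType}.

(** With t = kappa / 12 the bounds on n determine a as n / l up to a relative error of about kappa /
    4 and one block, which 2 <= kappa n / l absorbs. *)
Lemma scale_bounds (l n a kappa : R) : 1 <= l -> 0 < kappa < 1 / 100 ->
  2 <= kappa * (n / l) -> 0 <= a ->
  n <= (l + 3 * (kappa / 12)) * a -> (l - 3 * (kappa / 12)) * (a - 1) <= n ->
  (1 - kappa) * (n / l) <= a <= (1 + kappa) * (n / l).
Proof.
move=> l1 /andP[k0 k1] kx a0 h1 h2.
have l0 : 0 < l by exact: lt_le_trans l1.
move: kx; move En : (n / l) => x kx.
have {}En : n = l * x by rewrite -En mulrC divfK // gt_eqF.
rewrite En in h1 h2.
have x0 : 0 < x by rewrite -(pmulr_rgt0 _ k0); apply: lt_le_trans kx.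
have g1 : x <= (1 + kappa / 4) * a.
  rewrite -(ler_pM2l l0); apply: le_trans h1 _; rewrite [leRHS]mulrA ler_wpM2r //.
  have := ler_wpM2r (ltW k0) l1; lra.
have g2 : (1 - kappa / 4) * (a - 1) <= x.
  have [a1|a1] := leP 1 a.
    rewrite -(ler_pM2l l0); apply: le_trans h2; rewrite [leLHS]mulrA ler_wpM2r ?subr_ge0 //.
    have := ler_wpM2r (ltW k0) l1; lra.
  apply: (@le_trans _ _ 0); last exact: ltW.
  by rewrite mulr_ge0_le0 //; lra.
apply/andP; split.
  have k10 : 0 <= 1 - kappa by lra.
  have := ler_wpM2l k10 g1.
  have : 0 <= kappa * a by apply: mulr_ge0 => //; exact: ltW.
  have : 0 <= kappa * (kappa * a) by apply: mulr_ge0; [exact: ltW|apply: mulr_ge0 => //; exact: ltW].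
  lra.
have k20 : 0 <= 1 + kappa / 2 by lra.
have := ler_wpM2l k20 g2.
have [a1|a1] := leP 1 a; last first.
  by move=> _; lra.
have : 0 <= kappa * (1 - kappa / 2) * (a - 1).
  by apply: mulr_ge0; [apply: mulr_ge0|]; lra.
lra.
Qed.

End Scale.

(* The lower bound on k only excludes k too small for a union bound; the number
   of blocks of both strings lies in the remaining range. *)
Definition balanced (d : measure_display) (T : measurableType d) (R : realType)
    (P : probability T R) (l : nat) (BX BY : nat -> {RV P >-> nat}) (t : R) (n : nat) (w : T) :
  Prop :=
  forall z k, (k <= 4 * n)%N -> (n <= 2 * l.+1 * k)%N -> forall v, v \in idx l ->
    (1 / 3 - t) * k%:R <= (count (fun i => block BX BY (z, i) w == v) (iota 0 k))%:R.

(** A statement about a single outcome: an optimal alignment is passed to [modification_bound] and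
    its counts to [modification_gain]. All probability sits in the hypotheses on w. *)
Lemma balanced_gain (d : measure_display) (T : measurableType d) (R : realType)
    (P : probability T R) (l : nat) (BX BY : nat -> {RV P >-> nat}) (sX sY : {RV P >-> bool})
    (q0 eps delta : R) (hl : (0 < l)%N) :
  let X n w := prefix_bstring (sX w) (fun i => BX i w) n in
  let Y n w := prefix_bstring (sY w) (fun i => BY i w) n in
  0 <= q0 < 1 / 24 -> 0 < eps -> 0 < delta ->
  (forall p : nat -> nat -> R,
    (1 / 3 - q0) / 2 <= \sum_(j <- idx l) p l.-1 j ->
    (1 / 3 - q0) / 2 <= \sum_(j <- idx l) p l.+1 j ->
    \sum_(i <- idx l) \sum_(j <- idx l) p i j = 1 ->
    (forall i j, i \in idx l -> j \in idx l -> 0 <= p i j) ->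
    - delta <= 2 * entropy q0 + (1 - 4 * q0) * (ln (1 / 9) + entropy_p l p) ->
    3 / 2 * eps < objective l q0 p) ->
  exists2 kappa : R, 0 < kappa < 1 / 100 & exists x0 : R, forall n w,
  x0 <= n%:R -> regular l BX BY w -> balanced l BX BY (kappa / 12) n w ->
  ~ atypical_event l BX BY q0 (kappa * (n%:R / l%:R)) (4 * n) w ->
  few_left_out q0 (X n w) (Y n w) ->
  [/\ (1 < l)%N, (0 < size (blocks_of_length l.-1 (X n w)))%N,
    (0 < size (blocks_of_length l.+1 (X n w)))%N &
    eps * (size (blocks_of_length l.-1 (X n w)) * size (blocks_of_length l.+1 (X n w)))%:R <=
    (\sum_(i <- blocks_of_length l.-1 (X n w)) \sum_(j <- blocks_of_length l.+1 (X n w))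
        lcs (letters (modify l (X n w) i j)) (letters (Y n w)))%:R -
    (lcs (letters (X n w)) (letters (Y n w)) *
      (size (blocks_of_length l.-1 (X n w)) * size (blocks_of_length l.+1 (X n w))))%:R].
Proof.
move=> X Y q0b e0 d0 rob.
have [kappa kb [x0 MG]] := modification_gain hl q0b e0 d0 rob.
exists kappa => //.
have /andP[k0 k1] := kb.
have l0R : 0 < l%:R :> R by rewrite ltr0n.
have l1R : 1 <= l%:R :> R by rewrite ler1n.
(* The three terms give x0 <= n / l, then kappa n / l >= 2, then n > l + 1 and n / l >= 200. *)
exists (Num.max (l%:R * x0) (Num.max (l%:R * (2 / kappa)) (200 * l%:R + 2))).
move=> n w; rewrite !ge_max => /and3P[n1 n2 n3] reg bal nat_ few.
have {}n1 : x0 <= n%:R / l%:R by rewrite ler_pdivlMr // mulrC.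
have {}n2 : 2 <= kappa * (n%:R / l%:R).
  by rewrite mulrC -ler_pdivrMr // ler_pdivlMr // mulrC.
have n4 : (l.+1 < n)%N.
  rewrite -(ltr_nat R) -natr1; apply: lt_le_trans n3; lra.
have x200 : (200 : R) <= n%:R / l%:R by rewrite ler_pdivlMr //; lra.
pose b z i := block BX BY (z, i) w.
have bi z i : b z i \in idx l by exact: reg.
have t01 : 0 <= kappa / 12 <= 1 / 10 by lra.
have gd z := @good_total R l n (kappa / 12) (b z) hl (bi z) (bal z) t01.
have low z := @n_lower R l n (kappa / 12) (b z) hl (bi z) (bal z) t01 n4.
have upp z := @n_upper R l n (kappa / 12) (b z) hl (bi z) (bal z) t01.
have le4 z := @good_nblocks_le R l n (kappa / 12) (b z) hl (bi z) (bal z) t01.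
have cntb z s v := @blocks_lower R l n (kappa / 12) (b z) hl (bi z) (bal z) t01 s v.
have sc z := scale_bounds l1R kb n2 (ler0n R _) (upp z) (low z).
set u := X n w; set v := Y n w.
have su : size u.2 = nblocks (b true) n by rewrite size_prefix.
have sv : size v.2 = nblocks (b false) n by rewrite size_prefix.
set N := size (blocks_of_length l.-1 u); set N' := size (blocks_of_length l.+1 u).
have hB x : x \in idx l -> (1 / 3 - kappa) * (size u.2)%:R - 1 <= (size (blocks_of_length x u))%:R.
  move=> xi; have := cntb true (sX w) x xi; rewrite -/(X n w) -/u su.
  have : 0 <= kappa * (nblocks (b true) n)%:R by rewrite mulr_ge0 // ltW.
  by clear; lra.
have [i1 [i2 i3]] : l.-1 \in idx l /\ l \in idx l /\ l.+1 \in idx l.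
  by rewrite !inE !eqxx !orbT.
have hN : _ <= N%:R := hB _ i1.
have hN' : _ <= N'%:R := hB _ i3.
have [a opt lopt] := optimal_alignment_exists (letters u) (letters v).
have [fu fv] := few _ opt.
pose s := left_out u.2 (unzip1 a); pose s' := left_out v.2 (unzip2 a).
rewrite -/s -/u in fu; rewrite -/s' -/v in fv.
have sizeu := sc true; have sizev := sc false; rewrite -su in sizeu; rewrite -sv in sizev.
have u90 : 90 <= (size u.2)%:R :> R.
  have := ler_wpM2r (ler0n R n) (ltW k1) => kn.
  case/andP: sizeu => h _; apply: le_trans h.
  by have := ler_wpM2r (le_trans (ler0n R 200) x200) (ltW k1); move: x200; clear; lra.
have vu : (size v.2)%:R <= 2 * (size u.2)%:R :> R.
  have x0' := le_trans (ler0n R 200) x200.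
  have := ler_wpM2r x0' (ltW k1); case/andP: sizeu => h _; case/andP: sizev => _ h'.
  by move: h h' x0'; clear; lra.
have qu : q0 * (size u.2)%:R <= 1 / 24 * (size u.2)%:R.
  by apply: ler_wpM2r => //; case/andP: q0b => _ /ltW.
have qv : q0 * (size v.2)%:R <= 1 / 24 * (size v.2)%:R.
  by apply: ler_wpM2r => //; case/andP: q0b => _ /ltW.
have ku : kappa * (size u.2)%:R <= 1 / 100 * (size u.2)%:R.
  by apply: ler_wpM2r => //; exact: ltW.
have l1 : (1 < l)%N.
  (* For l = 1 about a third of the blocks are empty, hence left out. *)
  rewrite ltn_neqAle hl andbT; apply/eqP => el.
  have := left_out_empty u (unzip1 a); rewrite -(ler_nat R).
  move: hN; rewrite /N -el /= -/s.
  by move: fu qu ku u90; clear; lra.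
have inner z st i : (i.+1 < nblocks (b z) n)%N ->
    nth 0%N (prefix_bstring st (b z) n).2 i = b z i by apply: nth_prefix_inner (gd z).
have lenb z st i : (i < nblocks (b z) n)%N ->
    (0 < nth 0%N (prefix_bstring st (b z) n).2 i <= l.+1)%N.
  move=> ib; have [h1 h2] := nth_prefix_bound st (gd z) ib.
  have := bi z i; rewrite mem_idx // => /andP[b1 b2].
  by rewrite h2 ?(leq_trans h1) //; apply: leq_trans b1; rewrite -ltnS prednK.
have u1 i : (i < size u.2)%N -> (0 < nth 0%N u.2 i <= l.+1)%N.
  by rewrite su; exact: lenb.
have v1 i : (i < size v.2)%N -> (0 < nth 0%N v.2 i <= l.+1)%N.
  by rewrite sv; exact: lenb.
have uE i : (i.+1 < size u.2)%N -> nth 0%N u.2 i = b true i by rewrite su; exact: inner.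
have vE i : (i.+1 < size v.2)%N -> nth 0%N v.2 i = b false i by rewrite sv; exact: inner.
have u2 i : (i.+1 < size u.2)%N -> (l.-1 <= nth 0%N u.2 i)%N.
  by move=> /uE ->; have := bi true i; rewrite mem_idx // => /andP[].
have v2 i : (i.+1 < size v.2)%N -> (l.-1 <= nth 0%N v.2 i)%N.
  by move=> /vE ->; have := bi false i; rewrite mem_idx // => /andP[].
have [gain [loss [[hL G1 G2 L1] [L2 hQ]]]] := modification_bound l1 u1 v1 u2 v2 opt.1 lopt.
rewrite -/s -/s' -/N -/N' in hL G1 G2 L1 L2 hQ.
move: hL G1 G2 L1 L2 hQ; set prs := aligned_pairs _ _ _ _ => hL G1 G2 L1 L2 hQ.
have [un1 un2] : uniq (unzip1 prs) /\ uniq (unzip2 prs).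
  by apply: uniq_aligned_pairs; exact: sorted_aligned_blocks.
have prsP t : t \in prs -> (t.1.+1 < size u.2)%N /\ (t.2.+1 < size v.2)%N.
  by move=> /aligned_pairs_lt /andP[].
pose f (t : nat * nat) := (nth 0%N u.2 t.1, nth 0%N v.2 t.2).
have fi t : t \in prs -> (f t).1 \in idx l /\ (f t).2 \in idx l.
  by move=> /prsP[t1 t2]; rewrite /f /= uE // vE //; split; exact: bi.
have [cM cQ] := count_idx hl fi.
pose c i j := count (fun t => ((f t).1 == i) && ((f t).2 == j)) prs.
rewrite -/(c l.-1 l) -/(c l.-1 l.+1) in G1.
rewrite -/(c l.-1 l.-1) in G2; rewrite -/(c l.+1 l.+1) in L1.
rewrite -/(c l.+1 l.-1) -/(c l.+1 l) in L2.
have Ma : (size prs <= size u.2)%N.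
  rewrite -(size_map fst) -(size_iota 0 (size u.2)); apply: uniq_leq_size => //.
  by move=> _ /mapP[t tp ->]; rewrite mem_iota; have [/ltnW] := prsP _ tp.
have aM : (size u.2 <= size prs + 3 * s + s' + 2)%N.
  have := hQ predT; rewrite count_predT size_iota.
  by rewrite (_ : count (fun t => predT t.1) prs = size prs) //; exact: count_predT.
have hrow x : (size (blocks_of_length x u) <= \sum_(j <- idx l) c x j + 3 * s + s' + 2)%N.
  by have := hQ (fun i => nth 0%N u.2 i == x); rewrite -size_filter cQ.
have natle (x y : nat) : (x <= y)%N -> x%:R <= y%:R :> R by rewrite ler_nat.
have aMR := natle _ _ aM; rewrite natrD natrD natrD natrM in aMR.
have m0 : (0 < size prs)%N.
  rewrite -(ltr0n R); move: aMR u90 fu fv qu qv vu; clear; lra.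
pose C i j : R := (c i j)%:R.
have CM : \sum_(i <- idx l) \sum_(j <- idx l) C i j = (size prs)%:R.
  by rewrite -cM natr_sum; apply: eq_bigr => i _; rewrite natr_sum.
have hE : - (kappa * (n%:R / l%:R)) <= (size u.2)%:R * entropy q0 + (size v.2)%:R * entropy q0 +
    (size prs)%:R * (ln (1 / 9) + entropy_p l (fun i j => C i j / (size prs)%:R)).
  (* If the inequality failed, the actual numbers of blocks, the masks of the kept blocks and the
     observed type of the pairs would witness [atypical_event]. *)
  rewrite leNgt; apply/negP => hlt; apply: nat_.
  have au : (size u.2 < (4 * n).+1)%N by rewrite ltnS su; exact: le4.
  have av : (size v.2 < (4 * n).+1)%N by rewrite ltnS sv; exact: le4.
  pose c' (x y : 'I_3) := c (l.-1 + x)%N (l.-1 + y)%N.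
  pose cf := [ffun z : 'I_3 * 'I_3 => inord (c' z.1 z.2) : 'I_(4 * n).+1].
  have cfE : (fun x y : 'I_3 => cf (x, y) : nat) = c'.
    apply/funext => x; apply/funext => y; rewrite ffunE inordK //.
    apply: leq_ltn_trans au; apply: leq_trans Ma; exact: count_size.
  have [f1 [kf1 df1]] := kept_mask (sorted_aligned_blocks u.2 (unzip1 a)) (aligned_blocks_bound u.2 (unzip1 a)).
  have [f2 [kf2 df2]] := kept_mask (sorted_aligned_blocks v.2 (unzip2 a)) (aligned_blocks_bound v.2 (unzip2 a)).
  have kE : kept_pairs f1 f2 = prs by rewrite /kept_pairs kf1 kf2.
  have c'M : (\sum_x \sum_y c' x y)%N = size prs.
    apply/eqP; rewrite -(eqr_nat R) -CM natr_sum sum_idx_ord //; apply/eqP.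
    by apply: eq_bigr => x _; rewrite natr_sum sum_idx_ord.
  exists ((Ordinal au, Ordinal av), cf), (f1, f2); split.
    rewrite /atypical cfE /= kE; split => //.
    - by rewrite df1 df2 -(size_aligned_blocks u.2 (unzip1 a)) -(size_aligned_blocks v.2 (unzip2 a)) !addnK !size_aligned_blocks fu fv.
    - by rewrite un1 un2.
    - by rewrite -c'M -cfE.
    rewrite (_ : entropy_p l (empirical l c') = entropy_p l (fun i j => C i j / (size prs)%:R)) //.
    rewrite !entropy_p_ord //; apply: eq_bigr => x _; apply: eq_bigr => y _.
    by rewrite empiricalE c'M.
  rewrite cfE /= kE; split.
    by move=> t _; split; exact: reg.
  move=> x y; rewrite /pair_count /c' /c; apply: eq_in_count => t /prsP[t1 t2].
  by rewrite /f /= uE // vE.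
have C0 i j : 0 <= C i j by exact: ler0n.
have [N0 N0' fin] := MG (n%:R / l%:R) (size u.2)%:R (size v.2)%:R N%:R N'%:R s%:R s'%:R
  gain%:R loss%:R (size prs)%:R C n1 sizeu sizev hN hN' fu fv C0
  ltac:(by rewrite -natrD; exact: natle)
  ltac:(by rewrite -natrM -!natrD; exact: natle)
  ltac:(by rewrite -!natrD; exact: natle)
  ltac:(by rewrite -!natrD; exact: natle)
  CM (natle _ _ Ma) ltac:(by rewrite -natrM -!natrD; exact: natle)
  ltac:(by rewrite -natr_sum -natrM -!natrD; apply: natle; exact: hrow)
  ltac:(by rewrite -natr_sum -natrM -!natrD; apply: natle; exact: hrow) hE.
rewrite !ltr0n in N0 N0'; split=> //.
have := natle _ _ hL; rewrite !natrD !natrM.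
have NN : 0 < (N%:R * N'%:R : R) by rewrite mulr_gt0 // ltr0n.
have := ler_wpM2r (ltW NN) fin.
have -> : (gain%:R / N%:R - loss%:R / N'%:R) * (N%:R * N'%:R) = N'%:R * gain%:R - N%:R * loss%:R :> R.
  by field; rewrite !pnatr_eq0 -!lt0n N0 N0'.
by clear; lra.
Qed.

(** * The conditional mean of the modification *)

(** The events [E i] have equal probability and Z is constant on each. Their probabilities add up to
    that of the conditioning event, so what they miss is null. *)
Lemma cond_expectation_uniform (d : measure_display) (T : measurableType d) (R : realType)
    (P : probability T R) (K : Type) (Z : T -> R) (U : T -> K) (w : T)
    (I : choiceType) (s : seq I) (E : I -> set T) (z : I -> R) (c : R) :
  (forall Q : R -> Prop, measurable [set v | Q (Z v)]) -> measurable [set v | U v = U w] -> uniq s ->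
  (forall i, measurable (E i)) -> trivIset [set` s] E ->
  (forall i v, i \in s -> E i v -> U v = U w /\ Z v = z i) ->
  0 < c -> (forall i, i \in s -> P (E i) = c%:E) ->
  P [set v | U v = U w] = ((size s)%:R * c)%:E ->
  cond_expectation P Z U w = (\sum_(i <- s) z i) / (size s)%:R.
Proof.
move=> mZ mA us mE tE EZ c0 PE PA; rewrite /cond_expectation; set A := [set v | _] in mA PA *.
have mZE (B : set T) : measurable B -> measurable_fun B (fun v => (Z v)%:E).
  by move=> mB _ Y _; apply: measurableI => //; exact: (mZ (fun r => Y r%:E)).
pose D := \bigcup_(i in [set` s]) E i.
have DE : D = \big[setU/set0]_(i <- s) E i by exact: bigcup_seq.
have mD : measurable D by rewrite DE; exact: bigsetU_measurable.
have DA : D `<=` A by move=> v [i si Ei]; have [] := EZ i v si Ei.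
have sumc : (\sum_(i <- s) c) = (size s)%:R * c.
  by rewrite big_const_seq count_predT iter_addr addr0 mulr_natl.
have PD : P D = P A.
  rewrite PA measure_fin_bigcup //= -fsbig_seq // -sumc -sumEFin.
  exact: eq_big_seq.
have PAD : P (A `\` D) = 0%E.
  have PAfin : (P A < +oo)%E by rewrite PA ltry.
  transitivity (P A - P D)%E; last by rewrite PD PA subee.
  by rewrite -{2}(setIidr DA); exact: measureD.
have -> : (\int[P]_(v in A) (Z v)%:E = \int[P]_(v in D) (Z v)%:E)%E.
  have -> : D = A `&` D by rewrite setIidr.
  rewrite integral_mkcondr; apply: ae_eq_integral => //.
  - exact: mZE.
  - by apply/measurable_restrict => //; apply: mZE; exact: measurableI.
  exists (A `\` D); split=> //; first exact: measurableD.
  move=> v /=; apply: contra_notP; rewrite /patch => nAD Av.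
  rewrite mem_set //; apply: contrapT => nD; exact: nAD.
have -> : (\int[P]_(v in D) (Z v)%:E = (\sum_(i <- s) z i * c)%:E)%E.
  rewrite DE integral_bigsetU_EFin //; last by apply: mZE; rewrite -DE.
  rewrite -sumEFin; apply: eq_big_seq => i si.
  rewrite EFinM -(PE i si) -integral_cst //; apply: eq_integral => v /set_mem Ei.
  by have [_ ->] := EZ i v si Ei.
rewrite PA /= -mulr_suml invfM mulrACA divff ?mulr1 //; exact: lt0r_neq0.
Qed.

(** Lets conditioning on the letters be replaced by conditioning on the block decompositions. An
    empty list of blocks would leave the first symbol undetermined. *)
Lemma letters_inj u v : all (leq 1) u.2 -> all (leq 1) v.2 -> u.2 != [::] ->
  letters u = letters v -> u = v.
Proof.
move=> u1 v1 u0 uv; have uv2 : u.2 = v.2 by rewrite -runs_letters // uv runs_letters.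
case: u v uv2 u1 v1 u0 uv => s bs [s' _] /= <-; case: bs => // b bs /andP[b0 _] _ _.
by rewrite !letters_cons; case: b b0 => //= b _ [->].
Qed.

Lemma regular_prefix_pos (b : nat -> nat) l n s : (1 < l)%N -> (forall i, b i \in idx l) -> (0 < n)%N ->
  all (leq 1) (prefix_bstring s b n).2 /\ (prefix_bstring s b n).2 != [::].
Proof.
move=> l1 bi n0; have b0 i : (0 < b i)%N by have := bi i; rewrite mem_idx; lia.
have nn : (n <= \sum_(i < n) b i)%N.
  rewrite -{1}(card_ord n) -sum1_card; exact: leq_sum.
split.
  apply/(all_nthP 0%N) => i; rewrite size_prefix => ik.
  by have [_] := nth_prefix_bound s nn ik; exact.
rewrite -size_eq0 size_prefix; apply/negP => /eqP k0.
by have [_ + _] := nblocksP nn; rewrite k0 big_ord0; lia.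
Qed.

Lemma uniq_blocks_of_length k u : uniq (blocks_of_length k u).
Proof. exact/filter_uniq/iota_uniq. Qed.

(** The fibre of the letters and the fibre of (X, Y) differ by irregular outcomes only, a null set;
    on the latter [uniform_choice] makes all pairs (i, j) equally likely. *)
Lemma mean_modification (d : measure_display) (T : measurableType d) (R : realType)
    (P : probability T R) (l n : nat) (BX BY : nat -> {RV P >-> nat}) (sX sY : {RV P >-> bool})
    (X Y : T -> bstring) (hX : forall w, X w = prefix_bstring (sX w) (fun i => BX i w) n)
    (hY : forall w, Y w = prefix_bstring (sY w) (fun i => BY i w) n)
    (I J : {RV P >-> nat}) (Z : T -> R)
    (hZ : forall v, Z v = (lcs (letters (modify l (X v) (I v) (J v))) (letters (Y v)))%:R
        - (lcs (letters (X v)) (letters (Y v)))%:R) (w : T) :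
  let Bm := blocks_of_length l.-1 (X w) in
  let Bp := blocks_of_length l.+1 (X w) in
  let gain i j : R := (lcs (letters (modify l (X w) i j)) (letters (Y w)))%:R
     - (lcs (letters (X w)) (letters (Y w)))%:R in
  (1 < l)%N -> (0 < n)%N -> P.-negligible (~` [set w | regular l BX BY w]) ->
  uniform_choice l X Y I J ->
  regular l BX BY w -> (0 < P [set v | X v = X w /\ Y v = Y w])%E ->
  (0 < size Bm)%N -> (0 < size Bp)%N ->
  cond_expectation P Z (fun v => (letters (X v), letters (Y v))) w =
  (\sum_(i <- Bm) \sum_(j <- Bp) gain i j) / (size Bm * size Bp)%:R.
Proof.
move=> Bm Bp gain l1 n0 [N [mN PN regN]] hIJ regw pos m0 p0.
set C := [set v | _] in pos.
have mX u : measurable [set v | X v = u] by rewrite (funext hX); exact: measurable_prefix.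
have mY u : measurable [set v | Y v = u] by rewrite (funext hY); exact: measurable_prefix.
rewrite (funext hZ).
pose V v := (X v, Y v, (I v, J v)).
have mV (Q : (bool * seq nat) * (bool * seq nat) * (nat * nat) -> Prop) : measurable [set v | Q (V v)].
  apply: measurable_discrete => -[[u u'] [i j]].
  rewrite (_ : [set v | _] = ([set v | X v = u] `&` [set v | Y v = u']) `&`
     ([set v | I v = i] `&` [set v | J v = j])).
    by apply: measurableI; apply: measurableI => //; exact: measurable_RV_fiber.
  apply/seteqP; split=> v; rewrite /V /=; move: (X v) (Y v) (I v) (J v) => x y k k'.
    by case=> -> -> -> ->.
  by case=> -[-> ->] [-> ->].
have mC : measurable C := mV (fun t => t.1.1 = X w /\ t.1.2 = Y w).
set U := fun v => (letters (X v), letters (Y v)).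
have mA : measurable [set v | U v = U w] := mV (fun t => (letters t.1.1, letters t.1.2) = U w).
have inj v : regular l BX BY v -> U v = U w -> X v = X w /\ Y v = Y w.
  move=> regv [eX eY].
  have [vX1 vX2] := regular_prefix_pos (sX v) l1 (fun i => regv (true, i)) n0.
  have [vY1 vY2] := regular_prefix_pos (sY v) l1 (fun i => regv (false, i)) n0.
  have [wX1 _] := regular_prefix_pos (sX w) l1 (fun i => regw (true, i)) n0.
  have [wY1 _] := regular_prefix_pos (sY w) l1 (fun i => regw (false, i)) n0.
  by split; apply: letters_inj => //; rewrite ?hX ?hY.
have PAC : P [set v | U v = U w] = P C.
  apply/eqP; rewrite eq_le; apply/andP; split; last first.
    by apply: le_measure; rewrite ?inE // => v [eX eY]; rewrite /U /= eX eY.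
  apply: (@le_trans _ _ (P (C `|` N))); last by rewrite measureU0.
  apply: le_measure; rewrite ?inE //; first exact: measurableU.
  move=> v Uv; have [regv|nreg] := pselect (regular l BX BY v); last by right; exact: regN.
  by left; exact: inj.
have [p PC] : exists p, P C = p%:E by exists (fine (P C)); rewrite fineK // fin_num_measure.
have p_gt0 : 0 < p by rewrite -lte_fin -PC.
have NN0 : (0 : R) < (size Bm * size Bp)%:R by rewrite ltr0n muln_gt0 m0.
rewrite (@cond_expectation_uniform _ _ _ _ _ _ _ _ _ (allpairs pair Bm Bp)
   (fun t => [set v | [/\ X v = X w, Y v = Y w, I v = t.1 & J v = t.2]])
   (fun t => gain t.1 t.2) (p / (size Bm * size Bp)%:R)) //.
- by rewrite size_allpairs big_allpairs.
- move=> Q; exact: (mV (fun t => Q ((lcs (letters (modify l t.1.1 t.2.1 t.2.2)) (letters t.1.2))%:R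
     - (lcs (letters t.1.1) (letters t.1.2))%:R))).
- by apply: allpairs_uniq; [exact: uniq_blocks_of_length..|move=> [? ?] [? ?]].
- move=> t; exact: (mV (fun t' => [/\ t'.1.1 = X w, t'.1.2 = Y w, t'.2.1 = t.1 & t'.2.2 = t.2])).
- by move=> [i j] [i' j'] _ _ [v [[/= _ _ <- <-] [/= _ _ <- <-]]].
- by move=> [i j] v _ [/= eX eY -> ->]; rewrite /U /gain eX eY.
- exact: divr_gt0.
- by move=> _ /allpairsP[[i j] [/= iB jB ->]] /=; rewrite hIJ // -/C PC natrM.
- by rewrite PAC PC size_allpairs mulrC divfK // lt0r_neq0.
Qed.

(** * Probability of the exceptional events *)

Section Unbalanced.
Context {d : measure_display} {T : measurableType d} {R : realType}.
Variable P : probability T R.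
Variables (l : nat) (BX BY : nat -> {RV P >-> nat}) (sX sY : {RV P >-> bool}).
Hypothesis hl : (0 < l)%N.
Hypothesis hmodel : block_model l BX BY sX sY.

(** Union bound over two strings, three lengths and 4 n + 1 values of k; k >= n / (2 (l + 1)) turns
    e^(- eta k) into e^(- c n). *)
Lemma unbalanced_prob (t : R) : 0 < t < 1 / 3 -> exists2 c : R, 0 < c &
  forall n, exists B, [/\ measurable B, (P B <= (6 * (4 * n).+1%:R * expR (- (c * n%:R)))%:E)%E &
    forall w, regular l BX BY w -> ~ B w -> balanced l BX BY t n w].
Proof.
move=> t01; have [eta eta0 low] := low_count hl hmodel t01.
have l2 : (0 : R) < (2 * l.+1)%:R by rewrite ltr0n.
exists (eta / (2 * l.+1)%:R); first exact: divr_gt0.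
move=> n; pose E (i : bool * 'I_3 * 'I_(4 * n).+1) : set T :=
  [set w | (n <= 2 * l.+1 * i.2)%N /\ ((forall j, (j < i.2)%N -> block BX BY (i.1.1, j) w \in idx l) /\
   (count (fun j => block BX BY (i.1.1, j) w == l.-1 + i.1.2)%N (iota 0 i.2))%:R < (1 / 3 - t) * i.2%:R)].
have HE i : measurable (E i) /\ (P (E i) <= (expR (- (eta / (2 * l.+1)%:R * n%:R)))%:E)%E.
  have [nk|nk] := boolP (n <= 2 * l.+1 * i.2)%N; last first.
    rewrite (_ : E i = set0); last by apply/seteqP; split=> w //; rewrite /E (negbTE nk) => -[].
    by split=> //; rewrite measure0 lee_fin expR_ge0.
  have [mL PL] := low i.1.1 (l.-1 + i.1.2)%N i.2 (mem_idx_add hl (ltn_ord i.1.2)).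
  rewrite /E nk (_ : [set w | _] = [set w | (forall j, (j < i.2)%N -> block BX BY (i.1.1, j) w \in idx l) /\
   (count (fun j => block BX BY (i.1.1, j) w == l.-1 + i.1.2)%N (iota 0 i.2))%:R < (1 / 3 - t) * i.2%:R]).
    split=> //; apply: le_trans PL _; rewrite lee_fin ler_expR lerN2 -mulrA.
    apply: ler_wpM2l; first exact: ltW.
    by rewrite ler_pdivrMl // -natrM ler_nat.
  by apply/seteqP; split=> w /= // [].
have mE : measurable [set w | exists i, E i w] by apply: measurable_exists => i; have [] := HE i.
exists [set w | exists i, E i w]; split=> //.
  pose I : finType := (bool * 'I_3 * 'I_(4 * n).+1)%type.
  apply: (@le_trans _ _ (\sum_(i in @predT I) P (E i))%E).
    by apply: probability_le_sum_fin => // [i|w [i ?]]; [have [] := HE i|exists i].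
  apply: (@le_trans _ _ (\sum_(i in @predT I) (expR (- (eta / (2 * l.+1)%:R * n%:R)))%:E)%E).
    by apply: lee_sum => i _; have [] := HE i.
  rewrite sumEFin lee_fin sumr_const -[leLHS]mulr_natl ler_wpM2r ?expR_ge0 //.
  have -> : #|@predT I| = #|{: I}| by apply: eq_card.
  by rewrite /I !card_prod card_bool !card_ord natrM.
move=> w reg nB z k kn nk v vl; rewrite leNgt; apply/negP => lt.
have [j vj j3] := idx_offset hl vl.
apply: nB; exists (z, Ordinal j3, Ordinal (kn : (k < (4 * n).+1)%N)).
by split=> //=; split=> [i _|]; [exact: reg | rewrite -vj].
Qed.

End Unbalanced.

(** Half of the exponent absorbs the polynomial through e^y >= y^(k + 1) / (k + 1)!; the other half
    dominates sqrt n once n >= (c / 2)^-2. *)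
Lemma poly_exp_decay (R : realType) (a c : R) (k : nat) : 0 <= a -> 0 < c -> exists N, forall n, (N <= n)%N ->
  a * n%:R ^+ k * expR (- (c * n%:R)) <= expR (- (n%:R `^ 2^-1)).
Proof.
move=> a0 c0; pose c2 := c / 2; have c20 : 0 < c2 by rewrite divr_gt0.
pose M := Num.max (c2 ^- 2) (a * (k.+1)`!%:R / c2 ^+ k.+1).
exists (Num.bound M) => n Nn.
have Mn : M <= n%:R.
  apply: (@le_trans _ _ (Num.bound M)%:R); last by rewrite ler_nat.
  apply/ltW/archi_boundP; by rewrite le_max invr_ge0 exprn_ge0 // ltW.
have n0 : (0 : R) <= n%:R by [].
move: Mn; rewrite ge_max => /andP[n1 n2].
have s1 : n%:R `^ 2^-1 <= c2 * n%:R.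
  have cn0 : 0 <= c2 * n%:R by rewrite mulr_ge0 // ltW.
  rewrite powR12_sqrt // -(@ler_pXn2r _ 2) ?nnegrE ?sqrtr_ge0 //.
  rewrite sqr_sqrtr // exprMn [n%:R ^+ 2]expr2 mulrA -[leLHS]mul1r ler_wpM2r //.
  by rewrite -ler_pdivrMl ?mulr1 ?exprn_gt0.
have s2 : a * n%:R ^+ k <= expR (c2 * n%:R).
  have := expR_ge1Dxn k (mulr_ge0 (ltW c20) n0).
  move=> h; apply: le_trans h; apply: (@le_trans _ _ ((c2 * n%:R) ^+ k.+1 / k.+1`!%:R)); last by rewrite lerDr.
  rewrite exprMn [n%:R ^+ k.+1]exprS ler_pdivlMr ?ltr0n ?fact_gt0 //.
  rewrite mulrAC mulrA ler_wpM2r ?exprn_ge0 //.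
  by rewrite [leRHS]mulrC -ler_pdivrMr ?exprn_gt0.
rewrite (_ : - (c * n%:R) = - (c2 * n%:R) + - (c2 * n%:R)); last by rewrite /c2; field.
rewrite expRD mulrA.
apply: (@le_trans _ _ (1 * expR (- (c2 * n%:R)))); last by rewrite mul1r ler_expR lerN2.
by rewrite ler_wpM2r ?expR_ge0 // expRN -ler_pdivlMr ?invr_gt0 ?expR_gt0 // invrK mul1r.
Qed.

(** From 4 n + 1 <= 5 n; the constants 60 and 2 5^11 contain a factor 2, so each term is at most
    half of the bound. *)
Lemma error_terms (R : realType) (c c' : R) : 0 < c -> 0 < c' -> exists N, forall n, (N <= n)%N ->
  6 * (4 * n).+1%:R * expR (- (c * n%:R)) + (4 * n).+1%:R ^+ 11 * expR (- (c' * n%:R)) <=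
  expR (- (n%:R `^ 2^-1)).
Proof.
move=> c0 c'0.
have [N1 H1] := poly_exp_decay 1 (ler0n R 60) c0.
have [N2 H2] := poly_exp_decay 11 (mulr_ge0 (ler0n R 2) (exprn_ge0 11 (ler0n R 5))) c'0.
exists (maxn 1 (maxn N1 N2)) => n; rewrite !geq_max => /and3P[n0 n1 n2].
have n4 : ((4 * n).+1%:R : R) <= 5 * n%:R by rewrite -natrM ler_nat; lia.
have h1 : 6 * (4 * n).+1%:R * expR (- (c * n%:R)) <= 2^-1 * (60 * n%:R ^+ 1 * expR (- (c * n%:R))).
  rewrite mulrA ler_wpM2r ?expR_ge0 // expr1; move: n4; clear; lra.
have h2 : (4 * n).+1%:R ^+ 11 * expR (- (c' * n%:R)) <= 2^-1 * (2 * 5 ^+ 11 * n%:R ^+ 11 * expR (- (c' * n%:R))).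
  rewrite mulrA ler_wpM2r ?expR_ge0 // -[2 * _ * _]mulrA mulKf // -exprMn.
  by apply: lerXn2r => //; rewrite ?nnegrE // mulr_ge0.
by move: h1 h2 (H1 n n1) (H2 n n2); clear; lra.
Qed.

(* uniform_choice only constrains (I, J) given values (u, v) of (X, Y) which have
   positive probability. *)
Lemma negligible_null_fibers (d : measure_display) (T : measurableType d) (R : realType)
    (P : probability T R) (C : countType) (Z : T -> C) :
  (forall c, measurable [set w | Z w = c]) ->
  P.-negligible [set w | P [set v | Z v = Z w] = 0%E].
Proof.
move=> mZ; set N := [set w | _].
rewrite (_ : N = \bigcup_k [set w | N w /\ choice.pickle (Z w) = k]); last first.
  by apply/seteqP; split=> [w Nw|w [k _ []//]]; exists (choice.pickle (Z w)).
apply: negligible_bigcup => k.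
have [[w [Nw <-]]|no] := pselect (exists w, N w /\ choice.pickle (Z w) = k).
  exists [set v | Z v = Z w]; split=> //.
  by move=> v [_ /(pcan_inj choice.pickleK)].
rewrite (_ : [set w | _] = set0); first exact: negligible_set0.
by apply/seteqP; split=> w //= H; exfalso; apply: no; exists w.
Qed.

Theorem theorem2p3 (d : measure_display) (T : measurableType d) (R : realType)
    (P : probability T R) (l : nat) (hl : (0 < l)%N)
    (BX BY : nat -> {RV P >-> nat}) (sX sY : {RV P >-> bool})
    (hmodel : block_model l BX BY sX sY)
    (X Y : nat -> T -> bstring)
    (hX : forall n w, X n w = prefix_bstring (sX w) (fun i => BX i w) n)
    (hY : forall n w, Y n w = prefix_bstring (sY w) (fun i => BY i w) n)
    (I J : nat -> {RV P >-> nat})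
    (hIJ : forall n, uniform_choice l (X n) (Y n) (I n) (J n))
    (L Lt : nat -> T -> nat)
    (hL : forall n w, L n w = lcs (letters (X n w)) (letters (Y n w)))
    (hLt : forall n w, Lt n w =
       lcs (letters (modify l (X n w) (I n w) (J n w))) (letters (Y n w)))
    (q0 : R) (hq0 : 0 <= q0 < 1 / 3)
    (eps : R) (heps : 0 < 2 * eps) (hmin : is_minimum l q0 (2 * eps)) :
  exists2 beta : R, 0 < beta & exists N : nat, forall n : nat, (N <= n)%N ->
    ((1 - expR (- (n%:R `^ beta)))%:E
       - P [set w | ~ few_left_out q0 (X n w) (Y n w)]
     <= P [set w | (eps <= cond_expectation P
                      (fun v => (Lt n v)%:R - (L n v)%:R)
                      (fun v => (letters (X n v), letters (Y n v))) w)%R])%E.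
Proof.
have e0 : 0 < eps by rewrite -(pmulr_rgt0 _ (ltr0n R 2)).
have q24 := minimum_q0_lt hq0 heps hmin.
have q0b : 0 <= q0 < 1 / 24 by case/andP: hq0 => -> _.
have [delta d0 rob] := minimum_robust hl hq0 heps hmin.
have [kappa /andP[k0 k1] [x0 good]] := balanced_gain BX BY sX sY hl q0b e0 d0 rob.
have t01 : 0 < kappa / 12 < 1 / 3 by apply/andP; split; lra.
have [c c0 unb] := unbalanced_prob hl hmodel t01.
have c'0 : 0 < kappa / l%:R by rewrite divr_gt0 // ltr0n.
have [N0 tail] := error_terms c0 c'0.
(* The exceptional events cost a polynomial times e^(- c n), which any power of n below the first
   dominates in the exponent; 1/2 is a convenient one. *)
exists 2^-1; first by rewrite invr_gt0.
exists (maxn 1 (maxn N0 (Num.bound `|x0|))) => n; rewrite !geq_max => /and3P[n_gt0 nN0 nx0].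
have {}nx0 : x0 <= n%:R.
  apply: le_trans (ler_norm x0) _; apply: (@le_trans _ _ (Num.bound `|x0|)%:R); last by rewrite ler_nat.
  by apply/ltW/archi_boundP.
have mX u : measurable [set v | X n v = u] by rewrite (funext (hX n)); exact: measurable_prefix.
have mY u : measurable [set v | Y n v = u] by rewrite (funext (hY n)); exact: measurable_prefix.
pose V v := (X n v, Y n v).
have mVf c1 : measurable [set v | V v = c1].
  case: c1 => u u'; rewrite (_ : [set v | _] = [set v | X n v = u] `&` [set v | Y n v = u']).
    exact: measurableI.
  apply/seteqP; split=> v; rewrite /V /=; move: (X n v) (Y n v) => x y.
    by case=> -> ->.
  by case=> -> ->.
have mV (Q : (bool * seq nat) * (bool * seq nat) -> Prop) : measurable [set v | Q (V v)].
  exact: measurable_discrete.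
set Lost := [set w | ~ few_left_out q0 (X n w) (Y n w)].
set Gain := [set w | eps <= cond_expectation _ _ _ _].
have mLost : measurable Lost := mV (fun t => ~ few_left_out q0 t.1 t.2).
(* The conditional mean depends on the outcome only through (X, Y), which takes countably many
   values. *)
have mGain : measurable Gain.
  pose U v := (letters (X n v), letters (Y n v)).
  exact: (mV (fun t => eps <= fine (\int[P]_(v in [set v | U v = (letters t.1, letters t.2)])
    ((Lt n v)%:R - (L n v)%:R)%:E) / fine (P [set v | U v = (letters t.1, letters t.2)]))).
have [B1 [mB1 PB1 hB1]] := unb n.
have q12 : 0 <= q0 <= 1 / 2 by case/andP: q0b => -> ?; lra.
have [] := atypical_prob hl hmodel (kappa * (n%:R / l%:R)) (4 * n) q12.
set B2 := atypical_event _ _ _ _ _ _ => mB2 PB2.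
have [M [mM PM hM]] := negligibleU (regular_ae hl hmodel) (negligible_null_fibers P mVf).
(* M contains the irregular outcomes and the null fibres of (X, Y). Off M and the three bad events,
   [balanced_gain] bounds the average that [mean_modification] identifies with the conditional
   mean. *)
have cover : setT `<=` (Gain `|` (Lost `|` (B1 `|` B2))) `|` M.
  move=> w _; have [Mw|nM] := pselect (M w); first by right.
  left; have [Lw|nL] := pselect (Lost w); first by right; left.
  have [B1w|nB1] := pselect (B1 w); first by right; right; left.
  have [B2w|nB2] := pselect (B2 w); first by right; right; right.
  left; have regw : regular l BX BY w by apply: contrapT => nr; apply: nM; apply: hM; left.
  have few : few_left_out q0 (X n w) (Y n w) by apply: contrapT.
  have pos : (0 < P [set v | X n v = X n w /\ Y n v = Y n w])%E.
    rewrite lt0e measure_ge0 andbT; apply/eqP => PV0; apply: nM; apply: hM; right => /=.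
    rewrite -PV0; congr (P _); apply/seteqP; split=> v; rewrite /V /=; move: (X n v) (Y n v) => x y.
      by case=> -> ->.
    by case=> -> ->.
  have := good n w nx0 regw (hB1 w regw nB1) nB2; rewrite -hX -hY => /(_ few)[l1 m0 p0 gain].
  have hZ v : (Lt n v)%:R - (L n v)%:R = (lcs (letters (modify l (X n v) (I n v) (J n v))) (letters (Y n v)))%:R
      - (lcs (letters (X n v)) (letters (Y n v)))%:R :> R by rewrite hL hLt.
  have E := mean_modification (hX n) (hY n) hZ l1 n_gt0 (regular_ae hl hmodel) (hIJ n) regw pos m0 p0.
  rewrite /Gain /= E ler_pdivlMr; last by rewrite ltr0n muln_gt0 m0.
  apply: le_trans gain _; rewrite le_eqVlt; apply/orP; left; apply/eqP.
  under [RHS]eq_bigr do rewrite sumrB.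
  rewrite sumrB natr_sum; congr (_ - _).
    by apply: eq_bigr => i _; rewrite natr_sum.
  under [RHS]eq_bigr do rewrite big_const_seq count_predT iter_addr_0.
  by rewrite big_const_seq count_predT iter_addr_0 [LHS]mulrnA mulnC mulrnA.
have fin A : measurable A -> P A = (fine (P A))%:E by move=> mA; rewrite fineK // fin_num_measure.
have : (1 <= P Gain + (P Lost + (P B1 + P B2)))%E.
  rewrite -(probability_setT P) (_ : setT = (Gain `|` (Lost `|` (B1 `|` B2))) `|` M); last first.
    by apply/seteqP; split.
  have mB : measurable (B1 `|` B2) by exact: measurableU.
  have mLB : measurable (Lost `|` (B1 `|` B2)) by exact: measurableU.
  rewrite measureU0 //; last exact: measurableU.
  apply: le_trans (measureU2 _ mGain mLB) _; apply: leeD2l.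
  apply: le_trans (measureU2 _ mLost mB) _; apply: leeD2l.
  exact: measureU2.
move: PB1 PB2 (tail n nN0); rewrite mulrA mulrAC [kappa * _ / _]mulrAC.
rewrite (fin _ mGain) (fin _ mLost) (fin _ mB1) (fin _ mB2) -EFinB -!EFinD !lee_fin.
by clear; lra.
Qed.
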